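(* Let $D\subset\mathbb C^n$ be a bounded convex domain with $\mathcal C^\infty$ boundary. If all but finitely many points $p\in\partial D$ are of finite D'Angelo type, then $D$ has the visibility property.
   Context: For a domain $D\subset\mathbb C^n$, the Kobayashi–Royden (pseudo)metric is $\kappa_D(z;X)=\inf\{|\alpha|:\exists\varphi\in\mathcal O(\mathbb D,D),\ \varphi(0)=z,\ \alpha\varphi'(0)=X\}$ and the Kobayashi (pseudo)distance is $k_D(x,y)=\inf_\gamma\int_0^1\kappa_D(\gamma(t);\gamma'(t))\,dt$ over piecewise $\mathcal C^1$ curves $\gamma:[0,1]\to D$ from $x$ to $y$. $D$ is complete hyperbolic if $k_D$ is a complete distance (bounded convex domains are complete hyperbolic). A geodesic is a curve $\sigma:I\to D$ on an interval $I\subset\mathbb R$ with $k_D(\sigma(s),\sigma(t))=|s-t|$ for all $s,t\in I$. Visibility: let $D$ be complete hyperbolic and $p,q\in\partial D$, $p\ne q$. The pair $\{p,q\}$ has visible geodesics if there are neighborhoods $U,V$ of $p,q$ respectively with $\overline U\cap\overline V=\emptyset$ and a compact set $K\subset D$ such that every geodesic $\gamma:[0,L]\to D$ with $\gamma(0)\in U$, $\gamma(L)\in V$ satisfies $\gamma([0,L])\cap K\ne\emptyset$. $D$ has the visibility property if every pair $\{p,q\}\subset\partial D$ with $p\ne q$ has visible geodesics. A point $p\in\partial D$ is of finite D'Angelo type if the order of contact at $p$ of (possibly singular, nonconstant) analytic discs with $\partial D$ is bounded, i.e. $\sup_\varphi \nu(\rho\circ\varphi)/\nu(\varphi-p)<\infty$,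 the supremum being over nonconstant holomorphic maps $\varphi$ from a neighborhood of $0\in\mathbb C$ to $\mathbb C^n$ with $\varphi(0)=p$, where $\rho$ is a smooth defining function of $D$ near $p$ and $\nu$ is the order of vanishing at $0$. (For convex domains it is known to be enough to consider complex lines.) *)

(* Defs.v *)
From HB Require Import structures.
From mathcomp Require Import all_boot all_order all_algebra.
From mathcomp Require Import all_classical all_reals all_analysis.
From mathcomp Require Import complex.

Set Implicit Arguments.
Unset Strict Implicit.
Unset Printing Implicit Defensive.

Import Order.TTheory GRing.Theory Num.Theory numFieldNormedType.Exports.

Local Open Scope ring_scope.
Local Open Scope classical_set_scope.

(* R[i] packed as a numClosedFieldType: it then inherits MathComp-Analysis's
   topology and normed-module structure, so that [derivable] and [derive1] on it
   are complex differentiability and the complex derivative.  Its order is the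
   partial one (x <= y iff y - x is real and nonnegative), so inequalities
   between norms are the usual ones, and the scalars of [convex_set] on a
   complex space are the real numbers of [0, 1]. *)
Definition cplx (R : realType) : numClosedFieldType := R[i].

Definition rtoc (R : realType) (x : R) : cplx R := (x%:C)%C.
Definition cmod (R : realType) (z : cplx R) : R := complex.Re `|z|.

Section kobayashi.
Context (R : realType) (n : nat).
Local Notation C := (cplx R).
Local Notation Cn := 'rV[C]_n.
Implicit Types (D : set Cn) (x y z X p q : Cn).

Definition domain D := [/\ open D, connected D & D !=set0].

(* For open D. *)
Definition boundary D : set Cn := closure D `\` D.

Definition holomorphic_on (U : set C) (phi : C -> Cn) :=
  forall z : C, U z -> derivable phi z 1.

Definition disc (r : R) : set C := [set z : C | cmod z < r].

Definition kobayashi_royden D z X : \bar R :=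
  ereal_inf [set (cmod alpha)%:E | alpha in [set alpha : C |
    exists phi : C -> Cn, [/\ holomorphic_on (disc 1) phi,
      forall w, disc 1 w -> D (phi w), phi 0 = z & alpha *: derive1 phi 0 = X]]].

Definition re_coord (g : R -> Cn) (j : 'I_n) : R -> R :=
  fun t => complex.Re (g t ord0 j).
Definition im_coord (g : R -> Cn) (j : 'I_n) : R -> R :=
  fun t => complex.Im (g t ord0 j).

Definition curve_derive (g : R -> Cn) (t : R) : Cn :=
  \row_j (derive1 (re_coord g j) t +i* derive1 (im_coord g j) t)%C.

Definition C1_curve (g : R -> Cn) :=
  (forall t j, derivable (re_coord g j) t 1 /\ derivable (im_coord g j) t 1) /\
  continuous (curve_derive g).

(* C^1 on a closed interval, as restriction of a C^1 curve defined on R. *)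
Definition C1_curve_on (a b : R) (g : R -> Cn) :=
  exists2 h : R -> Cn, C1_curve h & forall t, a <= t <= b -> g t = h t.

Definition piecewise_C1_01 (g : R -> Cn) :=
  exists (m : nat) (t : nat -> R), [/\ t 0%N = 0, t m = 1 &
    forall i, (i < m)%N -> t i < t i.+1 /\ C1_curve_on (t i) (t i.+1) g].

(* [curve_derive g t] is meaningless at the breakpoints of g, which form a
   null set. *)
Definition kobayashi_dist D x y : \bar R :=
  ereal_inf [set (\int[lebesgue_measure]_(t in `[0%R, 1%R])
                    kobayashi_royden D (g t) (curve_derive g t))%E |
    g in [set g : R -> Cn | [/\ piecewise_C1_01 g,
      forall t, 0 <= t <= 1 -> D (g t), g 0 = x & g 1 = y]]].

Definition geodesic D (I : set R) (s : R -> Cn) :=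
  (forall t, I t -> D (s t)) /\
  forall t u, I t -> I u -> kobayashi_dist D (s t) (s u) = `|t - u|%:E.

Definition visible_geodesics D p q :=
  exists U V K : set Cn,
    [/\ nbhs p U, nbhs q V, closure U `&` closure V = set0,
        compact K /\ K `<=` D &
        forall (L : R) (g : R -> Cn), 0 <= L -> geodesic D `[0, L] g ->
          U (g 0) -> V (g L) -> (g @` `[0, L]) `&` K !=set0].

(* Used only for complete hyperbolic D, as every bounded convex domain is. *)
Definition visibility_property D :=
  forall p q, boundary D p -> boundary D q -> p <> q ->
    visible_geodesics D p q.

End kobayashi.

Section real_smoothness.
Context (R : realType) (V : normedModType (cplx R)).
Implicit Types (f : V -> R) (U : set V).

(* Real directional derivatives: the derivative along v of the restriction of f
   to the real line through z. *)
Definition real_derivable f (z v : V) :=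
  derivable (fun h : R => f (z + rtoc h *: v)) 0 1.
Definition real_derive (v : V) f : V -> R :=
  fun z => derive1 (fun h : R => f (z + rtoc h *: v)) 0.

Definition iter_real_derive (vs : seq V) f : V -> R := foldr real_derive f vs.

(* C^oo on the open set U: all the iterated directional derivatives exist and
   are continuous on U. *)
Definition smooth_on U f :=
  forall (vs : seq V) (z : V), U z ->
    {for z, continuous (iter_real_derive vs f)} /\
    forall v, real_derivable (iter_real_derive vs f) z v.

End real_smoothness.

Section finite_type.
Context (R : realType) (n : nat).
Local Notation C := (cplx R).
Local Notation Cn := 'rV[C]_n.
Implicit Types (D U : set Cn) (p : Cn) (rho : Cn -> R).

Definition local_defining_function D p U rho :=
  [/\ open U /\ U p, smooth_on U rho,
      forall z, U z -> exists v, real_derive v rho z <> 0 &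
      forall z, U z -> (D z <-> rho z < 0)].

Definition smooth_boundary D :=
  forall p, boundary D p -> exists U rho, local_defining_function D p U rho.

(* Orders of vanishing at 0: the least order of a nonzero derivative at 0, +oo
   when there is none. *)
Definition real_vanishing_order (f : C -> R) : \bar R :=
  ereal_inf [set k%:R%:E | k in [set k : nat |
    exists vs : seq C, size vs = k /\ iter_real_derive vs f 0 <> 0]].
Definition hol_vanishing_order (f : C -> Cn) : \bar R :=
  ereal_inf [set k%:R%:E | k in [set k : nat | derive1n k f 0 <> 0]].

Definition analytic_disc_at p (phi : C -> Cn) :=
  exists r : R, [/\ 0 < r, holomorphic_on (disc r) phi, phi 0 = p &
    exists2 w, disc r w & phi w <> p].

(* For analytic discs the denominators are finite and at least 1. *)
Definition finite_type D p :=
  exists U rho, local_defining_function D p U rho /\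
    (ereal_sup [set real_vanishing_order (rho \o phi) /
                    hol_vanishing_order (fun w => (phi w - p)%R) |
                phi in analytic_disc_at p] < +oo)%E.

End finite_type.

(* Main.v *)
(* Supporting complex-affine functionals map a convex D into a half-plane, so a Schwarz lemma bounds
   k_D from below: if k_D(x, y) is small, then D contains a disc centred at x, in the complex line
   through x and y, of radius a multiple of |y - x|.  At a point of finite type, a disc of radius d in
   D centred at z forces the distance delta(z) to the boundary to be at least d^j / j (an iterated
   finite difference of a defining function along the disc does not vanish), and by compactness j is
   uniform on a shell around p that avoids the finitely many bad points.  In the other direction k_D
   is at most logarithmic in delta, so delta decays exponentially along a geodesic, in both
   directions from the point where it is largest.  Sampling a geodesic that stays in {delta < eta} at
   equal times, the part of it that crosses the shell has length at most the sum of
   (j delta)^(1/j), a two-sided geometric series with small sum; hence it cannot cross. *)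
Require Import Defs.
From mathcomp Require Import all_boot all_order all_algebra.
From mathcomp Require Import all_classical all_reals all_analysis.
From mathcomp Require Import complex.
From mathcomp Require Import measurable_realfun ring lra.
Import Order.TTheory GRing.Theory Num.Theory numFieldNormedType.Exports.
Set Implicit Arguments.
Unset Strict Implicit.
Unset Printing Implicit Defensive.
Local Open Scope ring_scope.
Local Open Scope classical_set_scope.

(** No estimate is available at an exceptional point, and $p$, $q$ may be exceptional, so the type
    estimates live on a shell around $p$ whose closed range of radii avoids the finitely many values
    of $|z-p|$ at such points. Finite type enters only through complex lines: along $u\mapsto
    z_0+uX$ some real derivative of a defining function is nonzero, and this persists for nearby
    points and directions. No differentiability of a geodesic is known, so its length is replaced by
    increments between samples so close in $k_D$ that the complex disc centred at one sample and
    reaching the next lies in $D$. Decay alone bounds the sum of these increments without making it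
    small, and $\delta<\eta$ alone says nothing about the number of samples. Hence one factor of
    $\delta^2$ is estimated by $\eta$, the other by the decay, and a $2j$-th root is taken: the
    geometric series then has a prefactor that tends to 0 with $\eta$. Sharp constants never matter;
    any bound on $|f'(0)|$ in the Schwarz lemma would do. *)

Section rtoc.
Context (R : realType).
Implicit Types (x y : R) (z w : cplx R).

Lemma rtocD x y : rtoc (x + y) = rtoc x + rtoc y.
Proof. exact: (rmorphD (@real_complex R)). Qed.
Lemma rtocN x : rtoc (- x) = - rtoc x.
Proof. exact: (rmorphN (@real_complex R)). Qed.
Lemma rtocB x y : rtoc (x - y) = rtoc x - rtoc y.
Proof. exact: (rmorphB (@real_complex R)). Qed.
Lemma rtocM x y : rtoc (x * y) = rtoc x * rtoc y.
Proof. exact: (rmorphM (@real_complex R)). Qed.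
Lemma rtoc1 : rtoc (1 : R) = 1. Proof. by []. Qed.
Lemma rtoc0 : rtoc (0 : R) = 0. Proof. by []. Qed.
Lemma rtocV x : rtoc (x^-1) = (rtoc x)^-1.
Proof. exact: (fmorphV (@real_complex R)). Qed.
Lemma rtoc_eq0 x : (rtoc x == 0) = (x == 0).
Proof. exact: (fmorph_eq0 (@real_complex R)). Qed.
Lemma rtoc_le x y : (rtoc x <= rtoc y) = (x <= y).
Proof. exact: lecR. Qed.
Lemma rtoc_lt x y : (rtoc x < rtoc y) = (x < y).
Proof. exact: ltcR. Qed.
Lemma ge0_rtoc z : 0 <= z -> z = rtoc (complex.Re z).
Proof. by case: z => a b; rewrite lecE/= => /andP[/eqP -> _]. Qed.

Lemma complex_split z : z = rtoc (complex.Re z) + 'i%C * rtoc (complex.Im z).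
Proof.
case: z => a b; rewrite /rtoc /=; apply/eqP; rewrite eq_complex /=.
by apply/andP; split; apply/eqP; rewrite /=; ring.
Qed.

Lemma cReD z w : complex.Re (z + w) = complex.Re z + complex.Re w.
Proof. by case: z; case: w. Qed.
Lemma cImD z w : complex.Im (z + w) = complex.Im z + complex.Im w.
Proof. by case: z; case: w. Qed.
Lemma cReN z : complex.Re (- z) = - complex.Re z.
Proof. by case: z. Qed.
Lemma cImN z : complex.Im (- z) = - complex.Im z.
Proof. by case: z. Qed.
Lemma cReB z w : complex.Re (z - w) = complex.Re z - complex.Re w.
Proof. by rewrite cReD cReN. Qed.
Lemma cImB z w : complex.Im (z - w) = complex.Im z - complex.Im w.
Proof. by rewrite cImD cImN. Qed.
Lemma cReM z w : complex.Re (z * w) =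
  complex.Re z * complex.Re w - complex.Im z * complex.Im w.
Proof. by case: z; case: w. Qed.
Lemma cImM z w : complex.Im (z * w) =
  complex.Re z * complex.Im w + complex.Im z * complex.Re w.
Proof. by case: z; case: w. Qed.

End rtoc.

(** * Real-valued norms and compactness in $\mathbb C^n$ *)

Section real_norm.
Context (R : realType) (V : normedModType (cplx R)).
Implicit Types (v w : V).

(* The norm of a normed module over [cplx R] takes values in [cplx R]. *)
Definition nm v : R := complex.Re `|v|.

Lemma nmE v : `|v| = rtoc (nm v).
Proof. exact/ge0_rtoc/normr_ge0. Qed.
Lemma nm_ge0 v : 0 <= nm v.
Proof. by rewrite -rtoc_le -nmE rtoc0. Qed.
Lemma nm0 : nm 0 = 0. Proof. by rewrite /nm normr0. Qed.
Lemma nm_eq0 v : (nm v == 0) = (v == 0).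
Proof. by rewrite -rtoc_eq0 -nmE normr_eq0. Qed.
Lemma nm_gt0 v : (0 < nm v) = (v != 0).
Proof. by rewrite lt_def nm_ge0 andbT nm_eq0. Qed.
Lemma nmD v w : nm (v + w) <= nm v + nm w.
Proof. by rewrite -rtoc_le rtocD -!nmE ler_normD. Qed.
Lemma nmN v : nm (- v) = nm v.
Proof. by rewrite /nm normrN. Qed.
Lemma nmC v w : nm (v - w) = nm (w - v).
Proof. by rewrite -nmN opprB. Qed.
Lemma nm_tri u v w : nm (u - w) <= nm (u - v) + nm (v - w).
Proof. by rewrite (le_trans _ (nmD _ _))// addrA subrK. Qed.
Lemma nm_dist v w : `|nm v - nm w| <= nm (v - w).
Proof.
rewrite ler_norml; apply/andP; split.
  by rewrite lerBrDr addrC lerBlDr -(nmN (v - w)) opprB; have := nmD (w - v) v; rewrite subrK addrC.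
by rewrite lerBlDr; have := nmD (v - w) w; rewrite subrK.
Qed.
Lemma nmZ (a : cplx R) v : nm (a *: v) = cmod a * nm v.
Proof. by rewrite /nm normrZ (ge0_rtoc (normr_ge0 a)) nmE -rtocM. Qed.

Lemma nbhs_nm (x : V) (A : set V) :
  nbhs x A <-> exists2 e : R, 0 < e & forall y, nm (y - x) < e -> A y.
Proof.
split=> [/nbhs_normP[e /= e0 eA]|[e e0 eA]].
  have ee := ge0_rtoc (ltW e0).
  exists (complex.Re e) => [|y ye]; first by rewrite -rtoc_lt -ee.
  by apply: eA; rewrite /= ee nmE rtoc_lt nmC.
apply/nbhs_normP; exists (rtoc e) => /=; first by rewrite -rtoc0 rtoc_lt.
by move=> y /=; rewrite nmE rtoc_lt nmC => /eA.
Qed.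

Lemma nm_continuous : continuous nm.
Proof.
move=> x; apply/cvgrPdist_lt => e e0.
apply: (iffRL (nbhs_nm x _)); exists e => // y /=.
by rewrite nmC; apply: le_lt_trans; exact: nm_dist.
Qed.

End real_norm.

Section continuity.
Context (R : realType).

Lemma cmodE (z : cplx R) : cmod z = nm (z : (cplx R)^o).
Proof. by []. Qed.

Lemma cmod_sqr (z : cplx R) : cmod z ^+ 2 = complex.Re z ^+ 2 + complex.Im z ^+ 2.
Proof.
case: z => a b; rewrite /cmod /= /Num.norm /= sqr_sqrtr//.
by rewrite addr_ge0// sqr_ge0.
Qed.
Lemma cmod_ge0 (z : cplx R) : 0 <= cmod z.
Proof. exact: (@nm_ge0 R (cplx R)^o). Qed.
Lemma cmodM (z w : cplx R) : cmod (z * w) = cmod z * cmod w.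
Proof. exact: (@nmZ R (cplx R)^o). Qed.
Lemma cmodD (z w : cplx R) : cmod (z + w) <= cmod z + cmod w.
Proof. exact: (@nmD R (cplx R)^o). Qed.
Lemma cmodN (z : cplx R) : cmod (- z) = cmod z.
Proof. exact: (@nmN R (cplx R)^o). Qed.
Lemma cmod0 : cmod (0 : cplx R) = 0.
Proof. exact: (@nm0 R (cplx R)^o). Qed.
Lemma cmod1 : cmod (1 : cplx R) = 1.
Proof. by rewrite /cmod normr1. Qed.
Lemma cmod_eq0 (z : cplx R) : (cmod z == 0) = (z == 0).
Proof. exact: (@nm_eq0 R (cplx R)^o). Qed.
Lemma cmod_gt0 (z : cplx R) : (0 < cmod z) = (z != 0).
Proof. exact: (@nm_gt0 R (cplx R)^o). Qed.
Lemma cmodV (z : cplx R) : cmod z^-1 = (cmod z)^-1.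
Proof.
have [->|z0] := eqVneq z 0; first by rewrite invr0 cmod0 invr0.
have z1 : cmod z != 0 by rewrite cmod_eq0.
by apply: (mulfI z1); rewrite -cmodM !divff ?cmod1.
Qed.
Lemma cmod_rtoc (x : R) : cmod (rtoc x) = `|x|.
Proof. by rewrite /cmod /= /Num.norm /= expr0n /= addr0 sqrtr_sqr. Qed.

Lemma Re_le_cmod (z : cplx R) : `|complex.Re z| <= cmod z.
Proof.
rewrite -(@ler_pXn2r _ 2)// ?nnegrE ?normr_ge0 ?cmod_ge0//.
by rewrite cmod_sqr real_normK ?num_real// lerDl sqr_ge0.
Qed.
Lemma Im_le_cmod (z : cplx R) : `|complex.Im z| <= cmod z.
Proof.
rewrite -(@ler_pXn2r _ 2)// ?nnegrE ?normr_ge0 ?cmod_ge0//.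
by rewrite cmod_sqr real_normK ?num_real// lerDr sqr_ge0.
Qed.
Lemma cmod_le_ReIm (z : cplx R) : cmod z <= `|complex.Re z| + `|complex.Im z|.
Proof.
rewrite {1}(complex_split z) (le_trans (cmodD _ _))// cmodM !cmod_rtoc.
rewrite lerD2l -[leRHS]mul1r ler_wpM2r// /cmod /= /Num.norm /=.
by rewrite expr0n /= expr1n add0r sqrtr1.
Qed.

Lemma Re_continuous : continuous (@complex.Re R : cplx R -> R).
Proof.
move=> x A /nbhs_ballP[e /= e0 eA].
apply: (iffRL (@nbhs_nm R (cplx R)^o x _)); exists e => // y; rewrite -cmodE => yx.
by apply: eA; rewrite /ball /= -cReB (le_lt_trans (Re_le_cmod _))// cmodE nmC.
Qed.
Lemma Im_continuous : continuous (@complex.Im R : cplx R -> R).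
Proof.
move=> x A /nbhs_ballP[e /= e0 eA].
apply: (iffRL (@nbhs_nm R (cplx R)^o x _)); exists e => // y; rewrite -cmodE => yx.
by apply: eA; rewrite /ball /= -cImB (le_lt_trans (Im_le_cmod _))// cmodE nmC.
Qed.

Lemma cvg_nm (T : Type) (F : set_system T) {FF : Filter F} (V : normedModType (cplx R))
    (f : T -> V) (l : V) :
  f @ F --> l <-> forall e : R, 0 < e -> \forall t \near F, nm (f t - l) < e.
Proof.
split=> [fl e e0|H A /nbhs_nm[e e0 eA]].
  have : nbhs l [set y | nm (y - l) < e] by apply/nbhs_nm; exists e.
  exact: fl.
by apply: filterS (H e e0) => t /eA.
Qed.

Lemma rtoc_continuous : continuous (@rtoc R : R -> (cplx R)^o).
Proof.
move=> x; apply/cvg_nm => e e0.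
near=> t; rewrite -cmodE -rtocB cmod_rtoc distrC; near: t.
exact: (@cvgr_dist_lt _ _ _ (nbhs x) _ id x).
Unshelve. all: by end_near. Qed.

End continuity.

Section rV.
Context (R : realType) (n : nat).
Local Notation C := (cplx R).
Local Notation Cn := 'rV[C]_n.

Lemma coord_le_nm (X : Cn) j : cmod (X ord0 j) <= nm X.
Proof.
rewrite -rtoc_le -nmE -[leLHS](@nmE R (cplx R)^o).
rewrite [leRHS]/Num.norm /= mx_normE.
rewrite -[leLHS]nngE num_le.
exact: (@le_bigmax _ _ _ _ (fun i : 'I_1 * 'I_n => (`|X i.1 i.2|%:nng)%R) (ord0, j)).
Qed.

Lemma nm_le (X : Cn) (e : R) : 0 <= e ->
  (forall j, cmod (X ord0 j) <= e) -> nm X <= e.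
Proof.
move=> e0 H; rewrite -rtoc_le -nmE [leLHS]/Num.norm /=.
have [->|/mx_norm_neq0[[i j] ->]] := eqVneq (mx_norm X) 0; first by rewrite -rtoc0 rtoc_le.
by rewrite /= [X in `|X|](_ : _ = X ord0 j) ?(ord1 i)// [leLHS](@nmE R (cplx R)^o) rtoc_le H.
Qed.

(** Closed in a product of compact squares, the images of $[-M,M]^2$ under $(a,b)\mapsto a+ib$. *)
Lemma Cn_compact (A : set Cn) (M : R) : closed A -> (forall x, A x -> nm x <= M) ->
  compact A.
Proof.
move=> Acl AM.
pose sq : set C := (fun x : R * R => (rtoc x.1 + 'i%C * rtoc x.2)) @`
   (`[- M, M] `*` `[- M, M]).
have csq : compact (sq : set C^o).
  apply: continuous_compact; last first.
    by apply: compact_setX; exact: segment_compact.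
  apply: continuous_subspaceT => x.
  apply: (@cvgD _ C^o).
    by apply: (cvg_comp _ _ (@cvg_fst _ _ _ _ _)); exact: rtoc_continuous.
  apply: (@cvgMr C).
  by apply: (cvg_comp _ _ (@cvg_snd _ _ _ _ _)); exact: rtoc_continuous.
apply: (subclosed_compact Acl (@rV_compact C n (fun=> sq) (fun=> csq))).
move=> x /AM xM i /=.
exists (complex.Re (x ord0 i), complex.Im (x ord0 i)); last by rewrite /= -complex_split.
by split; rewrite /= in_itv /= -ler_norml;
  rewrite (le_trans _ xM)// (le_trans _ (coord_le_nm x i))// ?Re_le_cmod ?Im_le_cmod.
Qed.

End rV.

(** * Goursat's theorem and a Schwarz lemma *)

Section segment_integral.
Context (R : realType).
Implicit Types (u : R -> R) (a b m : R).

Definition itg u a b := \int[@lebesgue_measure R]_(x in `[a, b]) u x.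

(** Two-sided continuity also at the endpoints: differentiability on a closed rectangle gives it,
    and it restricts to subsegments at once. *)
Definition cont_on u a b := forall x, a <= x <= b -> {for x, continuous u}.

Lemma cont_onW u a b : cont_on u a b -> {within `[a, b], continuous u}.
Proof.
move=> H; apply: continuous_in_subspaceT => x; rewrite inE /= in_itv /=; exact: H.
Qed.

Lemma cont_on_int u a b : cont_on u a b ->
  (@lebesgue_measure R).-integrable `[a, b] (EFin \o u).
Proof.
move=> H; apply: continuous_compact_integrable; first exact: segment_compact.
exact: cont_onW.
Qed.

Lemma itg_chasles u a m b : a <= m -> m <= b -> cont_on u a b ->
  itg u a b = itg u a m + itg u m b.
Proof.
move=> am mb H; have iu := cont_on_int H.
have := @Rintegral_itvB R u (BLeft a) (BRight b) m iu.
rewrite !bnd_simp => /(_ am mb) E; rewrite /itg.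
apply/eqP; rewrite addrC -subr_eq; apply/eqP; rewrite E.
rewrite Rintegral_itv_obnd_cbnd//.
apply: integrableS iu => //.
by apply: subset_itv; rewrite bnd_simp.
Qed.

Lemma itg_cst k a b : a <= b -> itg (fun=> k) a b = k * (b - a).
Proof.
move=> ab; rewrite /itg Rintegral_cst//; congr (_ * _).
have := @lebesgue_measure_itv R `[a, b]%R; rewrite /= lte_fin => E.
transitivity (fine (if (a < b)%R then b%:E - a%:E else 0)%E); first by congr fine; exact: E.
case: ltP => [//|ba]; rewrite (_ : b = a) ?subrr//.
by apply/eqP; rewrite eq_le ba ab.
Qed.

Lemma cont_on_cst k a b : cont_on (fun=> k) a b.
Proof. by move=> x _; exact: cvg_cst. Qed.

Lemma itg_le u v a b : cont_on u a b -> cont_on v a b ->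
  (forall x, a <= x <= b -> u x <= v x) -> itg u a b <= itg v a b.
Proof.
move=> cu cv uv; apply: le_Rintegral => //; exact: cont_on_int.
Qed.

Lemma itg_bound u k e a b : a <= b -> cont_on u a b ->
  (forall x, a <= x <= b -> `|u x - k| <= e) ->
  `|itg u a b - k * (b - a)| <= e * (b - a).
Proof.
move=> ab cu H; rewrite ler_distl; apply/andP; split.
  rewrite -mulrBl -(itg_cst _ ab) itg_le//; first exact: cont_on_cst.
  by move=> x /H; rewrite ler_distl => /andP[].
rewrite -mulrDl -(itg_cst _ ab) itg_le//; first exact: cont_on_cst.
by move=> x /H; rewrite ler_distl => /andP[].
Qed.

Lemma itgB u v a b : cont_on u a b -> cont_on v a b ->
  itg (fun x => u x - v x) a b = itg u a b - itg v a b.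
Proof. by move=> cu cv; rewrite /itg RintegralB//; exact: cont_on_int. Qed.

Lemma cont_onB u v a b : cont_on u a b -> cont_on v a b ->
  cont_on (fun x => u x - v x) a b.
Proof. by move=> cu cv x xab; apply: (@cvgB _ R^o); [exact: cu|exact: cv]. Qed.

Lemma cont_onS u a b a' b' : a <= a' -> b' <= b -> cont_on u a b -> cont_on u a' b'.
Proof.
move=> aa bb H x /andP[x1 x2]; apply: H.
by rewrite (le_trans aa x1) (le_trans x2 bb).
Qed.

Lemma itg_ub u k a b : a <= b -> cont_on u a b ->
  (forall x, a <= x <= b -> u x <= k) -> itg u a b <= k * (b - a).
Proof.
by move=> ab cu H; rewrite -(itg_cst _ ab) itg_le//; exact: cont_on_cst.
Qed.

End segment_integral.

Section rectangle_bisection.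
Context (R : realType).

Definition rect := (R * R * (R * R))%type.
Definition half (s : bool) (I : R * R) : R * R :=
  if s then (I.1, (I.1 + I.2) / 2) else ((I.1 + I.2) / 2, I.2).
Definition quarter (s : bool * bool) (Q : rect) : rect :=
  (half s.1 Q.1, half s.2 Q.2).
Definition inI (x : R) (I : R * R) := I.1 <= x <= I.2.

Lemma nested_halves (I : nat -> R * R) : (I 0%N).1 <= (I 0%N).2 ->
  (forall n, exists s, I n.+1 = half s (I n)) ->
  (forall n, (I n).1 <= (I n).2 /\ (I 0%N).1 <= (I n).1 /\ (I n).2 <= (I 0%N).2 /\
     (I n).2 - (I n).1 = ((I 0%N).2 - (I 0%N).1) / 2 ^+ n) /\
  exists x, forall n, inI x (I n).
Proof.
move=> I0 IS.
have le n : (I n).1 <= (I n).2.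
  elim: n => // n IH; have [[] ->] := IS n; rewrite /half /=; lra.
have mono n : (I n).1 <= (I n.+1).1 /\ (I n.+1).2 <= (I n).2.
  have := le n; have [[] ->] := IS n; rewrite /half /=; lra.
have mono1 m k : (I m).1 <= (I (m + k)%N).1 /\ (I (m + k)%N).2 <= (I m).2.
  elim: k => [|k IH]; first by rewrite addn0.
  by rewrite addnS; have := mono (m + k)%N; lra.
split=> [n|].
  split; first exact: le.
  have := mono1 0%N n; rewrite add0n => -[m1 m2]; split=> //; split=> //.
  elim: n {m1 m2} => [|n IH]; first by rewrite expr0 divr1.
  rewrite exprS invfM mulrCA -IH.
  have [[] ->] := IS n; rewrite /half /=; lra.
have cross m k : (I m).1 <= (I k).2.
  have h1 := mono1 m k; have h2 := mono1 k m; rewrite addnC in h2.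
  have := le (m + k)%N; lra.
pose A := [set (I n).1 | n in [set: nat]].
have A0 : A !=set0 by exists (I 0%N).1; exists 0%N.
exists (sup A) => n; apply/andP; split.
  apply: ub_le_sup; last by exists n.
  by exists (I 0%N).2 => _ [k _ <-]; exact: cross.
by apply: ge_sup => // _ [k _ <-]; exact: cross.
Qed.

(** Contraposition: every failing rectangle has a failing quarter, and the nested failing quarters
    shrink to a point, where the local hypothesis is contradicted. *)
Lemma rect_induction (P : rect -> Prop) (Q0 : rect) :
  Q0.1.1 <= Q0.1.2 -> Q0.2.1 <= Q0.2.2 ->
  (forall Q, Q0.1.1 <= Q.1.1 -> Q.1.1 <= Q.1.2 -> Q.1.2 <= Q0.1.2 ->
     Q0.2.1 <= Q.2.1 -> Q.2.1 <= Q.2.2 -> Q.2.2 <= Q0.2.2 ->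
     (forall s, P (quarter s Q)) -> P Q) ->
  (forall x y, inI x Q0.1 -> inI y Q0.2 -> exists2 r, 0 < r &
     forall Q, Q0.1.1 <= Q.1.1 -> Q.1.2 <= Q0.1.2 ->
     Q0.2.1 <= Q.2.1 -> Q.2.2 <= Q0.2.2 ->
     inI x Q.1 -> inI y Q.2 -> Q.1.2 - Q.1.1 < r -> Q.2.2 - Q.2.1 < r -> P Q) ->
  P Q0.
Proof.
move=> h1 h2 Hq Hloc; apply: contrapT => nP.
pose ok (Q : rect) := [/\ Q0.1.1 <= Q.1.1, Q.1.1 <= Q.1.2, Q.1.2 <= Q0.1.2,
  Q0.2.1 <= Q.2.1 & (Q.2.1 <= Q.2.2 /\ Q.2.2 <= Q0.2.2)].
have /choice[F HF] : forall Q, exists s, ok Q -> ~ P Q -> ~ P (quarter s Q).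
  move=> Q; have [[okQ nPQ]|H] := pselect (ok Q /\ ~ P Q); last first.
    by exists (true, true) => o p; case: H.
  have : ~ forall s, P (quarter s Q).
    by move=> H; apply: nPQ; case: okQ => o1 o2 o3 o4 [p5 p6]; apply: Hq.
  by move=> /existsNP[s Hs]; exists s.
pose Qn n := iter n (fun Q => quarter (F Q) Q) Q0.
have [b1 [x xI]] := @nested_halves (fun n => (Qn n).1) h1
  (fun n => ex_intro _ (F (Qn n)).1 erefl).
have [b2 [y yI]] := @nested_halves (fun n => (Qn n).2) h2
  (fun n => ex_intro _ (F (Qn n)).2 erefl).
have okn n : ok (Qn n).
  by have := b1 n; have := b2 n; rewrite /= => -[? [? [? _]]] [? [? [? _]]].
have nPn n : ~ P (Qn n).
  by elim: n => // n IH; apply: HF => //; exact: okn.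
have [r r0 Hr] := Hloc x y (xI 0%N) (yI 0%N).
pose M := (Q0.1.2 - Q0.1.1) + (Q0.2.2 - Q0.2.1).
have [n Hn] : exists n, M / r < 2 ^+ n.
  exists (Num.bound (M / r)).
  have M0 : 0 <= M / r by apply: divr_ge0; [rewrite /M; lra|exact: ltW].
  by apply: (lt_le_trans (archi_boundP M0)); rewrite -natrX ler_nat ltnW// ltn_expl.
have Mr : M / 2 ^+ n < r.
  by rewrite ltr_pdivrMr ?exprn_gt0// mulrC -ltr_pdivrMr.
apply: (nPn n); have [p1 p2 p3 p4 [p5 p6]] := okn n.
have P2 : (0 : R) < (2 ^+ n)^-1 by rewrite invr_gt0 exprn_gt0.
apply: Hr => //.
  have [_ [_ [_ /= ->]]] := b1 n.
  apply: le_lt_trans Mr; rewrite /= ler_pM2r// /M; lra.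
have [_ [_ [_ /= ->]]] := b2 n.
apply: le_lt_trans Mr; rewrite /= ler_pM2r// /M; lra.
Qed.

End rectangle_bisection.

Section goursat.
Context (R : realType).
Local Notation C := (cplx R).
Implicit Types (h : C -> C) (z w l : C) (a b c d x y : R).

Definition mkc x y : C := (x +i* y)%C.

(** Differentiability without a quotient: the point [w = z] is covered, and the remainder bound can
    be integrated as it stands. *)
Definition cdiffat h z l := forall e : R, 0 < e -> exists2 r : R, 0 < r &
  forall w, cmod (w - z) < r -> cmod (h w - h z - l * (w - z)) <= e * cmod (w - z).

Definition cdiff_rect h a b c d := forall x y, a <= x <= b -> c <= y <= d ->
  exists l, cdiffat h (mkc x y) l.

Lemma mkcB x y x' y' : mkc x y - mkc x' y' = mkc (x - x') (y - y').
Proof. by []. Qed.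

Lemma cdiffat_cont h z l : cdiffat h z l ->
  forall e, 0 < e -> exists2 r : R, 0 < r & forall w, cmod (w - z) < r -> cmod (h w - h z) < e.
Proof.
move=> H e e0; have [r r0 Hr] := H 1 ltr01.
have K0 : 0 < 1 + cmod l by rewrite ltr_wpDr ?cmod_ge0.
exists (Num.min r (e / (1 + cmod l))) => [|w].
  by rewrite lt_min r0 divr_gt0.
rewrite lt_min => /andP[/Hr wr]; rewrite ltr_pdivlMr// => we.
rewrite -(subrK (l * (w - z)) (h w - h z)).
apply: le_lt_trans (cmodD _ _) _; rewrite cmodM.
by move: wr we; set u := cmod (_ - _ - _); set v := cmod (w - z); set k := cmod l; lra.
Qed.

Lemma cont_slice_x h x y l : cdiffat h (mkc x y) l ->
  {for x, continuous (fun t => complex.Im (h (mkc t y)))}.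
Proof.
move=> /cdiffat_cont H; apply/cvgrPdist_lt => e /H[r r0 Hr].
near=> t; rewrite distrC /= -cImB; apply: le_lt_trans (Im_le_cmod _) _.
apply: Hr; rewrite mkcB subrr; apply: le_lt_trans (cmod_le_ReIm _) _.
rewrite /= normr0 addr0 distrC; near: t.
exact: (@cvgr_dist_lt _ _ _ (nbhs x) _ id x).
Unshelve. all: by end_near. Qed.

Lemma cont_slice_y h x y l : cdiffat h (mkc x y) l ->
  {for y, continuous (fun t => complex.Re (h (mkc x t)))}.
Proof.
move=> /cdiffat_cont H; apply/cvgrPdist_lt => e /H[r r0 Hr].
near=> t; rewrite distrC /= -cReB; apply: le_lt_trans (Re_le_cmod _) _.
apply: Hr; rewrite mkcB subrr; apply: le_lt_trans (cmod_le_ReIm _) _.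
rewrite /= normr0 add0r distrC; near: t.
exact: (@cvgr_dist_lt _ _ _ (nbhs y) _ id y).
Unshelve. all: by end_near. Qed.

Definition xint h y a b := itg (fun x => complex.Im (h (mkc x y))) a b.
Definition yint h x c d := itg (fun y => complex.Re (h (mkc x y))) c d.

(* The imaginary part of the contour integral of [h] along the boundary of [Q]; the real part is
   not needed, as the integral of 1/z is purely imaginary. *)
Definition bdint h (Q : rect R) :=
  xint h Q.2.1 Q.1.1 Q.1.2 - xint h Q.2.2 Q.1.1 Q.1.2 +
  (yint h Q.1.2 Q.2.1 Q.2.2 - yint h Q.1.1 Q.2.1 Q.2.2).

Lemma cdiff_rect_x h a b c d y : cdiff_rect h a b c d -> c <= y <= d ->
  cont_on (fun x => complex.Im (h (mkc x y))) a b.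
Proof. by move=> H cyd x xab; have [l /cont_slice_x] := H x y xab cyd. Qed.

Lemma cdiff_rect_y h a b c d x : cdiff_rect h a b c d -> a <= x <= b ->
  cont_on (fun y => complex.Re (h (mkc x y))) c d.
Proof. by move=> H xab y cyd; have [l /cont_slice_y] := H x y xab cyd. Qed.

Lemma bdint_quarters h Q : Q.1.1 <= Q.1.2 -> Q.2.1 <= Q.2.2 ->
  cdiff_rect h Q.1.1 Q.1.2 Q.2.1 Q.2.2 ->
  bdint h Q = bdint h (quarter (true, true) Q) + bdint h (quarter (true, false) Q) +
   (bdint h (quarter (false, true) Q) + bdint h (quarter (false, false) Q)).
Proof.
case: Q => [[a b] [c d]] /= ab cd H; rewrite /bdint /quarter /half /=.
set m := (a + b) / 2; set k := (c + d) / 2.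
have [am mb] : a <= m /\ m <= b by rewrite /m; lra.
have [ck kd] : c <= k /\ k <= d by rewrite /k; lra.
have X y : c <= y <= d -> xint h y a b = xint h y a m + xint h y m b.
  by move=> ycd; apply: itg_chasles => //; exact: cdiff_rect_x H ycd.
have Y x : a <= x <= b -> yint h x c d = yint h x c k + yint h x k d.
  by move=> xab; apply: itg_chasles => //; exact: cdiff_rect_y H xab.
rewrite (X c) ?lexx// (X d) ?lexx ?cd// (Y a) ?lexx// (Y b) ?lexx ?ab//.
ring.
Qed.

(** The affine part of [h] at the point integrates to zero: the horizontal sides give $-\Re
    l\,(d-c)(b-a)$ and the vertical ones the opposite. The remainders on opposite sides differ by at
    most $2es$, with [s] half the perimeter. *)
Lemma bdint_local h x0 y0 l e : cdiffat h (mkc x0 y0) l -> 0 < e ->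
  exists2 r : R, 0 < r & forall a b c d, cdiff_rect h a b c d ->
    a <= x0 <= b -> c <= y0 <= d -> b - a < r -> d - c < r ->
    `|bdint h (a, b, (c, d))| <= 2 * e * (b - a + (d - c)) ^+ 2.
Proof.
move=> H e0; have [r r0 Hr] := H e e0.
exists (r / 2) => [|a b c d Hc xab ycd bar dcr]; first by rewrite divr_gt0.
set s := b - a + (d - c).
have [ab cd] : a <= b /\ c <= d by lra.
have s0 : 0 <= s by rewrite /s; lra.
pose er w := h w - h (mkc x0 y0) - l * (w - mkc x0 y0).
have Her x y : a <= x <= b -> c <= y <= d -> cmod (er (mkc x y)) <= e * s.
  move=> xx yy.
  have Hs : cmod (mkc x y - mkc x0 y0) <= s.
    rewrite mkcB (le_trans (cmod_le_ReIm _))//= /s.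
    by rewrite lerD// ler_norml; apply/andP; split; lra.
  apply: le_trans (Hr _ _) _; last by rewrite ler_pM2l.
  by apply: le_lt_trans Hs _; rewrite /s; lra.
have hE w w' : h w - h w' = l * (w - w') + (er w - er w').
  by rewrite /er; ring.
have B1 : `|itg (fun x => complex.Im (h (mkc x c)) - complex.Im (h (mkc x d))) a b
   - (- complex.Re l * (d - c)) * (b - a)| <= 2 * e * s * (b - a).
  have ccd : c <= c <= d by rewrite lexx.
  have cdd : c <= d <= d by rewrite lexx andbT.
  apply: itg_bound => // [|x xx].
    by apply: cont_onB; apply: (cdiff_rect_x Hc).
  rewrite -cImB hE cImD mkcB subrr cImM /= [X in `|X|](_ : _ =
    complex.Im (er (mkc x c) - er (mkc x d))); last by ring.
  apply: le_trans (Im_le_cmod _) _; apply: le_trans (cmodD _ _) _.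
  by rewrite cmodN -mulrA mulr_natl mulr2n lerD// Her.
have B2 : `|itg (fun y => complex.Re (h (mkc b y)) - complex.Re (h (mkc a y))) c d
   - (complex.Re l * (b - a)) * (d - c)| <= 2 * e * s * (d - c).
  have aab : a <= a <= b by rewrite lexx.
  have abb : a <= b <= b by rewrite lexx andbT.
  apply: itg_bound => // [|y yy].
    by apply: cont_onB; apply: (cdiff_rect_y Hc).
  rewrite -cReB hE cReD mkcB subrr cReM /= [X in `|X|](_ : _ =
    complex.Re (er (mkc b y) - er (mkc a y))); last by ring.
  apply: le_trans (Re_le_cmod _) _; apply: le_trans (cmodD _ _) _.
  by rewrite cmodN -mulrA mulr_natl mulr2n lerD// Her.
rewrite itgB in B1; last 2 first.
- by apply: (cdiff_rect_x Hc); rewrite lexx.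
- by apply: (cdiff_rect_x Hc); rewrite lexx andbT.
rewrite itgB in B2; last 2 first.
- by apply: (cdiff_rect_y Hc); rewrite lexx andbT.
- by apply: (cdiff_rect_y Hc); rewrite lexx.
rewrite expr2 mulrA {2}/s mulrDr.
apply: le_trans (lerD B1 B2); apply: le_trans (ler_normD _ _).
rewrite le_eqVlt; apply/orP; left; apply/eqP; congr `|_|.
rewrite /bdint /xint /yint /=; ring.
Qed.

Theorem goursat h a b c d : a <= b -> c <= d -> cdiff_rect h a b c d ->
  bdint h (a, b, (c, d)) = 0.
Proof.
move=> ab cd H; apply/eqP; rewrite -normr_le0; apply/ler_addgt0Pl => e e0.
rewrite addr0; set s := b - a + (d - c).
have s0 : 0 <= s by rewrite /s; lra.
have K0 : 0 < s ^+ 2 + 1 by rewrite ltr_wpDl// sqr_ge0.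
(* The [+ 1] keeps the denominator positive for a degenerate rectangle. *)
pose e' := e / 2 / (s ^+ 2 + 1).
have e'0 : 0 < e' by rewrite !divr_gt0.
suff : `|bdint h (a, b, (c, d))| <= 2 * e' * s ^+ 2.
  move/le_trans; apply; rewrite /e' mulrA (mulrC 2) divfK// mulrAC ler_pdivrMr//.
  by rewrite ler_pM2l// lerDl.
(* A quarter has half the perimeter, so the four quadratic bounds add up exactly to the bound for
   the whole rectangle. *)
pose P (Q : rect R) := `|bdint h Q| <= 2 * e' * (Q.1.2 - Q.1.1 + (Q.2.2 - Q.2.1)) ^+ 2.
apply: (@rect_induction R P (a, b, (c, d))) => //=.
  move=> Q q1 q2 q3 q4 q5 q6 HP.
  rewrite /P bdint_quarters//; last first.
    move=> x y /andP[x1 x2] /andP[y1 y2]; apply: H; apply/andP; split.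
    - exact: le_trans x1.
    - exact: le_trans q3.
    - exact: le_trans y1.
    - exact: le_trans q6.
  apply: le_trans (ler_normD _ _) _.
  apply: le_trans (lerD (ler_normD _ _) (ler_normD _ _)) _.
  apply: le_trans (lerD (lerD (HP _) (HP _)) (lerD (HP _) (HP _))) _.
  rewrite /quarter /half /= le_eqVlt; apply/orP; left; apply/eqP.
  by field.
move=> x y xab ycd; have [l Hl] := H x y xab ycd.
have [r r0 Hr] := bdint_local Hl e'0; exists r => //.
move=> [[a' b'] [c' d']] /= a1 b1 c1 d1 xI yI l1 l2; apply: Hr => //.
move=> x' y' /andP[x1 x2] /andP[y1 y2]; apply: H; apply/andP; split.
- exact: le_trans x1.
- exact: le_trans b1.
- exact: le_trans y1.
- exact: le_trans d1.
Qed.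

End goursat.

Section schwarz.
Context (R : realType).
Local Notation C := (cplx R).
Implicit Types (f h : C -> C) (z w l : C).

Lemma derivable_cdiffat h z : derivable h z 1 -> cdiffat h z (derive1 h z).
Proof.
move=> H e e0.
have H' : (fun t : C => t^-1 *: (h (t + z) - h z)) @ 0^' --> derive1 h z.
  rewrite derive1E; have := H; rewrite /derivable /derive.
  rewrite (_ : (fun t => t^-1 *: ((h \o shift z) (t *: 1) - h z)) =
    (fun t => t^-1 *: (h (t + z) - h z))); first by [].
  by apply/funext => t /=; rewrite [t *: 1]mulr1.
have /(@nbhs_nm R (C^o) 0)[r r0 Hr] : \forall t \near (0 : C^o), t != 0 ->
    nm (t^-1 *: (h (t + z) - h z) - derive1 h z : C^o) < e.
  have /cvg_nm/(_ e e0) := H'.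
  by rewrite near_withinE.
exists r => // w wr; have [->|wz] := eqVneq w z.
  by rewrite !subrr mulr0 subr0 cmod0 mulr0.
have tz : w - z != 0 by rewrite subr_eq0.
have {Hr} := Hr (w - z); rewrite subr0 => /(_ wr tz); rewrite subrK => Hr.
have -> : h w - h z - derive1 h z * (w - z) =
    (w - z) * ((w - z)^-1 *: (h w - h z) - derive1 h z).
  rewrite [_ *: _](_ : _ = (w - z)^-1 * (h w - h z))//.
  by move: (h w - h z) (h^`()%classic z) (w - z) tz => p q v v0; field.
by rewrite cmodM mulrC ler_wpM2r ?cmod_ge0// ltW.
Qed.

Lemma Re_inv z : complex.Re z^-1 = complex.Re z / (complex.Re z ^+ 2 + complex.Im z ^+ 2).
Proof. by case: z. Qed.
Lemma Im_inv z : complex.Im z^-1 = - complex.Im z / (complex.Re z ^+ 2 + complex.Im z ^+ 2).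
Proof. by case: z => a b /=; rewrite mulNr. Qed.

(** The region between the squares is cut into four rectangles avoiding 0, two of full height and
    two short ones, and Goursat applies to each. [s <= 1/4] keeps them in the unit disc. *)
Lemma bdint_annulus h (t s : R) : 0 < t -> t < s -> s <= 1/4 ->
  (forall z, z != 0 -> cmod z < 1 -> exists l, cdiffat h z l) ->
  bdint h (- s, s, (- s, s)) = bdint h (- t, t, (- t, t)).
Proof.
move=> t0 ts s4 H.
have Hpt x y : (x != 0) || (y != 0) -> - s <= x <= s -> - s <= y <= s ->
    exists l, cdiffat h (mkc x y) l.
  move=> xy0 xs ys; apply: H.
    by rewrite eq_complex /= negb_and.
  apply: le_lt_trans (cmod_le_ReIm _) _ => /=.
  have : `|x| <= s by rewrite ler_norml.
  have : `|y| <= s by rewrite ler_norml.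
  by lra.
have dx a b c d : - s <= a -> b <= s -> - s <= c -> d <= s ->
    (0 < a) || (b < 0) || (0 < c) || (d < 0) -> cdiff_rect h a b c d.
  move=> a1 b1 c1 d1 H0 x y xab ycd; apply: Hpt; last 2 first.
  - by lra.
  - by lra.
  apply/orP; case/orP: H0 => [/orP[/orP[]|]|] H0.
  - by left; apply/eqP; lra.
  - by left; apply/eqP; lra.
  - by right; apply/eqP; lra.
  - by right; apply/eqP; lra.
have G1 : bdint h (- s, - t, (- s, s)) = 0.
  by apply: goursat; [lra|lra|apply: dx; [lra|lra|lra|lra|]]; rewrite ?oppr_lt0 t0 ?orbT.
have G2 : bdint h (t, s, (- s, s)) = 0.
  by apply: goursat; [lra|lra|apply: dx; [lra|lra|lra|lra|]]; rewrite ?oppr_lt0 t0 ?orbT.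
have G3 : bdint h (- t, t, (- s, - t)) = 0.
  by apply: goursat; [lra|lra|apply: dx; [lra|lra|lra|lra|]]; rewrite ?oppr_lt0 t0 ?orbT.
have G4 : bdint h (- t, t, (t, s)) = 0.
  by apply: goursat; [lra|lra|apply: dx; [lra|lra|lra|lra|]]; rewrite ?oppr_lt0 t0 ?orbT.
have X y : y != 0 -> - s <= y <= s ->
    xint h y (- s) s = xint h y (- s) (- t) + xint h y (- t) t + xint h y t s.
  move=> y0 ys.
  have Hc : cont_on (fun x => complex.Im (h (mkc x y))) (- s) s.
    by move=> x xs; have [|l /cont_slice_x//] := Hpt x y _ xs ys; rewrite y0 orbT.
  rewrite /xint (@itg_chasles R _ (- s) t s) ?(@itg_chasles R _ (- s) (- t) t)//; try lra.
  by apply: cont_onS Hc; lra.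
have Y x : x != 0 -> - s <= x <= s ->
    yint h x (- s) s = yint h x (- s) (- t) + yint h x (- t) t + yint h x t s.
  move=> x0 xs.
  have Hc : cont_on (fun y => complex.Re (h (mkc x y))) (- s) s.
    by move=> y ys; have [|l /cont_slice_y//] := Hpt x y _ xs ys; rewrite x0.
  rewrite /yint (@itg_chasles R _ (- s) t s) ?(@itg_chasles R _ (- s) (- t) t)//; try lra.
  by apply: cont_onS Hc; lra.
move: G1 G2 G3 G4; rewrite /bdint /=.
rewrite (X s) ?(X (- s)) ?(Y t) ?(Y (- t)); first lra.
all: try (by apply/eqP; lra).
all: try (by lra).
Qed.

Lemma sq_le_cmod (z : C) (t : R) : 0 <= t ->
  t ^+ 2 <= complex.Re z ^+ 2 \/ t ^+ 2 <= complex.Im z ^+ 2 -> t <= cmod z.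
Proof.
move=> t0 H; rewrite -(@ler_pXn2r _ 2)// ?nnegrE ?cmod_ge0// cmod_sqr.
have := sqr_ge0 (complex.Re z); have := sqr_ge0 (complex.Im z).
by case: H; lra.
Qed.

(* With [|u| = 1] and [u f'(0) = m := |f'(0)|], the function
   [h z = u (f z - f 0 - f'(0) z) / z^2] is [o(1/|z|)] at [0], so its integral over the boundary of a
   square centred at [0] vanishes; there [h z = u (f z - f 0) / z^2 - m / z], the first term is
   bounded and the integral of [1/z] is not zero. *)
Lemma schwarz f : (forall z, cmod z < 1 -> derivable f z 1) ->
  (forall z, cmod z < 1 -> cmod (f z) <= 1) -> cmod (derive1 f 0) <= 16.
Proof.
move=> df f1; set d := derive1 f 0.
have z1 : cmod (0 : C) < 1 by rewrite cmod0.
have Hd : cdiffat f 0 d := derivable_cdiffat (df _ z1).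
set m := cmod d.
have [d0|d0] := eqVneq d 0; first by rewrite /m d0 cmod0.
have m0 : 0 < m by rewrite cmod_gt0.
pose u : C := rtoc m / d.
have cu : cmod u = 1.
  by rewrite cmodM cmodV cmod_rtoc (gtr0_norm m0) divff// gt_eqF.
have ud : u * d = rtoc m by rewrite /u divfK.
clearbody u.
pose h (z : C) := u * (f z - f 0 - d * z) * (z * z)^-1.
have Hh z : z != 0 -> cmod z < 1 -> exists l, cdiffat h z l.
  move=> z0 zz; exists (derive1 h z); apply: derivable_cdiffat.
  rewrite /h; apply: (@derivableM _ _ (fun z => u * (f z - f 0 - d * z)) (fun z => (z * z)^-1)).
    apply: (@derivableM _ _ (fun=> u) (fun z => (f z - f 0 - d * z))); first exact: derivable_cst.
    apply: derivableB.
      by apply: derivableB; [exact: df|exact: derivable_cst].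
    by apply: (@derivableM _ _ (fun=> d) id); [exact: derivable_cst|exact: derivable_id].
  apply: derivableV; first by rewrite mulf_neq0.
  by apply: (@derivableM _ _ id id); exact: derivable_id.
have cont_x (t y : R) : 0 < t -> t <= 1/4 -> y = t \/ y = - t ->
    cont_on (fun x => complex.Im (h (mkc x y))) (- t) t.
  move=> t0 t4 yt x xt.
  have [||l /cont_slice_x//] := Hh (mkc x y).
    by rewrite eq_complex /= negb_and; apply/orP; right; apply/eqP; lra.
  apply: le_lt_trans (cmod_le_ReIm _) _ => /=.
  have : `|x| <= t by rewrite ler_norml.
  have : `|y| <= t by rewrite ler_norml; lra.
  by lra.
have cont_y (t x : R) : 0 < t -> t <= 1/4 -> x = t \/ x = - t ->
    cont_on (fun y => complex.Re (h (mkc x y))) (- t) t.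
  move=> t0 t4 xt y yt.
  have [||l /cont_slice_y//] := Hh (mkc x y).
    by rewrite eq_complex /= negb_and; apply/orP; left; apply/eqP; lra.
  apply: le_lt_trans (cmod_le_ReIm _) _ => /=.
  have : `|x| <= t by rewrite ler_norml; lra.
  have : `|y| <= t by rewrite ler_norml.
  by lra.
have Hs : bdint h (- (1/4), 1/4, (- (1/4), 1/4)) = 0.
  apply/eqP; rewrite -normr_le0; apply/ler_addgt0Pl => e e0; rewrite addr0.
  have e8 : 0 < e / 8 by rewrite divr_gt0.
  have [r r0 Hr] := Hd _ e8.
  pose t := Num.min (r / 4) (1 / 8).
  have t0 : 0 < t by rewrite lt_min !divr_gt0.
  have [tr t8] : t <= r / 4 /\ t <= 1 / 8 by split; rewrite ge_min lexx ?orbT.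
  have t4 : t <= 1/4 by lra.
  rewrite (@bdint_annulus h t)//; last by lra.
  (* Boundary points of the small square have modulus in $[t,2t]$; a side has length $2t$, so it
     contributes at most $e/4$. *)
  have Hb z : t <= cmod z -> cmod z <= 2 * t -> cmod (h z) <= e / 8 / t.
    move=> z_t zt2; have cz0 : 0 < cmod z by lra.
    rewrite /h !cmodM cmodV cmodM cu mul1r.
    have Hz : cmod (f z - f 0 - d * z) <= e / 8 * cmod z.
      by have := Hr z; rewrite subr0; apply; lra.
    rewrite ler_pdivrMr ?mulr_gt0//; apply: (le_trans Hz).
    by rewrite mulrA ler_pM2r// mulrAC ler_pdivlMr// ler_pM2l.
  have Hx y : y = t \/ y = - t -> `|xint h y (- t) t| <= e / 4.
    move=> yt; have tt : - t <= t by lra.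
    suff Hb' : forall x, - t <= x <= t -> `|complex.Im (h (mkc x y)) - 0| <= e / 8 / t.
      have := itg_bound tt (cont_x t y t0 t4 yt) Hb'.
      rewrite mul0r subr0 opprK => H; apply: le_trans H _.
      by rewrite le_eqVlt; apply/orP; left; apply/eqP; field; rewrite gt_eqF.
    move=> x xt.
    rewrite subr0; apply: le_trans (Im_le_cmod _) (Hb _ _ _).
        by apply: sq_le_cmod; [lra|right => /=; case: yt => ->; rewrite ?sqrrN].
      apply: le_trans (cmod_le_ReIm _) _ => /=.
      have : `|x| <= t by rewrite ler_norml.
      have : `|y| <= t by rewrite ler_norml; lra.
      by lra.
  have Hy x : x = t \/ x = - t -> `|yint h x (- t) t| <= e / 4.
    move=> xt; have tt : - t <= t by lra.
    suff Hb' : forall y, - t <= y <= t -> `|complex.Re (h (mkc x y)) - 0| <= e / 8 / t.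
      have := itg_bound tt (cont_y t x t0 t4 xt) Hb'.
      rewrite mul0r subr0 opprK => H; apply: le_trans H _.
      by rewrite le_eqVlt; apply/orP; left; apply/eqP; field; rewrite gt_eqF.
    move=> y yt.
    rewrite subr0; apply: le_trans (Re_le_cmod _) (Hb _ _ _).
        by apply: sq_le_cmod; [lra|left => /=; case: xt => ->; rewrite ?sqrrN].
      apply: le_trans (cmod_le_ReIm _) _ => /=.
      have : `|y| <= t by rewrite ler_norml.
      have : `|x| <= t by rewrite ler_norml; lra.
      by lra.
  have X1 := Hx _ (or_introl erefl); have X2 := Hx _ (or_intror erefl).
  have Y1 := Hy _ (or_introl erefl); have Y2 := Hy _ (or_intror erefl).
  move: X1 X2 Y1 Y2; rewrite !ler_norml /bdint /=; lra.
have hE z : z != 0 -> h z = u * (f z - f 0) * (z * z)^-1 - rtoc m * z^-1.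
  by move=> z0; rewrite /h -ud; field.
(* $|f(z)-f(0)|\le 2$ and $|z|^{-2}\le 16$. *)
have Hg z : 1/4 <= cmod z -> cmod z < 1 -> cmod (u * (f z - f 0) * (z * z)^-1) <= 32.
  move=> z4 zz; rewrite !cmodM cmodV cmodM cu mul1r.
  rewrite ler_pdivrMr; last by apply: mulr_gt0; lra.
  apply: (@le_trans _ _ 2).
    by have := cmodD (f z) (- f 0); rewrite cmodN; have := f1 _ zz; have := f1 _ z1; lra.
  nra.
have Hx (x y : R) : - (1/4) <= x <= 1/4 -> y = 1/4 \/ y = - (1/4) ->
   1/4 <= cmod (mkc x y) /\ cmod (mkc x y) < 1 /\ mkc x y != 0 /\
   1/4 <= cmod (mkc y x) /\ cmod (mkc y x) < 1 /\ mkc y x != 0.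
  move=> xx yy.
  have q : 1/4 <= cmod (mkc x y).
    by apply: sq_le_cmod; [lra|right => /=; case: yy => ->; rewrite ?sqrrN].
  have q' : 1/4 <= cmod (mkc y x).
    by apply: sq_le_cmod; [lra|left => /=; case: yy => ->; rewrite ?sqrrN].
  have x1 : `|x| <= 1/4 by rewrite ler_norml.
  have y1 : `|y| <= 1/4 by rewrite ler_norml; lra.
  do !split => //.
  - by apply: le_lt_trans (cmod_le_ReIm _) _ => /=; lra.
  - by rewrite -cmod_gt0; lra.
  - by apply: le_lt_trans (cmod_le_ReIm _) _ => /=; lra.
  - by rewrite -cmod_gt0; lra.
(* Size of the relevant part of $m/z$ on a side of the square, where $x^2+1/16\le 1/8$. *)
have frac (x : R) : - (1/4) <= x <= 1/4 -> 2 * m <= m * ((1/4) / (x ^+ 2 + (1/4) ^+ 2)).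
  move=> xx; have q : 0 < x ^+ 2 + (1/4) ^+ 2.
    by rewrite ltr_wpDl ?sqr_ge0// exprn_gt0//; lra.
  rewrite mulrC ler_pM2l// ler_pdivlMr//; nra.
have hI z : 1/4 <= cmod z -> cmod z < 1 ->
    `|complex.Im (h z) - m * (complex.Im z / (complex.Re z ^+ 2 + complex.Im z ^+ 2))| <= 32.
  move=> z4 z_1; rewrite hE -?cmod_gt0; last by lra.
  rewrite cImB [X in _ - X - _]cImM Im_inv /= mul0r addr0 mulNr mulrN opprK addrK.
  exact: le_trans (Im_le_cmod _) (Hg _ z4 z_1).
have hR z : 1/4 <= cmod z -> cmod z < 1 ->
    `|complex.Re (h z) + m * (complex.Re z / (complex.Re z ^+ 2 + complex.Im z ^+ 2))| <= 32.
  move=> z4 z_1; rewrite hE -?cmod_gt0; last by lra.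
  rewrite cReB [X in _ - X + _]cReM Re_inv /= mul0r subr0 subrK.
  exact: le_trans (Re_le_cmod _) (Hg _ z4 z_1).
have tt : - (1/4) <= 1/4 :> R by lra.
have q0 : 0 < 1/4 :> R by lra.
have K : 1/4 - - (1/4) = 1/2 :> R by lra.
(* Each side, of length 1/2, contributes at most $(32-2m)/2$; the four contributions add up to 0, so
   $m\le 16$. *)
have B1 : xint h (- (1/4)) (- (1/4)) (1/4) <= (32 - 2 * m) * (1/2).
  rewrite -K; apply: itg_ub => //; first by apply: cont_x => //; right.
  move=> x xx; have [p1 [p2 _]] := Hx x _ xx (or_intror erefl).
  have := hI _ p1 p2; rewrite ler_norml => /andP[_] /=.
  by rewrite sqrrN mulNr mulrN opprK; have := frac x xx; lra.
have B2 : - xint h (1/4) (- (1/4)) (1/4) <= (32 - 2 * m) * (1/2).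
  rewrite lerNl -mulNr -K -(itg_cst _ tt); apply: itg_le => //.
  - exact: cont_on_cst.
  - by apply: cont_x => //; left.
  move=> x xx; have [p1 [p2 _]] := Hx x _ xx (or_introl erefl).
  have := hI _ p1 p2; rewrite ler_norml => /andP[+ _]; rewrite /=.
  by have := frac x xx; lra.
have B3 : yint h (1/4) (- (1/4)) (1/4) <= (32 - 2 * m) * (1/2).
  rewrite -K; apply: itg_ub => //; first by apply: cont_y => //; left.
  move=> x xx; have [_ [_ [_ [p1 [p2 _]]]]] := Hx x _ xx (or_introl erefl).
  have := hR _ p1 p2; rewrite ler_norml => /andP[_] /=.
  by rewrite (addrC (_ ^+ 2)); have := frac x xx; lra.
have B4 : - yint h (- (1/4)) (- (1/4)) (1/4) <= (32 - 2 * m) * (1/2).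
  rewrite lerNl -mulNr -K -(itg_cst _ tt); apply: itg_le => //.
  - exact: cont_on_cst.
  - by apply: cont_y => //; right.
  move=> x xx; have [_ [_ [_ [p1 [p2 _]]]]] := Hx x _ xx (or_intror erefl).
  have := hR _ p1 p2; rewrite ler_norml => /andP[+ _]; rewrite /=.
  by rewrite sqrrN (addrC (_ ^+ 2)) mulNr mulrN; have := frac x xx; lra.
move: Hs; rewrite /bdint /=; lra.
Qed.

End schwarz.

Section complex_limits.
Context (R : realType) (T : Type) (F : set_system T) {FF : Filter F}.
Local Notation C := (cplx R).
Implicit Types (f g : T -> C) (a b : C).

Lemma cvg_cmod f a :
  f @ F --> a <-> forall e : R, 0 < e -> \forall t \near F, cmod (f t - a) < e.
Proof. exact: (@cvg_nm R T F FF C^o). Qed.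

Lemma ccvgM f g a b : f @ F --> a -> g @ F --> b -> (fun t => f t * g t) @ F --> a * b.
Proof. exact: (@cvgM C T F FF f g a b). Qed.

Lemma ccvgD f g a b : f @ F --> a -> g @ F --> b -> (fun t => f t + g t) @ F --> a + b.
Proof. exact: (@cvgD C C^o T F FF f g a b). Qed.

Lemma ccvgV f a : a != 0 -> f @ F --> a -> (fun t => (f t)^-1) @ F --> a^-1.
Proof. exact: (@cvgV C T F FF f a). Qed.

Lemma ccvg_cst a : (fun=> a) @ F --> a.
Proof. exact: cvg_cst. Qed.

End complex_limits.

(** * Lower bound for the Kobayashi distance *)

Section lin.
Context (R : realType) (n : nat).
Local Notation C := (cplx R).
Local Notation Cn := 'rV[C]_n.

Definition lin (a : 'I_n -> C) (X : Cn) : C := \sum_j a j * X ord0 j.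

Lemma linD a X Y : lin a (X + Y) = lin a X + lin a Y.
Proof. by rewrite /lin -big_split; apply: eq_bigr => j _; rewrite mxE mulrDr. Qed.
Lemma linZ a (k : C) X : lin a (k *: X) = k * lin a X.
Proof. by rewrite /lin mulr_sumr; apply: eq_bigr => j _; rewrite mxE mulrCA. Qed.
Lemma linN a X : lin a (- X) = - lin a X.
Proof. by rewrite -scaleN1r linZ mulN1r. Qed.
Lemma linB a X Y : lin a (X - Y) = lin a X - lin a Y.
Proof. by rewrite linD linN. Qed.

Lemma lin_le a X : cmod (lin a X) <= (\sum_j cmod (a j)) * nm X.
Proof.
rewrite /lin mulr_suml.
have H (I : Type) (r : seq I) (F : I -> C) : cmod (\sum_(i <- r) F i) <= \sum_(i <- r) cmod (F i).
  elim: r => [|i r IH]; first by rewrite !big_nil cmod0.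
  by rewrite !big_cons; apply: le_trans (cmodD _ _) _; rewrite lerD2l.
apply: le_trans (H _ _ _) _; apply: ler_sum => j _.
by rewrite cmodM ler_wpM2l ?cmod_ge0// coord_le_nm.
Qed.

Lemma lin_cvg (T : Type) (F : set_system T) {FF : Filter F} a (f : T -> Cn) (l : Cn) :
  f @ F --> l -> (fun t => lin a (f t)) @ F --> (lin a l).
Proof.
move=> /cvg_nm H; apply/cvg_cmod => e e0.
have K0 : 0 < 1 + \sum_j cmod (a j).
  by rewrite ltr_wpDr// sumr_ge0// => j _; exact: cmod_ge0.
have e1 : 0 < e / (1 + \sum_j cmod (a j)) by rewrite divr_gt0.
apply: filterS (H _ e1) => t; rewrite ltr_pdivlMr// => tl.
rewrite -linB; apply: le_lt_trans (lin_le _ _) _.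
by apply: le_lt_trans tl; rewrite mulrC ler_wpM2l ?nm_ge0// lerDr.
Qed.

(** The increment [s] and the filter are arbitrary so that one computation serves the complex
    derivative along a disc ([s] the identity) and the real derivative along a curve
    ([s = rtoc]). *)
Lemma cvg_quot (T : Type) (F : set_system T) {FF : Filter F} (s M : T -> C) (M0 d K : C) :
  s @ F --> (0) -> (\forall h \near F, s h != 0) ->
  (fun h => (s h)^-1 * (M h - M0)) @ F --> (d) -> M0 != 0 ->
  (fun h => (s h)^-1 * (K * (M h)^-1 - K * M0^-1)) @ F --> (- K * d * (M0 * M0)^-1).
Proof.
move=> s0 sn0 Md M00.
have MM : M @ F --> (M0).
  have H : (fun h => s h * ((s h)^-1 * (M h - M0)) + M0) @ F --> (0 * d + M0).
    exact: (ccvgD (ccvgM s0 Md) (@ccvg_cst R T F FF M0)).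
  rewrite mul0r add0r in H; apply: cvg_trans H; apply: near_eq_cvg.
  by apply: filterS sn0 => h sh; rewrite mulrA divff// mul1r subrK.
have MN : \forall h \near F, M h != 0.
  have /cvg_cmod/(_ (cmod M0)) H := MM; have := H; rewrite cmod_gt0 => /(_ M00).
  apply: filterS => h Hh; apply/eqP => Mh; move: Hh.
  by rewrite Mh sub0r cmodN ltxx.
have H : (fun h => - K * ((s h)^-1 * (M h - M0)) * ((M h)^-1 * M0^-1)) @ F -->
    (- K * d * (M0^-1 * M0^-1)).
  exact: (ccvgM (ccvgM (@ccvg_cst R T F FF (- K)) Md)
    (ccvgM (ccvgV M00 MM) (@ccvg_cst R T F FF M0^-1))).
rewrite -invfM in H; apply: cvg_trans H; apply: near_eq_cvg.
by apply: filterS2 sn0 MN => h sh Mh; field; rewrite sh Mh M00.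
Qed.

End lin.

Section royden_lower.
Context (R : realType) (n : nat).
Local Notation C := (cplx R).
Local Notation Cn := 'rV[C]_n.
Implicit Types (D : set Cn) (a : 'I_n -> C) (b : C).

Lemma derivable_quot (phi : C -> Cn) a b (K z : C) : derivable phi z 1 ->
  lin a (phi z) + b != 0 ->
  derivable (fun w => K * (lin a (phi w) + b)^-1) z 1 /\
  derive1 (fun w => K * (lin a (phi w) + b)^-1) z =
    - K * lin a (derive1 phi z) * ((lin a (phi z) + b) * (lin a (phi z) + b))^-1.
Proof.
move=> dphi M0.
have H : (fun t : C => t^-1 *: (phi (t + z) - phi z)) @ 0^' --> derive1 phi z.
  rewrite derive1E; have := dphi; rewrite /derivable /derive.
  rewrite (_ : (fun t => t^-1 *: ((phi \o shift z) (t *: 1) - phi z)) =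
    (fun t => t^-1 *: (phi (t + z) - phi z))); first by [].
  by apply/funext => t /=; rewrite [t *: 1]mulr1.
have {}H := @lin_cvg R n C _ (@dnbhs_filter C 0) a _ _ H.
pose M (t : C) : C := lin a (phi (t + z)) + b.
have s0 : (id : C -> C) @ (0 : C)^' --> (0 : C) by exact: nbhs_dnbhs.
have sn0 : \forall h \near (0 : C)^', (id : C -> C) h != 0 by exact: nbhs_dnbhs_neq.
have Md : (fun h : C => h^-1 * (M h - (lin a (phi z) + b))) @ (0 : C)^' -->
    lin a (derive1 phi z).
  apply: cvg_trans H; apply: near_eq_cvg; apply: nearW => t.
  by rewrite linZ linB /M opprD addrACA subrr addr0.
have Q := @cvg_quot R C _ (@dnbhs_filter C 0) id M _ _ K s0 sn0 Md M0.
set f := fun w => _.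
have Q' : (fun t : C => t^-1 *: ((f \o shift z) (t *: 1) - f z)) @ 0^' -->
    (- K * lin a (derive1 phi z) * ((lin a (phi z) + b) * (lin a (phi z) + b))^-1).
  apply: cvg_trans Q; apply: near_eq_cvg; apply: nearW => t /=.
  by rewrite /f [t *: 1]mulr1.
split; first by apply/cvg_ex; eexists; exact: Q'.
by rewrite derive1E; apply: cvg_lim Q'.
Qed.

Lemma derive1_addl (g : C -> C) (k z : C) : derivable g z 1 ->
  derivable (fun w => k + g w) z 1 /\ derive1 (fun w => k + g w) z = derive1 g z.
Proof.
have E : (fun t : C => t^-1 *: (((fun w => k + g w) \o shift z) (t *: 1) - (k + g z))) =
    (fun t : C => t^-1 *: ((g \o shift z) (t *: 1) - g z)).
  by apply/funext => t /=; rewrite opprD addrACA subrr add0r.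
by move=> dg; rewrite !derive1E /derivable /derive E; split.
Qed.

(** Derivative along [X] of the real part of $c\,(w-1)/(w+1)$ with $w=\mathrm{lin}_a(z)+b$, over the
    constant 16 of [schwarz]. A real part, unlike a modulus, integrates along a curve to a
    difference of endpoint values; the rotation [c] is chosen at the end to recover the modulus. *)
Definition royden_lb a b (c : C) (z X : Cn) : R :=
  complex.Re (2 * c * lin a X * ((lin a z + (b + 1)) * (lin a z + (b + 1)))^-1) / 16.

Lemma Re_pos_cmod (w : C) : 0 < complex.Re w -> cmod (w - 1) <= cmod (w + 1) /\ w + 1 != 0.
Proof.
move=> w0; split.
  rewrite -(@ler_pXn2r _ 2)// ?nnegrE ?cmod_ge0// !cmod_sqr.
  by rewrite cReB cReD cImB cImD /=; nra.
apply/eqP => H; have := congr1 (@complex.Re R) H; rewrite cReD /=; lra.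
Qed.

(* [w |-> (w - 1) / (w + 1) = 1 - 2 / (w + 1)] maps the right half-plane into the unit disc. *)
Lemma royden_ge D a b (c : C) (z X : Cn) :
  (forall w, D w -> 0 < complex.Re (lin a w + b)) -> cmod c = 1 ->
  ((royden_lb a b c z X)%:E <= kobayashi_royden D z X)%E.
Proof.
move=> HD c1; apply: le_ereal_inf_tmp => _ [alpha [phi [hphi phiD phi0 aX]] <-].
rewrite lee_fin.
have d0 : disc 1 (0 : C) by rewrite /disc /= cmod0.
pose f (w : C) : C := 1 + - 2 * (lin a (phi w) + (b + 1))^-1.
have pos w : disc 1 w -> 0 < complex.Re (lin a (phi w) + b) by move/phiD/HD.
have nz w : disc 1 w -> lin a (phi w) + (b + 1) != 0.
  by move=> /pos/Re_pos_cmod[_]; rewrite addrA.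
have df w : disc 1 w -> derivable f w 1.
  move=> dw; have [d1 _] := derivable_quot (- 2) (hphi _ dw) (nz _ dw).
  by have [] := derive1_addl 1 d1.
have bf w : disc 1 w -> cmod (f w) <= 1.
  move=> dw; have [h1 h2] := Re_pos_cmod (pos _ dw).
  have -> : f w = (lin a (phi w) + b - 1) / (lin a (phi w) + b + 1).
    rewrite /f addrA; move: h2; set q := lin a (phi w) + b => h2.
    by field.
  by rewrite cmodM cmodV ler_pdivrMr ?mul1r// cmod_gt0.
have S := schwarz df bf.
have -> : royden_lb a b c z X = complex.Re (c * alpha * derive1 f 0) / 16.
  rewrite /royden_lb -aX linZ -phi0; congr (complex.Re _ / 16).
  have [q1 q2] := derivable_quot (- 2) (hphi _ d0) (nz _ d0).
  have [_ ->] := derive1_addl 1 q1.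
  by rewrite q2; ring.
rewrite ler_pdivrMr//; apply: le_trans (ler_norm _) _.
apply: le_trans (Re_le_cmod _) _; rewrite !cmodM c1 mul1r.
by rewrite ler_wpM2l ?cmod_ge0.
Qed.

Lemma royden_ge0 D (z X : Cn) : (0 <= kobayashi_royden D z X)%E.
Proof.
by apply: le_ereal_inf_tmp => _ [alpha _ <-]; rewrite lee_fin cmod_ge0.
Qed.

End royden_lower.

(* No measurability is assumed: it is not available for the Kobayashi-Royden metric along a curve. *)
Lemma ge0_le_integral_nomeas d (T : measurableType d) (R : realType)
    (mu : {measure set T -> \bar R}) (D : set T) (f1 f2 : T -> \bar R) :
  (forall x, D x -> (0 <= f1 x)%E) -> (forall x, D x -> (f1 x <= f2 x)%E) ->
  (\int[mu]_(x in D) f1 x <= \int[mu]_(x in D) f2 x)%E.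
Proof.
move=> f10 f12; rewrite !(integral_mkcond D).
have h10 x : (0 <= (f1 \_ D) x)%E by apply: erestrict_ge0.
have h20 x : (0 <= (f2 \_ D) x)%E.
  by apply: erestrict_ge0 => t Dt; apply: le_trans (f12 _ Dt); exact: f10.
rewrite !ge0_integralTE//; apply: ge_ereal_sup => _ [h hf <-] /=.
apply: ereal_sup_ubound; exists h => //= x; apply: le_trans (hf x) _; exact: lee_restrict.
Qed.

Section curves.
Context (R : realType) (n : nat).
Local Notation C := (cplx R).
Local Notation Cn := 'rV[C]_n.
Implicit Types (h g : R -> Cn) (a : 'I_n -> C) (b K : C).

Definition curve_derivable h t :=
  forall j, derivable (re_coord h j) t 1 /\ derivable (im_coord h j) t 1.

Lemma Re_rtocM (x : R) (z : C) : complex.Re (rtoc x * z) = x * complex.Re z.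
Proof. by rewrite cReM /= mul0r subr0. Qed.
Lemma Im_rtocM (x : R) (z : C) : complex.Im (rtoc x * z) = x * complex.Im z.
Proof. by rewrite cImM /= mul0r addr0. Qed.

Lemma curve_cvg h t : curve_derivable h t ->
  (fun s : R => (rtoc s)^-1 *: (h (s + t) - h t)) @ 0^' --> curve_derive h t.
Proof.
move=> H; apply/cvg_nm => e e0.
have e4 : 0 < e / 4 by rewrite divr_gt0.
have Q (f : R -> R) : derivable f t 1 -> \forall s \near 0^',
    `|s^-1 * (f (s + t) - f t) - derive1 f t| < e / 4.
  move=> df.
  have : (fun s : R => s^-1 *: (f (s + t) - f t)) @ 0^' --> derive1 f t.
    rewrite derive1E; have := df; rewrite /derivable /derive.
    rewrite (_ : (fun s => s^-1 *: ((f \o shift t) (s *: 1) - f t)) =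
      (fun s => s^-1 *: (f (s + t) - f t))); first by [].
    by apply/funext => s /=; rewrite [s *: 1]mulr1.
  by move/cvgrPdist_lt => /(_ _ e4); apply: filterS => s; rewrite distrC.
near=> s.
apply: (@le_lt_trans _ _ (e / 2)); last by lra.
apply: nm_le => [|j]; first by lra.
apply: le_trans (cmod_le_ReIm _) _.
rewrite !mxE cReB cImB -rtocV Re_rtocM Im_rtocM cReB cImB /=.
have h1 : `|s^-1 * (re_coord h j (s + t) - re_coord h j t) - derive1 (re_coord h j) t| < e / 4.
  by move: j; near: s; apply: filter_forall => j; apply: Q; have [] := H j.
have h2 : `|s^-1 * (im_coord h j (s + t) - im_coord h j t) - derive1 (im_coord h j) t| < e / 4.
  by move: j {h1}; near: s; apply: filter_forall => j; apply: Q; have [] := H j.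
move: h1 h2; rewrite /re_coord /im_coord; lra.
Unshelve. all: by end_near. Qed.

Lemma rtoc_dnbhs : (@rtoc R : R -> C) @ 0^' --> (0 : C).
Proof.
apply/cvg_cmod => e e0; near=> s; rewrite subr0 cmod_rtoc.
by near: s; exact: dnbhs0_lt.
Unshelve. all: by end_near. Qed.

Lemma curve_derivable_cont h t : curve_derivable h t -> {for t, continuous h}.
Proof.
move=> /curve_cvg/cvg_nm H; apply/cvg_nm => e e0.
have K0 : 0 < 1 + nm (curve_derive h t) by rewrite ltr_wpDr ?nm_ge0.
have e1 : 0 < e / (1 + nm (curve_derive h t)) by rewrite divr_gt0.
have H1 : \forall s \near 0^', nm (h (s + t) - h t) < e.
  near=> s.
  have s0 : s != 0 by near: s; exact: nbhs_dnbhs_neq.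
  have h1 : nm ((rtoc s)^-1 *: (h (s + t) - h t) - curve_derive h t) < 1.
    by near: s; exact: H.
  have h2 : `|s| < e / (1 + nm (curve_derive h t)) by near: s; exact: dnbhs0_lt.
  rewrite ltr_pdivlMr// in h2; apply: le_lt_trans h2.
  have {1}-> : h (s + t) - h t = rtoc s *: ((rtoc s)^-1 *: (h (s + t) - h t)).
    by rewrite scalerA divff ?scale1r// rtoc_eq0.
  rewrite nmZ cmod_rtoc ler_wpM2l//.
  rewrite -[X in nm X](subrK (curve_derive h t)).
  by apply: le_trans (nmD _ _) _; rewrite lerD2r ltW.
move: H1; rewrite near_withinE => /nbhs_ballP[r /= r0 Hr].
apply/nbhs_ballP; exists r => // s /= ts.
have [->|st] := eqVneq s t; first by rewrite subrr nm0.
have := Hr (s - t); rewrite subrK; apply; last by rewrite subr_eq0.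
by move: ts; rewrite /ball /= sub0r normrN distrC.
Unshelve. all: by end_near. Qed.

Definition upath a b K h (t : R) : R := complex.Re (K * (lin a (h t) + b)^-1).
Definition vpath a b K h (t : R) : R :=
  complex.Re (- K * lin a (curve_derive h t) * ((lin a (h t) + b) * (lin a (h t) + b))^-1).

Lemma upath_derive a b K h t : curve_derivable h t -> lin a (h t) + b != 0 ->
  is_derive t 1 (upath a b K h) (vpath a b K h t).
Proof.
move=> hd M0.
have H := @lin_cvg R n R _ (@dnbhs_filter R 0) a _ _ (curve_cvg hd).
have s0 := rtoc_dnbhs.
have sn0 : \forall s \near (0 : R)^', rtoc s != 0.
  by near=> s; rewrite rtoc_eq0; near: s; exact: nbhs_dnbhs_neq.
pose M (s : R) : C := lin a (h (s + t)) + b.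
have Md : (fun s : R => (rtoc s)^-1 * (M s - (lin a (h t) + b))) @ (0 : R)^' -->
    lin a (curve_derive h t).
  apply: cvg_trans H; apply: near_eq_cvg; apply: nearW => s.
  by rewrite linZ linB /M opprD addrACA subrr addr0.
have Q := @cvg_quot R R _ (@dnbhs_filter R 0) (@rtoc R) M _ _ K s0 sn0 Md M0.
have Q' : (fun s : R => s^-1 *: ((upath a b K h \o shift t) (s *: 1) - upath a b K h t)) @ 0^'
     --> (vpath a b K h t : R^o).
  have Q1 := cvg_comp _ _ Q (@Re_continuous R _).
  apply: cvg_trans Q1; apply: near_eq_cvg; apply: nearW => s /=.
  by rewrite -rtocV Re_rtocM cReB [s *: 1]mulr1.
apply: DeriveDef; first by apply/cvg_ex; eexists; exact: Q'.
by apply: cvg_lim Q'.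
Unshelve. all: by end_near. Qed.

Lemma vpath_cont a b K h t : C1_curve h -> lin a (h t) + b != 0 ->
  {for t, continuous (vpath a b K h)}.
Proof.
move=> [hd hc] M0.
have c1 : (fun s => lin a (h s)) @ t --> lin a (h t).
  by apply: lin_cvg; apply: curve_derivable_cont => j; exact: hd.
have c2 : (fun s => lin a (curve_derive h s)) @ t --> lin a (curve_derive h t).
  by apply: lin_cvg; exact: hc.
have c3 : (fun s => lin a (h s) + b) @ t --> lin a (h t) + b.
  exact: (ccvgD c1 (@ccvg_cst R R _ _ b)).
have MM : (lin a (h t) + b) * (lin a (h t) + b) != 0 by rewrite mulf_neq0.
have c4 : (fun s => - K * lin a (curve_derive h s) *
    ((lin a (h s) + b) * (lin a (h s) + b))^-1) @ t -->
    - K * lin a (curve_derive h t) * ((lin a (h t) + b) * (lin a (h t) + b))^-1.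
  exact: (ccvgM (ccvgM (@ccvg_cst R R _ _ (- K)) c2) (ccvgV MM (ccvgM c3 c3))).
exact: (cvg_comp _ _ c4 (@Re_continuous R _)).
Qed.

(** The positive part is taken because the minorant of $\kappa_D$ has to be nonnegative. The
    interval is open because at its ends the derivative of the full curve need not be that of the
    piece [h]. *)
Lemma piece_integral a b K h (s t : R) : C1_curve h -> s < t ->
  (forall x, s <= x <= t -> lin a (h x) + b != 0) ->
  measurable_fun `]s, t[ (fun x => Num.max 0 (vpath a b K h x)) /\
  ((upath a b K h t - upath a b K h s)%:E <=
    \int[@lebesgue_measure R]_(x in `]s, t[) (Num.max 0 (vpath a b K h x))%:E)%E.
Proof.
move=> hC st M0.
have cv : cont_on (vpath a b K h) s t by move=> x xst; apply: vpath_cont => //; exact: M0.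
have cm : cont_on (fun x => Num.max 0 (vpath a b K h x)) s t.
  by move=> x xst; apply: (@continuous_max _ _ (cst 0)); [exact: cvg_cst|exact: cv].
have iv := cont_on_int cv; have im := cont_on_int cm.
have sub : `]s, t[%classic `<=` `[s, t]%classic by apply: subset_itvW.
split.
  apply: (@measurable_funS _ _ _ _ `[s, t]) => //.
  by case/integrableP : im => /measurable_EFinP.
have FT : (\int[@lebesgue_measure R]_(x in `[s, t]) (vpath a b K h x)%:E =
    (upath a b K h t)%:E - (upath a b K h s)%:E)%E.
  have du x : s <= x <= t -> is_derive x 1 (upath a b K h) (vpath a b K h x).
    by move=> xst; apply: upath_derive; [exact: hC.1|exact: M0].
  have cu x : s <= x <= t -> {for x, continuous (upath a b K h)}.
    move=> /du dx; apply: differentiable_continuous.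
    by apply/derivable1_diffP; exact: ex_derive.
  apply: continuous_FTC2 => //; first exact: cont_onW.
    split.
    - move=> x; rewrite in_itv /= => /andP[x1 x2].
      by apply: (@ex_derive _ _ _ _ _ _ _ (du x _)); rewrite !ltW.
    - by apply: cvg_at_right_filter; apply: cu; rewrite lexx ltW.
    - by apply: cvg_at_left_filter; apply: cu; rewrite lexx ltW.
  move=> x; rewrite in_itv /= => /andP[x1 x2].
  by rewrite derive1E; apply: (@derive_val _ _ _ _ _ _ _ (du x _)); rewrite !ltW.
rewrite EFinB -FT integral_itv_bndoo; last first.
  by apply: (@measurable_funS _ _ _ _ `[s, t]) => //; case/integrableP : iv.
apply: le_integral => //.
- exact: integrableS iv.
- exact: integrableS im.
- by move=> x _; rewrite lee_fin le_max lexx orbT.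
Qed.

Lemma curve_derive_eq g h (s t x : R) : (forall y, s <= y <= t -> g y = h y) ->
  s < x < t -> curve_derive g x = curve_derive h x.
Proof.
move=> gh /andP[sx xt].
have N : \near x, g x = h x.
  near=> y; apply: gh; apply/andP; split; apply: ltW.
    by near: y; exact: lt_nbhsr.
  by near: y; exact: lt_nbhsl.
apply/rowP => j; rewrite !mxE !derive1E; congr (_ +i* _)%C; apply: near_eq_derive.
  by apply: filterS N => y; rewrite /re_coord => ->.
by apply: filterS N => y; rewrite /im_coord => ->.
Unshelve. all: by end_near. Qed.

Lemma dist_ge (D : set Cn) a b (c : C) (x y : Cn) :
  (forall w, D w -> 0 < complex.Re (lin a w + b)) -> cmod c = 1 ->
  (((complex.Re (c * 2 * (lin a x + (b + 1))^-1) -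
    complex.Re (c * 2 * (lin a y + (b + 1))^-1)) / 16)%:E <= kobayashi_dist D x y)%E.
Proof.
move=> HD c1; apply: le_ereal_inf_tmp => _ [g [[m [t [t0 tm tS]]] gD gx gy] <-].
(* The sign cancels the one from differentiating an inverse, so that [vpath] with this [K] is
   [royden_lb]. *)
pose K : C := - (rtoc (16^-1) * (2 * c)).
pose U (z : Cn) : R := complex.Re (K * (lin a z + (b + 1))^-1).
have UE z : U z = - complex.Re (c * 2 * (lin a z + (b + 1))^-1) / 16.
  rewrite /U; set q := (lin a z + (b + 1))^-1.
  have -> : K * q = rtoc (- 16^-1) * (c * 2 * q) by rewrite /K rtocN; ring.
  by rewrite Re_rtocM mulNr mulNr mulrC.
have -> : (complex.Re (c * 2 * (lin a x + (b + 1))^-1) -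
    complex.Re (c * 2 * (lin a y + (b + 1))^-1)) / 16 = U y - U x.
  by rewrite !UE; ring.
have tmono k i : (i + k <= m)%N -> t i <= t (i + k)%N.
  elim: k => [|k IH]; first by rewrite addn0.
  rewrite addnS => H; apply: le_trans (IH (ltnW H)) _.
  by have [/ltW] := tS _ H.
have t01 i : (i <= m)%N -> 0 <= t i <= 1.
  move=> im; rewrite -t0 -tm; have := @tmono i 0%N; rewrite add0n => -> //=.
  by have := @tmono (m - i)%N i; rewrite subnKC// => ->.
pose kap s := kobayashi_royden D (g s) (curve_derive g s).
have nz z : D z -> lin a z + (b + 1) != 0.
  by move=> /HD/Re_pos_cmod[_]; rewrite addrA.
(* [G] is a measurable minorant of [kap], which itself may fail to be measurable. Since [G] vanishes
   from [t i] on, the positive part on the next piece can be added without overlap. *)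
suff H i : (i <= m)%N -> exists G : R -> R, [/\ measurable_fun setT G,
    forall s, 0 <= G s, forall s, t i <= s -> G s = 0,
    forall s, 0 <= s <= 1 -> ((G s)%:E <= kap s)%E &
    ((U (g (t i)) - U x)%:E <= \int[@lebesgue_measure R]_(s in `[0%R, 1%R]) (G s)%:E)%E].
  have [G [mG G0 _ Gk]] := H m (leqnn m); rewrite tm gy => GU.
  apply: le_trans GU _; apply: ge0_le_integral_nomeas => s /=.
    by rewrite lee_fin.
  by rewrite in_itv /=; exact: Gk.
elim: i => [_|i IH im].
  exists (fun=> 0); split => //.
  - by move=> s _; exact: royden_ge0.
  - by rewrite t0 gx subrr integral0.
have [G [mG G0 Gt Gk GU]] := IH (ltnW im).
have [tt [h hC gh]] := tS _ im.
have ti := t01 _ (ltnW im); have tSi := t01 _ im.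
have inD s : t i <= s <= t i.+1 -> D (g s) by move=> ss; apply: gD; lra.
have nzh s : t i <= s <= t i.+1 -> lin a (h s) + (b + 1) != 0.
  by move=> ss; rewrite -gh//; apply: nz; exact: inD.
have [mF FU] := @piece_integral a (b + 1) K h _ _ hC tt nzh.
pose F (s : R) : R := Num.max 0 (vpath a (b + 1) K h s); rewrite -/F in mF.
pose I : set R := `]t i, t i.+1[%classic.
pose P : R -> R := F \_ I.
have F0 s : 0 <= F s by rewrite /F le_max lexx.
have P0 s : 0 <= P s by rewrite /P patchE; case: ifP.
have PI s : ~ I s -> P s = 0 by move=> Is; rewrite /P patchE memNset.
have mI : measurable I by exact: measurable_itv.
have mP : measurable_fun setT P := (measurable_restrictT _ mI).1 mF.
exists (fun s => G s + P s); split.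
- exact: measurable_funD.
- by move=> s; rewrite addr_ge0.
- move=> s ts; rewrite Gt ?PI ?addr0//; last by lra.
  by rewrite /I /= in_itv /=; lra.
- move=> s s01; have [Is|Is] := pselect (I s); last by rewrite PI// addr0 Gk.
  have := Is; rewrite /I /= in_itv /= => ss.
  rewrite Gt ?add0r; last by lra.
  rewrite /P patchE mem_set// /F /kap.
  have E : vpath a (b + 1) K h s = royden_lb a b c (g s) (curve_derive g s).
    rewrite (curve_derive_eq gh)// /vpath /royden_lb gh; last by lra.
    by rewrite /K opprK -!mulrA Re_rtocM mulrC !mulrA.
  rewrite E /Num.max; case: ifP => _; first exact: royden_ge.
  exact: royden_ge0.
under eq_integral do rewrite EFinD.
rewrite ge0_integralD//; last 4 first.
- by move=> s _; rewrite lee_fin.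
- apply: measurable_funTS; exact/measurable_EFinP.
- by move=> s _; rewrite lee_fin.
- apply: measurable_funTS; exact/measurable_EFinP.
have -> : U (g (t i.+1)) - U x = (U (g (t i)) - U x) + (U (g (t i.+1)) - U (g (t i))).
  by lra.
rewrite EFinD; apply: leeD GU _.
have -> : (\int[@lebesgue_measure R]_(s in `[0%R, 1%R]) (P s)%:E)%E =
    (\int[@lebesgue_measure R]_(s in I) (F s)%:E)%E.
  under eq_integral do rewrite -[(P _)%:E]/((EFin \o P) _) /P -restrict_EFin.
  rewrite -integral_mkcondr; congr (integral _ _ _).
  by apply/setIidr => s; rewrite /I /= !in_itv /=; lra.
apply: le_trans FU; rewrite lee_fin /upath -!gh ?lexx//; lra.
Qed.

End curves.

(** * Convexity, separation and discs forced by a small Kobayashi distance *)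

Section convex.
Context (R : realType) (n : nat).
Local Notation C := (cplx R).
Local Notation Cn := 'rV[C]_n.
Implicit Types (D : set Cn) (x y z w v q : Cn).

Definition rconvex D := forall x y (t : R), 0 <= t <= 1 -> D x -> D y ->
  D (rtoc (1 - t) *: x + rtoc t *: y).

Lemma convex_rconvex D : convex_set (D : set (convex_lmodType Cn)) -> rconvex D.
Proof.
move=> cD x y t /andP[t0 t1] Dx Dy.
have s0 : 0 <= rtoc (1 - t) :> C by rewrite -rtoc0 rtoc_le subr_ge0.
have s1 : rtoc (1 - t) <= 1 :> C by rewrite -rtoc1 rtoc_le lerBlDr lerDl.
have := cD x y (Itv01 s0 s1); rewrite !inE => /(_ Dx Dy).
have E : rtoc t = 1 - rtoc (1 - t) :> C by rewrite rtocB rtoc1 opprB addrC subrK.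
by rewrite E.
Qed.

(** For [0 < s] this is $\delta(z)\ge s$ without an infimum; for [s <= 0] it is vacuous and does not
    even give [D z]. *)
Definition inball D z (s : R) := forall w, nm (w - z) < s -> D w.

Lemma open_inball D z : open D -> D z -> exists2 s : R, 0 < s & inball D z s.
Proof. by move=> oD Dz; apply/nbhs_nm; apply: open_nbhs_nbhs. Qed.

Lemma inball_center D z s : 0 < s -> inball D z s -> D z.
Proof. by move=> s0; apply; rewrite subrr nm0. Qed.

Lemma inballW D z s s' : s' <= s -> inball D z s -> inball D z s'.
Proof. by move=> ss H w ws; apply: H; apply: lt_le_trans ss. Qed.

Lemma conv_shift x y e (r s t rho : R) : rho != 0 -> rho = (1 - t) * r + t * s ->
  rtoc (1 - t) *: (x + rtoc (r / rho) *: e) + rtoc t *: (y + rtoc (s / rho) *: e) =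
  rtoc (1 - t) *: x + rtoc t *: y + e.
Proof.
move=> r0 rE; rewrite !scalerDr !scalerA addrACA -[X in _ + X]scalerDl -!rtocM -rtocD.
have -> : (1 - t) * (r / rho) + t * (s / rho) = 1 by rewrite rE in r0 *; field.
by rewrite rtoc1 scale1r.
Qed.

(** The distance to the boundary of a convex set is concave: a displacement [e] of the combination
    is distributed over [x] and [y] in proportion to their radii. *)
Lemma inball_conv D x y r s t : rconvex D -> 0 < r -> 0 < s -> 0 <= t <= 1 ->
  inball D x r -> inball D y s ->
  inball D (rtoc (1 - t) *: x + rtoc t *: y) ((1 - t) * r + t * s).
Proof.
move=> cD r0 s0 t01 Bx By w.
pose p := rtoc (1 - t) *: x + rtoc t *: y; pose rho := (1 - t) * r + t * s.
rewrite -/p -/rho => wp.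
have rho0 : 0 < rho by apply: le_lt_trans wp; exact: nm_ge0.
pose e := w - p.
have He (k : R) : 0 < k -> nm (rtoc (k / rho) *: e) < k.
  move=> k0; rewrite nmZ cmod_rtoc ger0_norm ?divr_ge0 ?ltW//.
  by rewrite mulrAC ltr_pdivrMr// ltr_pM2l.
have Dx : D (x + rtoc (r / rho) *: e) by apply: Bx; rewrite addrAC subrr add0r He.
have Dy : D (y + rtoc (s / rho) *: e) by apply: By; rewrite addrAC subrr add0r He.
have := cD _ _ _ t01 Dx Dy.
rewrite (conv_shift x y e _ (erefl rho)) ?gt_eqF// -/p /e.
by rewrite addrC subrK.
Qed.

(** [q] is replaced by a nearby [w] of [D], and the defect is absorbed by moving [x] inside its
    ball: the point remains the same combination of the two. *)
Lemma segment_interior D x q r t : rconvex D -> 0 < r -> inball D x r -> 0 <= t < 1 ->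
  (forall e, 0 < e -> exists2 w, D w & nm (w - q) < e) ->
  D (rtoc (1 - t) *: x + rtoc t *: q).
Proof.
move=> cD r0 Bx /andP[t0 t1] Hq.
have t1' : 0 < 1 - t by rewrite subr_gt0.
have [w Dw wq] := Hq _ (mulr_gt0 r0 t1').
have Dx : D (x + rtoc (t / (1 - t)) *: (q - w)).
  have tt : 0 <= t / (1 - t) by apply: divr_ge0 => //; exact: ltW.
  apply: Bx; rewrite addrAC subrr add0r nmZ cmod_rtoc ger0_norm//.
  rewrite mulrAC ltr_pdivrMr// nmC; apply: le_lt_trans wq.
  by rewrite ler_piMl ?nm_ge0// ltW.
have t01 : 0 <= t <= 1 by rewrite t0 ltW.
have := cD _ _ _ t01 Dx Dw.
congr D; apply/rowP => j; rewrite !mxE rtocM rtocV.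
have : rtoc (1 - t) != 0 :> C by rewrite rtoc_eq0 gt_eqF.
by rewrite rtocB rtoc1 => tE; field.
Qed.

(** The real inner product of $\mathbb C^n=\mathbb R^{2n}$. Separation rests on a nearest-point
    argument, for which the maximum norm [nm] offers no orthogonality. *)
Definition rip z v : R :=
  \sum_j (complex.Re (z ord0 j) * complex.Re (v ord0 j) +
          complex.Im (z ord0 j) * complex.Im (v ord0 j)).

Lemma ripD z z' v : rip (z + z') v = rip z v + rip z' v.
Proof.
by rewrite -big_split; apply: eq_bigr => j _; rewrite !mxE cReD cImD /=; ring.
Qed.
Lemma ripC z v : rip z v = rip v z.
Proof. by apply: eq_bigr => j _; rewrite !(mulrC (complex.Re (z _ _)), mulrC (complex.Im (z _ _))). Qed.
Lemma ripZ (s : R) z v : rip (rtoc s *: z) v = s * rip z v.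
Proof.
by rewrite mulr_sumr; apply: eq_bigr => j _; rewrite !mxE Re_rtocM Im_rtocM; ring.
Qed.

Lemma rip_sqrD (u v : Cn) (s : R) : rip (u + rtoc s *: v) (u + rtoc s *: v) =
  rip u u + 2 * s * rip v u + s * (s * rip v v).
Proof. by rewrite ripD ripZ (ripC u) (ripC v) !ripD !ripZ (ripC u v); ring. Qed.

Lemma rip_lin z v : rip z v = complex.Re (lin (fun j => ((v ord0 j)^*)%C) z).
Proof.
rewrite /rip /lin (big_morph _ (@cReD R) (erefl _)); apply: eq_bigr => j _.
by rewrite cReM; case: (v ord0 j) => a b /=; ring.
Qed.

Lemma rip_sqr_ge v j : cmod (v ord0 j) ^+ 2 <= rip v v.
Proof.
have E i : complex.Re (v ord0 i) * complex.Re (v ord0 i) +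
    complex.Im (v ord0 i) * complex.Im (v ord0 i) = cmod (v ord0 i) ^+ 2.
  by rewrite cmod_sqr !expr2.
rewrite /rip (bigD1 j)//= E lerDl sumr_ge0// => i _.
by rewrite E sqr_ge0.
Qed.

Lemma rip_sqr_le v (M : R) : nm v <= M -> rip v v <= n%:R * M ^+ 2.
Proof.
move=> vM; have M0 : 0 <= M := le_trans (nm_ge0 v) vM.
rewrite -[X in _ <= X%:R * _](card_ord n) mulr_natl -sumr_const.
apply: ler_sum => j _.
have -> : complex.Re (v ord0 j) * complex.Re (v ord0 j) +
    complex.Im (v ord0 j) * complex.Im (v ord0 j) = cmod (v ord0 j) ^+ 2.
  by rewrite cmod_sqr !expr2.
by rewrite ler_sqr ?nnegrE ?cmod_ge0//; apply: le_trans (coord_le_nm _ _) vM.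
Qed.

(** A nearly nearest point [p] to [q] stands in for a nearest one, as the infimum may not be
    attained in [D]. Moving from [p] towards [z] cannot bring the squared distance to [q] below its
    infimum [d], which bounds the first-order term from below. *)
Lemma separation D q (M e : R) : rconvex D -> D !=set0 -> (forall z, D z -> nm z <= M) ->
  0 < e -> (forall z, D z -> e <= nm (z - q)) ->
  exists a, forall z, D z -> 0 < complex.Re (lin a (z - q)).
Proof.
move=> cD [z0 Dz0] DM e0 De.
have H1 z : D z -> e ^+ 2 <= rip (z - q) (z - q).
  move=> Dz; rewrite leNgt; apply/negP => H.
  have {}De := De _ Dz.
  have : nm (z - q) < e.
    have [c c0 cE] : exists2 c : R, 0 <= c < e & rip (z - q) (z - q) <= c ^+ 2.
      exists (Num.sqrt (rip (z - q) (z - q))); last first.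
        by rewrite sqr_sqrtr// /rip sumr_ge0// => j _; rewrite addr_ge0// -expr2 sqr_ge0.
      rewrite sqrtr_ge0 /= -(@ltr_pXn2r _ 2)// ?nnegrE ?sqrtr_ge0 ?ltW//.
      by rewrite sqr_sqrtr// /rip sumr_ge0// => j _; rewrite addr_ge0// -expr2 sqr_ge0.
    move: c0 => /andP[c0 ce]; apply: le_lt_trans ce; apply: nm_le => // j.
    rewrite -(@ler_pXn2r _ 2)// ?nnegrE ?cmod_ge0//.
    exact: le_trans (rip_sqr_ge _ _) cE.
  by lra.
pose A := [set rip (z - q) (z - q) | z in D].
have hA : has_inf A.
  split; first by exists (rip (z0 - q) (z0 - q)); exists z0.
  by exists (e ^+ 2) => _ [z Dz <-]; exact: H1.
set d := inf A.
have d0 : 0 < d.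
  apply: lt_le_trans (exprn_gt0 2 e0) _; apply: lb_le_inf; first exact: hA.1.
  by move=> _ [z Dz <-]; exact: H1.
pose B := n%:R * (2 * M) ^+ 2 + 1.
have M0 : 0 <= M := le_trans (nm_ge0 _) (DM _ Dz0).
have B1 : 1 <= B by rewrite /B lerDr mulr_ge0// sqr_ge0.
have B0 : 0 < B by lra.
(* The step [s] makes the second-order term at most $sd/2$. The defect of [p] is allowed to be $sd$;
   both are outweighed by $2s\,|p-q|^2\ge 2sd$. *)
pose s := Num.min 1 (d / (2 * B)).
have s0 : 0 < s by rewrite lt_min ltr01 divr_gt0// mulr_gt0.
have s1 : s <= 1 by rewrite ge_min lexx.
have sB : s * B <= d / 2.
  apply: (@le_trans _ _ (d / (2 * B) * B)); first by rewrite ler_pM2r// ge_min lexx orbT.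
  by rewrite invfM mulrA divfK ?gt_eqF.
have sd : 0 < s * d by rewrite mulr_gt0.
have [_ [p Dp <-] pd] := inf_adherent sd hA; rewrite -/d in pd.
exists (fun j => (((p - q) ord0 j)^*)%C) => z Dz.
rewrite -rip_lin.
have s01 : 0 <= s <= 1 by rewrite s1 ltW.
have Dw := cD _ _ _ s01 Dp Dz.
have dw : d <= rip ((p - q) + rtoc s *: (z - p)) ((p - q) + rtoc s *: (z - p)).
  apply: ge_inf; first exact: hA.2.
  exists (rtoc (1 - s) *: p + rtoc s *: z) => //.
  have -> // : rtoc (1 - s) *: p + rtoc s *: z - q = p - q + rtoc s *: (z - p).
  by apply/rowP => j; rewrite !mxE rtocB rtoc1; ring.
have zp : rip (z - p) (z - p) <= B.
  have : nm (z - p) <= 2 * M.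
    apply: le_trans (nmD _ _) _; rewrite nmN; have := DM _ Dz; have := DM _ Dp; lra.
  by move=> /rip_sqr_le; rewrite /B; lra.
have Ezq : rip (z - q) (p - q) = rip (z - p) (p - q) + rip (p - q) (p - q).
  by rewrite -ripD addrA subrK.
rewrite rip_sqrD in dw.
have dp : d <= rip (p - q) (p - q) by apply: ge_inf; [exact: hA.2|exists p].
rewrite Ezq.
set I := rip (z - p) (p - q) in dw *; set P := rip (p - q) (p - q) in dw dp pd *.
have K : 0 < s * (2 * (I + P)).
  have : s * rip (z - p) (z - p) <= d / 2 by apply: le_trans sB; rewrite ler_pM2l.
  move=> K1; have : s * (s * rip (z - p) (z - p)) <= s * (d / 2) by rewrite ler_pM2l.
  have : s * d <= s * P by rewrite ler_pM2l.
  move: dw pd; lra.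
by move: K; rewrite pmulr_rgt0// pmulr_rgt0.
Qed.

(** With the functional normalised at [x], the Cayley transform sends [x] to 0. The rotation [c]
    turns the difference of real parts into the modulus of the image of [y]. *)
Lemma kob_lower D a b x y : (forall w, D w -> 0 < complex.Re (lin a w + b)) ->
  D y -> lin a x + b = 1 ->
  ((cmod (lin a y + b - 1) / cmod (lin a y + b + 1) / 16)%:E <= kobayashi_dist D x y)%E.
Proof.
move=> HD Dy Hx; set w := lin a y + b.
have [_ w1] := Re_pos_cmod (HD _ Dy); rewrite -/w in w1.
pose H : C := (w - 1) / (w + 1).
pose c : C := if H == 0 then 1 else rtoc (cmod H) / H.
have [c1 cH] : cmod c = 1 /\ c * H = rtoc (cmod H).
  rewrite /c; case: eqP => [->|/eqP H0]; first by rewrite mulr0 cmod0 cmod1.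
  rewrite divfK// cmodM cmodV cmod_rtoc ger0_norm ?cmod_ge0// divff//.
  by rewrite cmod_eq0.
have := @dist_ge R n D a b c x y HD c1; congr (_%:E <= _)%E.
rewrite !addrA Hx -/w -cReB.
have -> : c * 2 / (1 + 1) - c * 2 / (w + 1) = c * H.
  by rewrite /H; field; rewrite w1 ?pnatr_eq0.
by rewrite cH /= /H cmodM cmodV.
Qed.

(** If $x+\zeta(y-x)$ were at positive distance from [D], the separating functional, normalised to 1
    at [x], would change by at least $1/|\zeta|>1/d$ between [x] and [y], and [kob_lower] would make
    their distance too large. So these points lie in the closure, and passing through a slightly
    larger $\zeta$ puts them in [D]. *)
Lemma disc_of_dist D x y (d M : R) : open D -> rconvex D -> (forall z, D z -> nm z <= M) ->
  0 < d -> D x -> D y -> (kobayashi_dist D x y < (16 * (1 + 2 * d))^-1%:E)%E ->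
  forall zeta : C, cmod zeta < d -> D (x + zeta *: (y - x)).
Proof.
move=> oD cD DM d0 Dx Dy kd.
have Hcl (zeta : C) : cmod zeta < d -> forall e, 0 < e ->
    exists2 w, D w & nm (w - (x + zeta *: (y - x))) < e.
  move=> zd e e0; apply: contrapT => N.
  set q := x + zeta *: (y - x) in N.
  have De z : D z -> e <= nm (z - q).
    by move=> Dz; rewrite leNgt; apply/negP => ze; apply: N; exists z.
  have [a Ha] := separation cD (ex_intro _ x Dx) DM e0 De.
  have Hx := Ha _ Dx; set l := complex.Re (lin a (x - q)) in Hx.
  pose a' j := rtoc l^-1 * a j.
  have a'E z : lin a' z = rtoc l^-1 * lin a z.
    by rewrite /lin mulr_sumr; apply: eq_bigr => j _; rewrite mulrA.
  pose b' := 1 - lin a' x.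
  have Re' z : complex.Re (lin a' z + b') = complex.Re (lin a (z - q)) / l.
    rewrite /b' addrCA -linB a'E cReD Re_rtocM.
    have -> : lin a (z - x) = lin a (z - q) - lin a (x - q) by rewrite -linB opprB addrA subrK.
    by rewrite cReB -/l /=; field; rewrite gt_eqF.
  have H1 w : D w -> 0 < complex.Re (lin a' w + b').
    by move=> Dw; rewrite Re' divr_gt0// Ha.
  have H2 : lin a' x + b' = 1 by rewrite /b' addrC subrK.
  have := kob_lower H1 Dy H2 => /le_lt_trans/(_ kd).
  have E : lin a' y + b' - 1 = rtoc l^-1 * lin a (y - x).
    by rewrite -a'E linB /b'; ring.
  have zE : zeta * lin a (y - x) = - lin a (x - q).
    by rewrite /q opprD addrA subrr add0r linN opprK linZ.
  set s := cmod (lin a' y + b' - 1).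
  have zs : 1 <= cmod zeta * s.
    rewrite /s E cmodM mulrCA -cmodM zE cmodN cmod_rtoc gtr0_norm ?invr_gt0//.
    rewrite mulrC ler_pdivlMr// mul1r; apply: le_trans (Re_le_cmod _).
    exact: ler_norm.
  have s0 : 0 <= s by exact: cmod_ge0.
  have ds : 1 < d * s.
    apply: (le_lt_trans zs); rewrite ltr_pM2r// lt_def s0 andbT.
    by apply/eqP => s00; move: zs; rewrite s00 mulr0 ler10.
  have sp : cmod (lin a' y + b' + 1) <= s + 2.
    have -> : lin a' y + b' + 1 = (lin a' y + b' - 1) + 2 by ring.
    apply: le_trans (cmodD _ _) _; rewrite lerD2l.
    by rewrite (_ : 2 = rtoc 2) ?cmod_rtoc ?ger0_norm// /rtoc rmorph_nat.
  have [_ wp] := Re_pos_cmod (H1 _ Dy); rewrite -cmod_gt0 in wp.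
  (* $u\mapsto u/(u+2)$ increases and $s>1/d$: this is where the threshold $1/(16(1+2d))$ comes
     from. *)
  rewrite lte_fin ltr_pdivrMr// ltr_pdivrMr//; apply/negP; rewrite -leNgt.
  have -> : (16 * (1 + 2 * d))^-1 * 16 * cmod (lin a' y + b' + 1) =
      cmod (lin a' y + b' + 1) / (1 + 2 * d).
    by field; rewrite gt_eqF//; lra.
  rewrite ler_pdivrMr; last by lra.
  by apply: le_trans sp _; nra.
move=> zeta zd; have [r r0 Br] := open_inball oD Dx.
have [->|z0] := eqVneq zeta 0; first by rewrite scale0r addr0.
have cz : 0 < cmod zeta by rewrite cmod_gt0.
(* The point is the combination, with weight [t], of [x] and the closure point with parameter
   $\zeta/t$, whose modulus is halfway between $|\zeta|$ and [d]. *)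
pose t := cmod zeta / ((cmod zeta + d) / 2).
have t0 : 0 <= t by apply: divr_ge0; lra.
have t1 : t < 1 by rewrite ltr_pdivrMr ?mul1r; lra.
pose z' := rtoc (t^-1) * zeta.
have tp : 0 < t by apply: divr_gt0; lra.
have z'd : cmod z' < d.
  rewrite cmodM cmod_rtoc gtr0_norm ?invr_gt0// /t invf_div divfK ?gt_eqF//; lra.
have t01 : 0 <= t < 1 by rewrite t0.
have := segment_interior cD r0 Br t01 (Hcl _ z'd).
rewrite scalerDr addrA -scalerDl -rtocD subrK rtoc1 scale1r scalerA /z' mulrA -rtocM.
by rewrite divff ?gt_eqF// rtoc1 mul1r.
Qed.

End convex.

(** * Upper bound for the Kobayashi distance *)

Section upper.
Context (R : realType) (n : nat).
Local Notation C := (cplx R).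
Local Notation Cn := 'rV[C]_n.
Implicit Types (D : set Cn) (x y z o v w : Cn).

Lemma affine_derive z v (w : C) :
  derivable (fun u : C => z + u *: v) w 1 /\ derive1 (fun u : C => z + u *: v) w = v.
Proof.
have Q : (fun t : C => t^-1 *: (((fun u : C => z + u *: v) \o shift w) (t *: 1) - (z + w *: v)))
    @ 0^' --> v.
  apply: (@cvg_trans _ ((fun=> v) @ (0 : C)^')); last exact: cvg_cst.
  apply: near_eq_cvg; near=> t.
  have t0 : t != 0 by near: t; exact: nbhs_dnbhs_neq.
  rewrite /= [t *: 1]mulr1 opprD addrACA subrr add0r scalerDl addrK scalerA.
  by rewrite mulVf// scale1r.
split; first by apply/cvg_ex; exists v.
by rewrite derive1E; apply: cvg_lim Q.
Unshelve. all: by end_near. Qed.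

Lemma royden_le D z (X : Cn) (s : R) : 0 < s -> inball D z s ->
  (kobayashi_royden D z X <= (nm X / s)%:E)%E.
Proof.
(* If [X = 0], the quotient by [nm X] is 0 by convention and the affine disc is constant. *)
move=> s0 Bz; pose V := rtoc (s / nm X) *: X.
have nmV : nm V <= s.
  rewrite nmZ cmod_rtoc ger0_norm; last by rewrite divr_ge0 ?nm_ge0// ltW.
  have [->|X0] := eqVneq (nm X) 0; first by rewrite mulr0 ltW.
  by rewrite divfK.
apply: ereal_inf_lbound; exists (rtoc (nm X / s)); last first.
  by rewrite cmod_rtoc ger0_norm// divr_ge0 ?nm_ge0// ltW.
exists (fun u : C => z + u *: V); split.
- by move=> w _; have [] := affine_derive z V w.
- move=> w; rewrite /disc /= => w1; apply: Bz; rewrite addrAC subrr add0r nmZ.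
  have [->|V0] := eqVneq (nm V) 0; first by rewrite mulr0.
  by apply: lt_le_trans nmV; rewrite gtr_pMl// lt_def V0 nm_ge0.
- by rewrite scale0r addr0.
- have [_ ->] := affine_derive z V 0; rewrite scalerA -rtocM.
  have [X0|X0] := eqVneq (nm X) 0.
    by move/eqP: X0; rewrite nm_eq0 => /eqP ->; rewrite scaler0.
  by rewrite mulrA divfK ?gt_eqF// divff// rtoc1 scale1r.
Qed.

Lemma quad_derive (a b c t : R) :
  is_derive t 1 (fun t : R => a + b * t + c * t ^+ 2) (b + 2 * c * t).
Proof.
pose f (t : R) : R := a + b * t + c * t ^+ 2.
have Q : (fun s : R => s^-1 *: ((f \o shift t) (s *: 1) - f t)) @ 0^' -->
    (b + 2 * c * t : R^o).
  apply: (@cvg_trans _ ((fun s : R => b + c * (2 * t + s)) @ (0 : R)^')).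
    apply: near_eq_cvg; near=> s.
    have s0 : s != 0 by near: s; exact: nbhs_dnbhs_neq.
    by rewrite /= [s *: 1]mulr1 /f /GRing.scale /=; field.
  have -> : b + 2 * c * t = b + c * (2 * t + 0) by ring.
  apply: (@cvgD R R^o); first exact: cvg_cst.
  apply: (@cvgM R); first exact: cvg_cst.
  apply: (@cvgD R R^o); first exact: cvg_cst.
  exact: nbhs_dnbhs.
apply: DeriveDef; first by apply/cvg_ex; eexists; exact: Q.
by apply: cvg_lim Q.
Unshelve. all: by end_near. Qed.

Definition quad x v w (t : R) : Cn := x + rtoc t *: v + rtoc (t ^+ 2) *: w.

Lemma quad_coord x v w (t : R) j :
  re_coord (quad x v w) j t =
    complex.Re (x ord0 j) + complex.Re (v ord0 j) * t + complex.Re (w ord0 j) * t ^+ 2 /\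
  im_coord (quad x v w) j t =
    complex.Im (x ord0 j) + complex.Im (v ord0 j) * t + complex.Im (w ord0 j) * t ^+ 2.
Proof.
rewrite /re_coord /im_coord /quad !mxE !cReD !cImD !Re_rtocM !Im_rtocM.
by rewrite ![t * _]mulrC ![_ ^+ 2 * _]mulrC.
Qed.

Lemma quad_C1 x v w : C1_curve (quad x v w) /\
  forall t, curve_derive (quad x v w) t = v + rtoc (2 * t) *: w.
Proof.
have E1 j : re_coord (quad x v w) j = (fun t => complex.Re (x ord0 j) +
    complex.Re (v ord0 j) * t + complex.Re (w ord0 j) * t ^+ 2).
  by apply/funext => t; have [] := quad_coord x v w t j.
have E2 j : im_coord (quad x v w) j = (fun t => complex.Im (x ord0 j) +
    complex.Im (v ord0 j) * t + complex.Im (w ord0 j) * t ^+ 2).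
  by apply/funext => t; have [] := quad_coord x v w t j.
have cd t : curve_derive (quad x v w) t = v + rtoc (2 * t) *: w.
  apply/rowP => j; rewrite !mxE E1 E2 !derive1E.
  have [_ ->] := quad_derive (complex.Re (x ord0 j)) (complex.Re (v ord0 j))
    (complex.Re (w ord0 j)) t.
  have [_ ->] := quad_derive (complex.Im (x ord0 j)) (complex.Im (v ord0 j))
    (complex.Im (w ord0 j)) t.
  apply/eqP; rewrite eq_complex cReD cImD Re_rtocM Im_rtocM /=.
  by apply/andP; split; apply/eqP; ring.
split=> //; split.
  move=> t j; rewrite E1 E2; split.
    by have [] := quad_derive (complex.Re (x ord0 j)) (complex.Re (v ord0 j))
      (complex.Re (w ord0 j)) t.
  by have [] := quad_derive (complex.Im (x ord0 j)) (complex.Im (v ord0 j))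
    (complex.Im (w ord0 j)) t.
move=> t; apply/cvg_nm => e e0.
have K0 : 0 < 2 * (1 + nm w) by rewrite mulr_gt0// ltr_wpDr ?nm_ge0.
have e1 : 0 < e / (2 * (1 + nm w)) by rewrite divr_gt0.
near=> s; rewrite !cd opprD addrACA subrr add0r -scalerBl -rtocB -mulrBr nmZ cmod_rtoc.
have : `|s - t| < e / (2 * (1 + nm w)).
  by rewrite distrC; near: s; exact: (@cvgr_dist_lt _ _ _ (nbhs t) _ id t).
rewrite ltr_pdivlMr// => H; apply: le_lt_trans H.
rewrite normrM ger0_norm// mulrCA mulrA ler_wpM2l ?mulr_ge0//.
by rewrite lerDr.
Unshelve. all: by end_near. Qed.

Lemma rtoc2 : rtoc 2 = 2 :> C.
Proof. by rewrite /rtoc rmorph_nat. Qed.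

Lemma bezier x o y (t : R) :
  rtoc (1 - t) *: (rtoc (1 - t) *: x + rtoc t *: o) +
  rtoc t *: (rtoc (1 - t) *: o + rtoc t *: y) =
  quad x (rtoc 2 *: (o - x)) (x - rtoc 2 *: o + y) t.
Proof.
rewrite /quad (rtocB 1 t) rtoc1 rtoc2 expr2 rtocM; move: (rtoc t) => T.
by apply/rowP => j; rewrite !mxE; ring.
Qed.

Lemma bezier_derive x o y (t : R) :
  rtoc 2 *: (o - x) + rtoc (2 * t) *: (x - rtoc 2 *: o + y) =
  rtoc (2 * (1 - t)) *: (o - x) + rtoc (2 * t) *: (y - o).
Proof.
rewrite (rtocM 2 t) (rtocM 2 (1 - t)) (rtocB 1 t) rtoc1 rtoc2; move: (rtoc t) => T.
by apply/rowP => j; rewrite !mxE; ring.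
Qed.

Lemma conv_gt0 (a b t : R) : 0 <= t <= 1 -> 0 < a -> 0 < b -> 0 < (1 - t) * a + t * b.
Proof. by move=> t01 a0 b0; nra. Qed.

(** On the first half of the curve $(1-t)^2\ge 1/4$ and $2t(1-t)\ge t$; the second half is the same
    with the endpoints exchanged. *)
Lemma bezier_radius (s r s' t : R) : 0 <= t <= 1/2 -> 0 < s -> 0 < r -> 0 < s' ->
  t * r + s / 4 <= (1 - t) * ((1 - t) * s + t * r) + t * ((1 - t) * r + t * s').
Proof.
move=> t01 s0 r0 s'0.
have q1 : 0 <= ((1 - t) * (1 - t) - 1/4) * s by apply: mulr_ge0; [nra|exact: ltW].
have q2 : 0 <= (2 * t * (1 - t) - t) * r by apply: mulr_ge0; [nra|exact: ltW].
have q3 : 0 <= t * t * s' by apply: mulr_ge0; [nra|exact: ltW].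
lra.
Qed.

(* The competitor is the quadratic Bezier curve from [x] to [y] with control point [o]. *)
Lemma dist_le D x y o (r s s' M : R) : rconvex D -> (forall z, D z -> nm z <= M) ->
  0 < M -> 0 < s <= r -> 0 < s' <= r -> inball D o r -> inball D x s -> inball D y s' ->
  (kobayashi_dist D x y <= (4 * M / r * (ln (8 * r / s) + ln (8 * r / s')))%:E)%E.
Proof.
move=> cD DM M0 /andP[s0 sr] /andP[s'0 s'r] Bo Bx By.
have r0 : 0 < r := lt_le_trans s0 sr.
pose v := rtoc 2 *: (o - x); pose w := x - rtoc 2 *: o + y.
pose g := quad x v w.
have [gC gd] := quad_C1 x v w.
pose rho (t : R) := (1 - t) * ((1 - t) * s + t * r) + t * ((1 - t) * r + t * s').
have gB t : 0 <= t <= 1 -> inball D (g t) (rho t).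
  move=> t01.
  have p1 : 0 < (1 - t) * s + t * r by exact: conv_gt0.
  have p2 : 0 < (1 - t) * r + t * s' by exact: conv_gt0.
  have := inball_conv cD p1 p2 t01 (inball_conv cD s0 r0 t01 Bx Bo)
    (inball_conv cD r0 s'0 t01 Bo By).
  by rewrite bezier.
have gpos t : 0 <= t <= 1 -> 0 < rho t by move=> t01; rewrite !conv_gt0.
(* [4 * M] bounds the speed, and the two inverses bound the inverse radius on the two halves. Their
   sum is used on the whole interval because it has an explicit antiderivative. *)
pose F (t : R) := 4 * M * ((t * r + s / 4)^-1 + ((1 - t) * r + s' / 4)^-1).
have Fpos1 t : 0 <= t <= 1 -> 0 < t * r + s / 4 by move=> t01; nra.
have Fpos2 t : 0 <= t <= 1 -> 0 < (1 - t) * r + s' / 4 by move=> t01; nra.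
have kF t : 0 <= t <= 1 -> (kobayashi_royden D (g t) (curve_derive g t) <= (F t)%:E)%E.
  move=> t01; apply: le_trans (royden_le _ (gpos _ t01) (gB _ t01)) _.
  have Dx := inball_center s0 Bx; have Do := inball_center r0 Bo.
  have Dy := inball_center s'0 By.
  have nd : nm (curve_derive g t) <= 4 * M.
    have -> : curve_derive g t = rtoc (2 * (1 - t)) *: (o - x) + rtoc (2 * t) *: (y - o).
      by rewrite gd /v /w bezier_derive.
    apply: le_trans (nmD _ _) _; rewrite !nmZ !cmod_rtoc !ger0_norm; try lra.
    have : nm (o - x) <= 2 * M.
      by apply: le_trans (nmD _ _) _; rewrite nmN; have := DM _ Do; have := DM _ Dx; lra.
    have : nm (y - o) <= 2 * M.
      by apply: le_trans (nmD _ _) _; rewrite nmN; have := DM _ Do; have := DM _ Dy; lra.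
    nra.
  have f1 := Fpos1 _ t01; have f2 := Fpos2 _ t01.
  have i1 : 0 < (t * r + s / 4)^-1 by rewrite invr_gt0.
  have i2 : 0 < ((1 - t) * r + s' / 4)^-1 by rewrite invr_gt0.
  rewrite lee_fin /F; apply: ler_pM => //; first exact: nm_ge0.
    by rewrite invr_ge0 ltW// gpos.
  have [th|th] := leP t (1/2).
    apply: (@le_trans _ _ (t * r + s / 4)^-1); last by rewrite lerDl ltW.
    by rewrite lef_pV2 ?posrE ?gpos//; apply: bezier_radius => //; lra.
  apply: (@le_trans _ _ ((1 - t) * r + s' / 4)^-1); last by rewrite lerDr ltW.
  rewrite lef_pV2 ?posrE ?gpos//.
  have -> : rho t = (1 - (1 - t)) * ((1 - (1 - t)) * s' + (1 - t) * r) +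
      (1 - t) * ((1 - (1 - t)) * r + (1 - t) * s) by rewrite /rho; ring.
  by apply: bezier_radius => //; lra.
pose f (t : R) := 4 * M / r * (ln (t * r + s / 4) - ln ((1 - t) * r + s' / 4)).
have df (t : R) : 0 <= t <= 1 -> is_derive t 1 f (F t).
  move=> t01; have f1 := Fpos1 _ t01; have f2 := Fpos2 _ t01.
  have d1 : is_derive t 1 (fun t : R => t * r + s / 4) r.
    have := quad_derive (s / 4) r 0 t; rewrite mulr0 mul0r addr0.
    by congr is_derive; apply/funext => u; rewrite mul0r addr0 addrC mulrC.
  have d2 : is_derive t 1 (fun t : R => (1 - t) * r + s' / 4) (- r).
    have := quad_derive (r + s' / 4) (- r) 0 t; rewrite mulr0 mul0r addr0.
    by congr is_derive; apply/funext => u; rewrite mul0r addr0; ring.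
  have e1 := is_derive1_ln f1; have e2 := is_derive1_ln f2.
  have c1 := @is_derive1_comp R (@ln R) (fun t : R => t * r + s / 4) t _ _ e1 d1.
  have c2 := @is_derive1_comp R (@ln R) (fun t : R => (1 - t) * r + s' / 4) t _ _ e2 d2.
  have c3 := is_deriveZ (4 * M / r) (is_deriveB c1 c2).
  apply: is_derive_eq c3 _.
  rewrite /F /GRing.scale /=; field.
  by rewrite !gt_eqF//; lra.
have cF : cont_on F 0 1.
  move=> t t01; have f1 := Fpos1 _ t01; have f2 := Fpos2 _ t01.
  apply: (@cvgM R); first exact: cvg_cst.
  apply: (@cvgD R R^o); apply: (@cvgV R); rewrite ?gt_eqF//.
    apply: (@cvgD R R^o); last exact: cvg_cst.
    by apply: (@cvgM R); [exact: cvg_id|exact: cvg_cst].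
  apply: (@cvgD R R^o); last exact: cvg_cst.
  apply: (@cvgM R); last exact: cvg_cst.
  by apply: (@cvgB R R^o); [exact: cvg_cst|exact: cvg_id].
have FT : (\int[@lebesgue_measure R]_(t in `[0%R, 1%R]) (F t)%:E = (f 1)%:E - (f 0)%:E)%E.
  have cf (t : R) : 0 <= t <= 1 -> {for t, continuous f}.
    move=> /df dt; apply: differentiable_continuous.
    by apply/derivable1_diffP; exact: ex_derive.
  apply: continuous_FTC2 => //; first exact: cont_onW.
    split.
    - move=> t; rewrite in_itv /= => /andP[t1 t2].
      by apply: (@ex_derive _ _ _ _ _ _ _ (df t _)); rewrite !ltW.
    - by apply: cvg_at_right_filter; apply: cf; rewrite lexx ler01.
    - by apply: cvg_at_left_filter; apply: cf; rewrite lexx ler01.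
  move=> t; rewrite in_itv /= => /andP[t1 t2].
  by rewrite derive1E; apply: (@derive_val _ _ _ _ _ _ _ (df t _)); rewrite !ltW.
apply: (@le_trans _ _ (\int[@lebesgue_measure R]_(t in `[0%R, 1%R]) (F t)%:E)%E).
  apply: ge_ereal_inf; exists (\int[@lebesgue_measure R]_(t in `[0%R, 1%R])
     kobayashi_royden D (g t) (curve_derive g t))%E.
    exists g => //; split.
    - exists 1%N, (fun i => i%:R); split => // -[|//] _.
      by split => //; exists g.
    - by move=> t t01; apply: inball_center (gpos _ t01) (gB _ t01).
    - by rewrite /g /quad expr0n /= rtoc0 !scale0r !addr0.
    - by rewrite /g -bezier subrr rtoc0 rtoc1 !scale0r !add0r !scale1r.
  apply: ge0_le_integral_nomeas => t /=; first by move=> _; exact: royden_ge0.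
  by rewrite in_itv /=; exact: kF.
rewrite FT -EFinB lee_fin /f subrr subr0 !mul0r !mul1r !add0r -mulrBr.
have K : 0 <= 4 * M / r by rewrite divr_ge0 ?mulr_ge0// ltW.
apply: ler_wpM2l => //.
have lnE u : 0 < u <= r -> ln (8 * r / u) = ln (2 * r) - ln (u / 4).
  move=> /andP[u0 ur]; rewrite -ln_div ?posrE ?divr_gt0 ?mulr_gt0//.
  by congr ln; field; rewrite gt_eqF.
rewrite !lnE ?s0 ?s'0//.
have : ln (r + s / 4) <= ln (2 * r) by rewrite ler_ln ?posrE; lra.
have : ln (r + s' / 4) <= ln (2 * r) by rewrite ler_ln ?posrE; lra.
lra.
Qed.

End upper.

(** * Real directional derivatives and finite differences *)

Section real_calculus.
Context (R : realType) (V : normedModType (cplx R)).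
Local Notation C := (cplx R).
Implicit Types (f g : V -> R) (z v w y : V) (U : set V).

Definition line f z v := fun h : R => f (z + rtoc h *: v).

Lemma line_shift f z v (t : R) : line f (z + rtoc t *: v) v = (fun h => line f z v (h + t)).
Proof. by apply/funext => h; rewrite /line -addrA -scalerDl -rtocD (addrC t). Qed.

Lemma line_derive f z v (t : R) : real_derivable f (z + rtoc t *: v) v ->
  is_derive t 1 (line f z v) (real_derive v f (z + rtoc t *: v)).
Proof.
rewrite /real_derivable /real_derive -/(line _ _ _) line_shift derive1E => H.
have E : (fun h : R => h^-1 *: ((line f z v \o shift t) (h *: 1) - line f z v t)) =
   (fun h : R => h^-1 *: (((fun h => line f z v (h + t)) \o shift 0) (h *: 1) -
      line f z v (0 + t))).
  by apply/funext => h /=; rewrite addr0 add0r.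
by apply: DeriveDef; rewrite /derivable /derive E.
Qed.

Lemma real_is_derive f z v : real_derivable f z v ->
  is_derive (0 : R) 1 (line f z v) (real_derive v f z).
Proof.
move=> H; have E : z + rtoc 0 *: v = z by rewrite rtoc0 scale0r addr0.
by have := @line_derive f z v 0; rewrite E; exact.
Qed.

Lemma real_mvt f z v : (forall t : R, 0 <= t <= 1 -> real_derivable f (z + rtoc t *: v) v) ->
  exists2 t : R, 0 <= t <= 1 & f (z + v) - f z = real_derive v f (z + rtoc t *: v).
Proof.
move=> H.
have D (t : R) : 0 <= t <= 1 -> is_derive t 1 (line f z v) (real_derive v f (z + rtoc t *: v)).
  by move=> /H; exact: line_derive.
have Hd (t : R) : t \in `]0, 1[%R -> is_derive t 1 (line f z v) (real_derive v f (z + rtoc t *: v)).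
  by rewrite in_itv /= => /andP[? ?]; apply: D; rewrite !ltW.
have Hc : {within `[0, 1], continuous (line f z v)}.
  apply: derivable_within_continuous => t; rewrite in_itv /= => /D Dt.
  exact: ex_derive.
have [t] := MVT_segment ler01 Hd Hc.
rewrite in_itv /= => t01; rewrite /line rtoc1 rtoc0 scale0r scale1r addr0 subr0 mulr1 => E.
by exists t.
Qed.

Lemma real_derive_scale f z v (a : R) : real_derivable f z v ->
  real_derive (rtoc a *: v) f z = a * real_derive v f z.
Proof.
move=> /real_is_derive H; rewrite {1}/real_derive derive1E.
have E : (fun h : R => f (z + rtoc h *: (rtoc a *: v))) = line f z v \o ( *%R a).
  by apply/funext => h; rewrite /line /= scalerA -rtocM mulrC.
rewrite E.
have d : is_derive (0 : R) 1 ( *%R a) a.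
  have := quad_derive 0 a 0 0; rewrite mulr0 addr0.
  by congr is_derive; apply/funext => h; rewrite mul0r addr0 add0r.
rewrite -{1}(mulr0 a) in H.
have [_ ->] := @is_derive1_comp R (line f z v) ( *%R a) 0 _ _ H d.
by rewrite mulrC.
Qed.

Lemma real_derive_local U f g z v : open U -> U z -> (forall y, U y -> f y = g y) ->
  real_derive v f z = real_derive v g z.
Proof.
move=> oU Uz fg; rewrite /real_derive !derive1E; apply: near_eq_derive.
have /nbhs_nm[e e0 eU] : nbhs z U by exact: open_nbhs_nbhs.
have K0 : 0 < 1 + nm v by rewrite ltr_wpDr ?nm_ge0.
have e1 : 0 < e / (1 + nm v) by rewrite divr_gt0.
near=> h; apply: fg; apply: eU; rewrite addrAC subrr add0r nmZ cmod_rtoc.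
have : `|h| < e / (1 + nm v).
  rewrite -[h]subr0 distrC; near: h.
  exact: (@cvgr_dist_lt _ _ _ (nbhs (0 : R)) _ id (0 : R)).
rewrite ltr_pdivlMr// => H; apply: le_lt_trans H.
by rewrite ler_wpM2l// lerDr.
Unshelve. all: by end_near. Qed.

Lemma smooth_cont U f z : smooth_on U f -> U z -> {for z, continuous f}.
Proof. by move=> sf Uz; have [] := sf [::] z Uz. Qed.

Lemma smooth_derivable U f z v : smooth_on U f -> U z -> real_derivable f z v.
Proof. by move=> sf Uz; have [_] := sf [::] z Uz. Qed.

Lemma iter_real_derive_rcons vs v f :
  iter_real_derive (rcons vs v) f = iter_real_derive vs (real_derive v f).
Proof. by rewrite /iter_real_derive foldr_rcons. Qed.

Lemma smooth_real_derive U f v : smooth_on U f -> smooth_on U (real_derive v f).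
Proof. by move=> sf vs z Uz; rewrite -iter_real_derive_rcons; exact: sf. Qed.

(** Smoothness only provides derivatives along single lines. The increment is split at $z+hv$; the
    second part is, by the mean value theorem, a derivative along [w] at an intermediate point, and
    converges by continuity of that derivative. *)
Lemma real_deriveD U f z v w : open U -> smooth_on U f -> U z ->
  real_derive (v + w) f z = real_derive v f z + real_derive w f z.
Proof.
move=> oU sf Uz.
have /nbhs_nm[e e0 eU] : nbhs z U by exact: open_nbhs_nbhs.
have [H1 H2] := real_is_derive (@smooth_derivable U f z v sf Uz).
have cw := smooth_cont (smooth_real_derive w sf) Uz.
have K0 : 0 < 1 + nm v + nm w by rewrite -addrA ltr_wpDr ?addr_ge0 ?nm_ge0.
rewrite {1}/real_derive derive1E; apply: cvg_lim => //.
have C1 : (fun h : R => h^-1 *: ((line f z v \o shift 0) (h *: 1) - line f z v 0)) @ 0^' -->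
    real_derive v f z.
  by rewrite -H2; exact: H1.
have C2 : (fun h : R => h^-1 * (f (z + rtoc h *: v + rtoc h *: w) - f (z + rtoc h *: v)))
    @ 0^' --> real_derive w f z.
  apply/cvgrPdist_lt => eps eps0.
  have /nbhs_nm[r r0 rH] : nbhs z [set y | `|real_derive w f z - real_derive w f y| < eps].
    exact: (@cvgr_dist_lt _ _ _ (nbhs z) _ _ _ cw).
  have m0 : 0 < Num.min e r / (1 + nm v + nm w) by rewrite divr_gt0// lt_min e0.
  near=> h.
  have h0 : h != 0 by near: h; exact: nbhs_dnbhs_neq.
  have hm : `|h| < Num.min e r / (1 + nm v + nm w) by near: h; exact: dnbhs0_lt.
  have small (t : R) : 0 <= t <= 1 ->
      nm (z + rtoc h *: v + rtoc t *: (rtoc h *: w) - z) < Num.min e r.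
    move=> t01; rewrite -(addrA z) (addrC z) addrK.
    apply: le_lt_trans (nmD _ _) _; rewrite !nmZ !cmod_rtoc.
    move: hm; rewrite ltr_pdivlMr// => hm; apply: le_lt_trans hm.
    have t1 : `|t| <= 1 by rewrite ger0_norm; lra.
    have : `|t| * (`|h| * nm w) <= `|h| * nm w by rewrite ler_piMl ?mulr_ge0 ?nm_ge0.
    by have := normr_ge0 h; nra.
  have sU t : 0 <= t <= 1 -> U (z + rtoc h *: v + rtoc t *: (rtoc h *: w)).
    by move=> /small; rewrite lt_min => /andP[? _]; apply: eU.
  have [t t01 ->] := @real_mvt f (z + rtoc h *: v) (rtoc h *: w)
    (fun t t01 => smooth_derivable sf (sU t t01)).
  rewrite real_derive_scale; last exact: (smooth_derivable sf (sU t t01)).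
  rewrite mulrA mulVf// mul1r; apply: rH.
  by have := small t t01; rewrite lt_min => /andP[].
have C1' : (fun h : R => h^-1 * (f (z + rtoc h *: v) - f z)) @ 0^' --> real_derive v f z.
  apply: cvg_trans C1; apply: near_eq_cvg; apply: nearW => h.
  by rewrite /line /= addr0 [h *: 1]mulr1 rtoc0 scale0r addr0.
have C3 := @cvgD R R^o R _ (@dnbhs_filter R 0) _ _ _ _ C1' C2.
apply: cvg_trans C3; apply: near_eq_cvg; apply: nearW => h.
rewrite /= addr0 [h *: 1]mulr1 rtoc0 scale0r addr0 !fctE.
have -> : z + rtoc h *: (v + w) = z + rtoc h *: v + rtoc h *: w by rewrite scalerDr addrA.
by rewrite -mulrDr addrC addrA subrK.
Unshelve. all: by end_near. Qed.

Lemma real_derive_sum (I : Type) (s : seq I) (u : I -> V) U f z : open U -> smooth_on U f -> U z ->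
  real_derive (\sum_(i <- s) u i) f z = \sum_(i <- s) real_derive (u i) f z.
Proof.
move=> oU sf Uz; elim: s => [|i s IH]; last by rewrite !big_cons (real_deriveD _ _ oU sf Uz) IH.
rewrite !big_nil -[X in real_derive X](scale0r (0 : V)) -rtoc0 real_derive_scale ?mul0r//.
exact: smooth_derivable Uz.
Qed.

Lemma iter_real_derive_local U f g vs z : open U -> (forall y, U y -> f y = g y) -> U z ->
  iter_real_derive vs f z = iter_real_derive vs g z.
Proof.
move=> oU fg; elim: vs z => [|v vs IH] z Uz /=; first exact: fg.
exact: (real_derive_local _ oU Uz IH).
Qed.

Lemma iter_real_derive_lin (m : nat) (a : 'I_m -> R) (g : 'I_m -> V -> R) U vs z :
  open U -> (forall i, smooth_on U (g i)) -> U z ->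
  iter_real_derive vs (fun y => \sum_i a i * g i y) z = \sum_i a i * iter_real_derive vs (g i) z.
Proof.
move=> oU sg; elim: vs z => [//|v vs IH] z Uz /=.
rewrite (real_derive_local v oU Uz IH).
have D i : is_derive (0 : R) 1 (a i *: line (iter_real_derive vs (g i)) z v)
    (a i *: real_derive v (iter_real_derive vs (g i)) z).
  apply: is_deriveZ; apply: real_is_derive.
  by have [_] := sg i vs z Uz.
have [_ E] := is_derive_sum D.
have EL : \sum_(i < m) a i *: line (iter_real_derive vs (g i)) z v =
    line (fun y => \sum_i a i * iter_real_derive vs (g i) y) z v.
  by apply/funext => h; rewrite fct_sumE.
by rewrite EL -derive1E in E; exact: E.
Qed.

Definition fdiff w f : V -> R := fun z => f (z + w) - f z.
Definition iter_fdiff (ws : seq V) f : V -> R := foldr fdiff f ws.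
Definition tot (ws : seq V) : R := \sum_(w <- ws) nm w.

Lemma tot_ge0 ws : 0 <= tot ws.
Proof. by rewrite sumr_ge0// => w _; exact: nm_ge0. Qed.

Lemma iter_fdiff_derive U f ws y v : smooth_on U f ->
  (forall x, nm (x - y) <= tot ws -> U x) ->
  real_derivable (iter_fdiff ws f) y v /\
  real_derive v (iter_fdiff ws f) y = iter_fdiff ws (real_derive v f) y.
Proof.
move=> sf; elim: ws y => [|w ws IH] y HU /=.
  split=> //; apply: smooth_derivable sf _; apply: HU.
  by rewrite subrr nm0 tot_ge0.
have [d1 e1] : real_derivable (iter_fdiff ws f) (y + w) v /\
    real_derive v (iter_fdiff ws f) (y + w) = iter_fdiff ws (real_derive v f) (y + w).
  apply: IH => x Hx; apply: HU; rewrite /tot big_cons.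
  apply: le_trans (nm_tri _ (y + w) _) _.
  by rewrite addrC lerD// addrAC subrr add0r.
have HU' x : nm (x - y) <= tot ws -> U x.
  by move=> Hx; apply: HU; apply: le_trans Hx _; rewrite /tot big_cons lerDr nm_ge0.
have [d0 e0] := IH y HU'.
have D1 := real_is_derive d1; have D0 := real_is_derive d0.
have D := is_deriveB D1 D0.
have E : line (iter_fdiff (w :: ws) f) y v =
    line (iter_fdiff ws f) (y + w) v - line (iter_fdiff ws f) y v.
  by apply/funext => h; rewrite /line /= /fdiff !fctE (addrAC y w).
by rewrite -E in D; case: D => D D'; split=> //; rewrite {1}/real_derive derive1E D' e1 e0.
Qed.

(** Increments are replaced by derivatives one at a time, each derivative commuting with the
    remaining differences; the directions come out in reverse order. *)
Lemma iter_fdiff_mvt U f ws z : smooth_on U f ->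
  (forall x, nm (x - z) <= tot ws -> U x) ->
  exists2 xi, nm (xi - z) <= tot ws & iter_fdiff ws f z = iter_real_derive (rev ws) f xi.
Proof.
elim: ws f z => [|w ws IH] f z sf HU.
  by exists z => //; rewrite subrr nm0 tot_ge0.
have H t : 0 <= t <= 1 -> forall x, nm (x - (z + rtoc t *: w)) <= tot ws ->
    nm (x - z) <= tot (w :: ws).
  move=> t01 x Hx; rewrite /tot big_cons.
  apply: le_trans (nm_tri _ (z + rtoc t *: w) _) _.
  rewrite addrC lerD// addrAC subrr add0r nmZ cmod_rtoc ler_piMl ?nm_ge0//.
  by rewrite ger0_norm; lra.
have [t t01 /= E] := @real_mvt (iter_fdiff ws f) z w (fun t t01 =>
  (iter_fdiff_derive w sf (fun x Hx => HU x (H t t01 x Hx))).1).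
have [_ E2] := iter_fdiff_derive w sf (fun x Hx => HU x (H t t01 x Hx)).
have [xi Hxi E3] := IH _ _ (smooth_real_derive w sf) (fun x Hx => HU x (H t t01 x Hx)).
exists xi; first exact: H Hxi.
by rewrite /= /fdiff E E2 E3 rev_cons iter_real_derive_rcons.
Qed.

Lemma iter_fdiff_le f (X z : V) (cs : seq C) (K : R) :
  (forall zeta : C, cmod zeta <= \sum_(c <- cs) cmod c -> `|f (z + zeta *: X)| <= K) ->
  `|iter_fdiff [seq c *: X | c <- cs] f z| <= 2 ^+ size cs * K.
Proof.
elim: cs z => [|c cs IH] z H /=.
  rewrite expr0 mul1r; have := H 0; rewrite scale0r addr0; apply.
  by rewrite big_nil cmod0.
rewrite exprS -mulrA mulr_natl mulr2n; apply: le_trans (ler_normB _ _) _.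
apply: lerD; apply: IH => zeta Hz.
  rewrite -addrA -scalerDl; apply: H; rewrite big_cons.
  by apply: le_trans (cmodD _ _) _; rewrite lerD2l.
by apply: H; rewrite big_cons; apply: le_trans Hz _; rewrite lerDr cmod_ge0.
Qed.

End real_calculus.

Section joint_continuity.
Context (R : realType) (n : nat).
Local Notation C := (cplx R).
Local Notation Cn := 'rV[C]_n.
Implicit Types (f : Cn -> R) (z X : Cn) (U : set Cn) (vs : seq C).

Definition rbasis (k : 'I_(n + n)) : Cn :=
  match fintype.split k with
  | inl j => delta_mx ord0 j
  | inr j => 'i%C *: delta_mx ord0 j
  end.
Definition rcoord (X : Cn) (k : 'I_(n + n)) : R :=
  match fintype.split k with
  | inl j => complex.Re (X ord0 j)
  | inr j => complex.Im (X ord0 j)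
  end.

Lemma rbasis_sum X : X = \sum_k rtoc (rcoord X k) *: rbasis k.
Proof.
rewrite big_split_ord /= -big_split /= {1}(row_sum_delta X); apply: eq_bigr => j _.
have -> : rcoord X (lshift n j) = complex.Re (X ord0 j).
  by rewrite /rcoord (unsplitK (inl j)).
have -> : rcoord X (rshift n j) = complex.Im (X ord0 j).
  by rewrite /rcoord (unsplitK (inr j)).
have -> : rbasis (lshift n j) = delta_mx ord0 j by rewrite /rbasis (unsplitK (inl j)).
have -> : rbasis (rshift n j) = 'i%C *: delta_mx ord0 j by rewrite /rbasis (unsplitK (inr j)).
by rewrite scalerA -scalerDl [rtoc (complex.Im _) * _]mulrC -complex_split.
Qed.

Lemma real_derive_rbasis U f z X : open U -> smooth_on U f -> U z ->
  real_derive X f z = \sum_k rcoord X k * real_derive (rbasis k) f z.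
Proof.
move=> oU sf Uz; rewrite {1}(rbasis_sum X) (real_derive_sum _ _ oU sf Uz).
by apply: eq_bigr => k _; rewrite real_derive_scale//; exact: smooth_derivable Uz.
Qed.

Lemma rcvg_sum (T : Type) (F : set_system T) {FF : Filter F} m (f : 'I_m -> T -> R) (l : 'I_m -> R) :
  (forall i, f i @ F --> l i) -> (fun t => \sum_i f i t) @ F --> \sum_i l i.
Proof.
move=> H; elim: (index_enum _) => [|i s IH].
  by rewrite big_nil; under eq_fun do rewrite big_nil; exact: cvg_cst.
rewrite big_cons; under eq_fun do rewrite big_cons.
exact: (@cvgD R R^o T F FF _ _ _ _ (H i) IH).
Qed.

Lemma rcoord_cvg (c : C) (X0 z0 : Cn) k :
  (fun p : Cn * Cn => rcoord (c *: p.1) k) @ (X0, z0) --> rcoord (c *: X0) k.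
Proof.
have H j : (fun p : Cn * Cn => c * p.1 ord0 j) @ (X0, z0) --> c * X0 ord0 j.
  apply: ccvgM; first exact: ccvg_cst.
  apply: (@cvg_comp _ _ _ fst (fun Y : Cn => Y ord0 j) _ (nbhs X0)); first exact: cvg_fst.
  exact: (@coord_continuous C 1 n ord0 j X0).
rewrite /rcoord; case: (fintype.split k) => j; rewrite mxE.
  under eq_fun do rewrite mxE.
  exact: (cvg_comp _ _ (H j) (@Re_continuous R _)).
under eq_fun do rewrite mxE.
exact: (cvg_comp _ _ (H j) (@Im_continuous R _)).
Qed.

(** [smooth_on] gives continuity in the base point for fixed directions only. Expanding each moving
    direction in the fixed real basis [rbasis] leaves continuous coefficients times derivatives in
    fixed directions. *)
Lemma iter_joint_cont U vs f X0 z0 : open U -> smooth_on U f -> U z0 ->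
  (fun p : Cn * Cn => iter_real_derive [seq v *: p.1 | v <- vs] f p.2) @ (X0, z0) -->
  iter_real_derive [seq v *: X0 | v <- vs] f z0.
Proof.
move=> oU sf Uz0; elim/last_ind: vs f sf => [|vs v IH] f sf.
  apply: (@cvg_comp _ _ _ snd f _ (nbhs z0)); first exact: cvg_snd.
  exact: smooth_cont sf Uz0.
have E X z : U z -> iter_real_derive [seq w *: X | w <- rcons vs v] f z =
    \sum_k rcoord (v *: X) k * iter_real_derive [seq w *: X | w <- vs] (real_derive (rbasis k) f) z.
  move=> Uz; rewrite map_rcons iter_real_derive_rcons.
  pose g y := \sum_k rcoord (v *: X) k * real_derive (rbasis k) f y.
  have fg y : U y -> real_derive (v *: X) f y = g y by exact: real_derive_rbasis.
  transitivity (iter_real_derive [seq w *: X | w <- vs] g z).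
    exact: (@iter_real_derive_local R _ U _ g _ z oU fg Uz).
  exact: (@iter_real_derive_lin R _ _ (rcoord (v *: X)) (fun k => real_derive (rbasis k) f)
    U _ z oU (fun k => smooth_real_derive (rbasis k) sf) Uz).
rewrite E//.
have Q : (fun p : Cn * Cn => \sum_k rcoord (v *: p.1) k *
    iter_real_derive [seq w *: p.1 | w <- vs] (real_derive (rbasis k) f) p.2) @ (X0, z0) -->
    \sum_k rcoord (v *: X0) k * iter_real_derive [seq w *: X0 | w <- vs] (real_derive (rbasis k) f) z0.
  apply: rcvg_sum => k.
  apply: (@cvgM R); first exact: rcoord_cvg.
  by apply: IH; exact: smooth_real_derive.
apply: cvg_trans Q; apply: near_eq_cvg.
have NU : \forall p \near (X0, z0), U p.2.
  have : nbhs z0 U by exact: open_nbhs_nbhs.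
  exact: (@cvg_snd Cn Cn (nbhs X0) (nbhs z0) _).
by apply: filterS NU => p Up; rewrite E.
Qed.

Lemma iter_real_derive_scale U us f z (h : R) : open U -> smooth_on U f -> U z ->
  iter_real_derive [seq rtoc h *: u | u <- us] f z = h ^+ size us * iter_real_derive us f z.
Proof.
move=> oU sf; elim: us z => [|u us IH] z Uz /=; first by rewrite expr0 mul1r.
have [_ D0] := sf us z Uz.
have [_ D1] := sf [seq rtoc h *: u | u <- us] z Uz.
rewrite real_derive_scale; last exact: D1.
rewrite (real_derive_local u oU Uz IH).
have [_ E] := is_deriveZ (h ^+ size us) (real_is_derive (D0 u)).
rewrite exprS -mulrA; congr (_ * _).
by rewrite -derive1E in E; exact: E.
Qed.

Lemma iter_real_derive_line vs f z X (w : C) :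
  iter_real_derive vs (f \o (fun u : C => z + u *: X)) w =
  iter_real_derive [seq v *: X | v <- vs] f (z + w *: X).
Proof.
elim: vs w => [//|v vs IH] w /=.
rewrite /real_derive; congr derive1; apply/funext => h.
by rewrite IH scalerDl addrA scalerA.
Qed.

(** The line $u\mapsto p+uX$ has order 1 at 0, so the quotient of orders is the order of the
    defining function along it, and a finite order means that some derivative is nonzero. *)
Lemma finite_type_line D p X : finite_type D p -> X != 0 ->
  exists U rho vs, local_defining_function D p U rho /\
    iter_real_derive [seq v *: X | v <- vs] rho p <> 0.
Proof.
move=> [U [rho [ldf H]]] X0; exists U, rho.
pose phi (u : C) : Cn := p + u *: X.
have an : analytic_disc_at p phi.
  exists 2; split=> //.
  - by move=> z _; have [] := affine_derive p X z.
  - by rewrite /phi scale0r addr0.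
  - exists 1; first by rewrite /disc /= cmod1 ltr1n.
    rewrite /phi scale1r => /eqP; rewrite -subr_eq0 addrAC subrr add0r => E.
    by rewrite E in X0.
have h1 : hol_vanishing_order (fun w => phi w - p) = 1%E.
  have E : (fun w => phi w - p) = (fun w : C => 0 + w *: X).
    by apply/funext => w; rewrite /phi addrAC subrr.
  apply/eqP; rewrite eq_le; apply/andP; split.
    apply: ereal_inf_lbound; exists 1%N; last by []; rewrite /= E.
    by have [_ ->] := affine_derive 0 X 0; apply/eqP.
  apply: le_ereal_inf_tmp => _ [[|k] /= Hk <-].
    by case: Hk; rewrite /phi scale0r addr0 subrr.
  by rewrite lee_fin ler1n.
have fin : (real_vanishing_order (rho \o phi) < +oo)%E.
  apply: le_lt_trans H; apply: ereal_sup_ubound; exists phi => //.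
  by rewrite h1 inve1 mule1.
have [k [vs [_ Hvs]]] : [set k : nat | exists vs : seq C,
    size vs = k /\ iter_real_derive vs (rho \o phi) 0 <> 0] !=set0.
  apply/set0P/negP => /eqP E; move: fin; rewrite /real_vanishing_order E image_set0.
  by rewrite ereal_inf0 ltxx.
exists vs; split=> //; move: Hvs.
by rewrite iter_real_derive_line scale0r addr0.
Qed.

End joint_continuity.

(** * Discs near points of finite type *)

Section type_estimate.
Context (R : realType) (n : nat).
Local Notation C := (cplx R).
Local Notation Cn := 'rV[C]_n.
Implicit Types (D : set Cn) (p z w X o : Cn).

Lemma inball_conv_point D p o (r t : R) : rconvex D -> D p -> inball D o r -> 0 < t <= 1 ->
  inball D (rtoc (1 - t) *: p + rtoc t *: o) (t * r).
Proof.
move=> cD Dp Bo /andP[t0 t1] y; pose c := rtoc (1 - t) *: p + rtoc t *: o.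
rewrite -/c => Hy.
have Do : D (o + rtoc t^-1 *: (y - c)).
  apply: Bo; rewrite addrAC subrr add0r nmZ cmod_rtoc gtr0_norm ?invr_gt0//.
  by rewrite mulrC ltr_pdivrMr// mulrC.
have t01 : 0 <= t <= 1 by rewrite t1 ltW.
have := cD _ _ _ t01 Dp Do.
rewrite scalerDr scalerA -rtocM divff ?gt_eqF// rtoc1 scale1r addrA.
by rewrite -/c addrC subrK.
Qed.

(* Harnack inequality for the distance to the boundary, which is concave. *)
Lemma inball_harnack D z w (s : R) : rconvex D -> D (z - w) -> inball D (z + w) (2 * s) ->
  inball D z s.
Proof.
move=> cD Dm Bp.
have t01 : 0 < (1/2 : R) <= 1 by apply/andP; split; lra.
have := inball_conv_point cD Dm Bp t01.
have -> : 1/2 * (2 * s) = s by field.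
have -> : 1 - 1/2 = 1/2 :> R by field.
have -> // : rtoc (1/2) *: (z - w) + rtoc (1/2) *: (z + w) = z.
have -> : rtoc (1/2) = 2^-1 :> C by rewrite mul1r rtocV rtoc2.
by apply/rowP => j; rewrite !mxE; field.
Qed.

(* [w] lies between [w + s (z0 - o)] and the centre of a ball contained in the one at [o]. *)
Lemma inball_pushed D z0 o w (r s : R) : rconvex D -> inball D o r -> nm (w - z0) <= r / 2 ->
  0 < s <= 1 -> D (w + rtoc s *: (z0 - o)) -> inball D w (s * r / 4).
Proof.
move=> cD Bo wz /andP[s0 s1] Dw.
have r0 : 0 <= r by have := nm_ge0 (w - z0); lra.
have Bo' : inball D (o + (w - z0)) (r / 2).
  move=> y Hy; apply: Bo; apply: le_lt_trans (nm_tri _ (o + (w - z0)) _) _.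
  by rewrite (addrAC o) subrr add0r; lra.
have s10 : 0 < 1 + s by lra.
pose t := s / (1 + s).
have t0 : 0 < t by rewrite divr_gt0.
have t1 : t <= 1 by rewrite ler_pdivrMr//; lra.
have t01 : 0 < t <= 1 by rewrite t0.
have := inball_conv_point cD Dw Bo' t01.
have -> : rtoc (1 - t) *: (w + rtoc s *: (z0 - o)) + rtoc t *: (o + (w - z0)) = w.
  have T1 : 1 - t = (1 + s)^-1 by rewrite /t; field; rewrite gt_eqF.
  have T2 : t = (1 + s)^-1 * s by rewrite /t mulrC.
  rewrite T1 T2 scalerDr scalerA -rtocM -addrA -scalerDr.
  have -> : z0 - o + (o + (w - z0)) = w by rewrite addrA subrK addrC subrK.
  by rewrite -scalerDl -rtocD -{1}(mulr1 (1 + s)^-1) -mulrDr mulVf ?gt_eqF// rtoc1 scale1r.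
apply: inballW; rewrite /t.
have : s / 2 <= s / (1 + s) by rewrite ler_pM2l// lef_pV2 ?posrE; lra.
by move=> H; have := ler_wpM2r r0 H; lra.
Qed.

(** A derivative of order [k] along the complex line stays away from 0 for nearby points and
    directions, so a [k]-th difference with step of order [d] is at least a multiple of $d^k$. If
    the ball of radius $d^k/K$ did not fit at [z], [rho] would be $O(d^k/K)$ at all evaluation
    points. *)
Lemma type_local D z0 X0 o (r : R) : rconvex D -> 0 < r -> inball D o r -> ~ D z0 ->
  finite_type D z0 -> X0 != 0 ->
  exists (e : R) (k : nat) (K : R), [/\ 0 < e, 0 < K &
    forall z X (d : R), nm (z - z0) < e -> nm (X - X0) < e -> D z -> 0 < d <= 1 ->
      (forall zeta : C, cmod zeta < d -> D (z + zeta *: X)) -> inball D z (d ^+ k / K)].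
Proof.
move=> cD r0 Bo nDz0 ft X0n0.
have [U [rho [vs [[[oU Uz0] srho _ HU] Hvs]]]] := finite_type_line ft X0n0.
set L := iter_real_derive _ _ _ in Hvs.
have L0 : 0 < `|L| by rewrite normr_gt0; apply/eqP.
have J := @iter_joint_cont R n U vs rho X0 z0 oU srho Uz0; rewrite -/L in J.
have [e1 e10 He1] : exists2 e1 : R, 0 < e1 & forall z X, nm (z - z0) < e1 -> nm (X - X0) < e1 ->
    `|L| / 2 < `|iter_real_derive [seq v *: X | v <- vs] rho z|.
  have L2 : 0 < `|L| / 2 by lra.
  move/cvgrPdist_lt : J => /(_ _ L2) [[P Q] /= [/nbhs_nm[a a0 aP] /nbhs_nm[b b0 bQ]] PQ].
  exists (Num.min a b) => [|z X]; first by rewrite lt_min a0.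
  rewrite !lt_min => /andP[_ zb] /andP[Xa _].
  have := PQ (X, z) (conj (aP _ Xa) (bQ _ zb)) => /=.
  set I := iter_real_derive _ _ _ => LI.
  have := ler_normD (L - I) I; rewrite subrK; lra.
(* [N] stands in for an outward normal: it points from an interior ball towards [z0], and by
   convexity motion along it leaves [D] after a time comparable to $\delta$ at most. *)
pose N := z0 - o.
pose Cn' := `|real_derive N rho z0| + 1.
have C0 : 0 < Cn' by rewrite ltr_wpDl.
have [e2 e20 He2] : exists2 e2 : R, 0 < e2 & forall z, nm (z - z0) < e2 ->
    U z /\ `|real_derive N rho z| <= Cn'.
  have cN := smooth_cont (smooth_real_derive N srho) Uz0.
  have /nbhs_nm[a a0 aP] : nbhs z0 [set y | `|real_derive N rho z0 - real_derive N rho y| < 1].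
    exact: (@cvgr_dist_lt _ _ _ (nbhs z0) _ _ _ cN).
  have /nbhs_nm[b b0 bU] : nbhs z0 U by exact: open_nbhs_nbhs.
  exists (Num.min a b) => [|z]; first by rewrite lt_min a0.
  rewrite lt_min => /andP[/aP /= H /bU Uz]; split=> //; rewrite /Cn'.
  have := ler_normB (real_derive N rho z0) (real_derive N rho z0 - real_derive N rho z).
  rewrite opprB addrC subrK.
  by move: H; move: (real_derive N rho z0) (real_derive N rho z) => a' b' H; lra.
(* The segment from [w] to [w + s N] leaves [D], so [|rho w|] is at most the variation of [rho]
   along it. *)
have rho_bound w (s : R) : nm (w - z0) < e2 / 2 -> nm (w - z0) <= r / 2 -> 0 < s <= 1 ->
    s * nm N < e2 / 2 -> D w -> ~ inball D w (s * r / 4) -> `|rho w| <= s * Cn'.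
  move=> we wr s01 sN Dw nB; have /andP[s0 s1] := s01.
  have nD : ~ D (w + rtoc s *: N) by move=> H; apply: nB; exact: inball_pushed wr s01 H.
  have seg (t : R) : 0 <= t <= 1 -> nm (w + rtoc t *: (rtoc s *: N) - z0) < e2.
    move=> t01; rewrite addrAC; apply: le_lt_trans (nmD _ _) _.
    rewrite !nmZ !cmod_rtoc (gtr0_norm s0) ger0_norm; last by lra.
    have : t * (s * nm N) <= s * nm N by case/andP: t01 => t0 t1; rewrite ler_piMl ?mulr_ge0 ?nm_ge0 ?(ltW s0).
    lra.
  have Uw : U w by apply: (He2 _ _).1; lra.
  have U1 : U (w + rtoc s *: N).
    by have /He2[] := seg 1 (ltac:(rewrite ler01 lexx//)); rewrite rtoc1 scale1r.
  have r1 : rho w < 0 by apply/(HU _ Uw).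
  have r2 : 0 <= rho (w + rtoc s *: N) by rewrite leNgt; apply/negP => /(HU _ U1).
  have [t t01 E] := @real_mvt R _ rho w (rtoc s *: N) (fun t t01 =>
    smooth_derivable srho (He2 _ (seg t t01)).1).
  have [Ut bt] := He2 _ (seg t t01).
  rewrite real_derive_scale in E; last exact: smooth_derivable Ut.
  rewrite ltr0_norm//.
  have : real_derive N rho (w + rtoc t *: (rtoc s *: N)) <= Cn' := le_trans (ler_norm _) bt.
  by move=> H; have : s * real_derive N rho (w + rtoc t *: (rtoc s *: N)) <= s * Cn';
    [rewrite ler_pM2l|lra].
pose S := \sum_(c <- vs) cmod c.
have S0 : 0 <= S by rewrite sumr_ge0// => c _; exact: cmod_ge0.
pose B := nm X0 + e1 + 1.
have B0 : 1 <= B by rewrite /B; have := nm_ge0 X0; lra.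
pose e3 := Num.min e1 (Num.min (e2 / 2) (r / 2)).
have e30 : 0 < e3 by rewrite !lt_min e10 !divr_gt0.
have [e31 [e32 e33]] : e3 <= e1 /\ e3 <= e2 / 2 /\ e3 <= r / 2.
  by rewrite /e3 !ge_min !lexx !orbT.
(* Step of the differences relative to [d]: the evaluation points keep parameters below [d] and stay
   within [e3 / 2] of [z]. *)
pose h0 := Num.min 1 (e3 / 2) / ((S + 1) * B).
have SB : 0 < (S + 1) * B by rewrite mulr_gt0; lra.
have h00 : 0 < h0 by rewrite divr_gt0// lt_min ltr01 divr_gt0.
have h0SB : h0 * ((S + 1) * B) <= 1 /\ h0 * ((S + 1) * B) <= e3 / 2.
  by rewrite /h0 divfK ?gt_eqF// !ge_min !lexx orbT.
clearbody h0 e3.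
pose k := size vs.
(* The first summand beats the finite-difference inequality, the second ensures [s <= 1] and
   [s * nm N < e2 / 2], and the last makes the contradiction strict. *)
pose K := 2 ^+ k * (16 * Cn') / (r * h0 ^+ k * `|L|) + 8 / r * (1 + nm N * 2 / e2) + 1.
have p1 : 0 <= 2 ^+ k * (16 * Cn') / (r * h0 ^+ k * `|L|).
  by rewrite divr_ge0 ?mulr_ge0 ?exprn_ge0// ltW.
have nN0 : 0 <= nm N * 2 / e2 by rewrite divr_ge0 ?mulr_ge0 ?nm_ge0// ltW.
have r80 : 0 < 8 / r by rewrite divr_gt0.
have p2 : 0 <= 8 / r * (1 + nm N * 2 / e2) by apply: mulr_ge0; [exact: ltW|exact: addr_ge0].
have K0 : 0 < K by rewrite /K; lra.
exists (e3 / 2), k, K; split=> //; first by lra.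
move=> z X d zz XX Dz /andP[d0 d1] disc_in; apply: contrapT => nB.
have dk1 : d ^+ k <= 1 by rewrite exprn_ile1// ltW.
have dk0 : 0 < d ^+ k by rewrite exprn_gt0.
set s0 := d ^+ k / K in nB.
have s00 : 0 < s0 by rewrite divr_gt0.
(* With this [s] the radius $sr/4$ of [rho_bound] is [2 * s0], the doubled radius in
   [inball_harnack]. *)
pose s := 8 * s0 / r.
have sr : s * r / 4 = 2 * s0 by rewrite /s; field; rewrite gt_eqF.
have s_pos : 0 < s by apply: divr_gt0 => //; exact: mulr_gt0.
have sK : s * K <= 8 / r.
  rewrite /s /s0.
  have -> : 8 * (d ^+ k / K) / r * K = 8 / r * d ^+ k by field; rewrite !gt_eqF.
  by rewrite ler_piMr// ltW.
have q1 : 8 / r <= K * 1.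
  rewrite mulr1 /K -[X in X <= _]add0r -addrA; apply: lerD => //.
  apply: (@le_trans _ _ (8 / r * (1 + nm N * 2 / e2))); last by rewrite lerDl.
  by rewrite ler_peMr ?(ltW r80)// lerDl.
have s1 : s <= 1.
  by have := le_trans sK q1; rewrite (mulrC K) ler_pM2r.
have sN : s * nm N < e2 / 2.
  have : s * nm N * K <= 8 / r * nm N by rewrite mulrAC ler_wpM2r ?nm_ge0.
  have : 8 / r * nm N < e2 / 2 * K.
    have -> : 8 / r * nm N = e2 / 2 * (8 / r * (nm N * 2 / e2)) by field; rewrite !gt_eqF.
    rewrite ltr_pM2l ?divr_gt0//; rewrite /K.
    have -> : 8 / r * (1 + nm N * 2 / e2) = 8 / r + 8 / r * (nm N * 2 / e2) by ring.
    by move: p1 r80; move: (8 / r) (8 / r * (nm N * _ / _)) (2 ^+ k * _ / _) => a b c; clear; lra.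
  by move=> H1 H2; rewrite -(@ltr_pM2r _ K)//; exact: le_lt_trans H2 H1.
have nmX : nm X <= B.
  have := nmD (X - X0) X0; rewrite subrK /B; move: XX e31 e30; clear.
  by move: (nm X) (nm X0) (nm _) => a b c; clear; lra.
have hS : d * h0 * S < d.
  rewrite -[ltRHS]mulr1 -mulrA ltr_pM2l//.
  apply: (@lt_le_trans _ _ (h0 * ((S + 1) * B))); last by case: h0SB.
  by rewrite ltr_pM2l//; clear -h00 S0 B0; nra.
have hSX : d * h0 * S * nm X <= e3 / 2.
  apply: (@le_trans _ _ (h0 * ((S + 1) * B))); last by case: h0SB.
  have : d * h0 * S * nm X <= 1 * (h0 * S * nm X).
    by rewrite -!mulrA; apply: ler_wpM2r => //; apply: mulr_ge0;
      [exact: ltW|apply: mulr_ge0 => //; exact: nm_ge0].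
  rewrite mul1r => /le_trans; apply; rewrite -mulrA ler_pM2l//.
  by apply: ler_pM => //; [exact: nm_ge0|clear -S0; lra].
(* Reversed, to undo the reversal in [iter_fdiff_mvt]. *)
pose cs := [seq rtoc (d * h0) * c | c <- rev vs].
have csS : \sum_(c <- cs) cmod c = d * h0 * S.
  rewrite /cs big_map; under eq_bigr do rewrite cmodM cmod_rtoc.
  rewrite -mulr_sumr ger0_norm ?mulr_ge0 ?ltW// /S; congr (_ * _).
  exact/perm_big/permEl/perm_rev.
pose ws := [seq c *: X | c <- cs].
have totE : tot ws = d * h0 * S * nm X.
  rewrite /tot /ws big_map; under eq_bigr do rewrite nmZ.
  by rewrite -mulr_suml csS.
(* If the ball at [z] is small then, by Harnack, so are the balls at all points of the disc; this bounds
   the finite difference, whereas the mean value theorem makes it comparable to its step. *)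
have fd_le : `|iter_fdiff ws rho z| <= 2 ^+ size cs * (s * Cn').
  apply: iter_fdiff_le => zeta; rewrite csS => Hz.
  have zd : cmod zeta < d by apply: le_lt_trans Hz _.
  have nz : nm (z + zeta *: X - z0) < e3.
    rewrite addrAC; apply: le_lt_trans (nmD _ _) _; rewrite nmZ.
    have : cmod zeta * nm X <= d * h0 * S * nm X by rewrite ler_wpM2r ?nm_ge0.
    clear -zz hSX Hz; lra.
  apply: rho_bound => //; [clear -nz e32; lra|clear -nz e33; lra|by rewrite s_pos| |].
    exact: disc_in.
  rewrite sr => Bw; apply: nB; apply: inball_harnack Bw => //.
  by rewrite -scaleNr; apply: disc_in; rewrite cmodN.
have [xi Hxi E] : exists2 xi, nm (xi - z) <= tot ws &
    iter_fdiff ws rho z = iter_real_derive (rev ws) rho xi.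
  apply: (iter_fdiff_mvt srho) => x Hx; apply: (He2 _ _).1.
  by apply: le_lt_trans (nm_tri _ z _) _; clear -Hx totE hSX zz e32 e20; lra.
have xiz : nm (xi - z0) < e3.
  by apply: le_lt_trans (nm_tri _ z _) _; clear -Hxi totE hSX zz; lra.
have Uxi : U xi by apply: (He2 _ _).1; clear -xiz e32 e20; lra.
have wsE : rev ws = [seq rtoc (d * h0) *: u | u <- [seq c *: X | c <- vs]].
  rewrite /ws /cs -!map_rev revK -!map_comp; apply: eq_map => c /=.
  by rewrite scalerA.
have low : (d * h0) ^+ k * (`|L| / 2) <= 2 ^+ k * (s * Cn').
  have szc : size cs = k by rewrite size_map size_rev.
  rewrite szc in fd_le; apply: le_trans fd_le.
  rewrite E wsE (iter_real_derive_scale _ _ oU srho Uxi) !size_map normrM ger0_norm.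
    rewrite ler_wpM2l// ?exprn_ge0 ?mulr_ge0 ?ltW//.
    by apply: He1; clear -xiz e31 XX e30; lra.
  by rewrite exprn_ge0 ?mulr_ge0 ?ltW.
have : K * (r * h0 ^+ k * `|L|) <= 2 ^+ k * (16 * Cn').
  have := low; rewrite exprMn /s /s0 => H.
  have hk : 0 < h0 ^+ k by rewrite exprn_gt0.
  have q : d ^+ k * (K * (r * h0 ^+ k * `|L|)) <= d ^+ k * (2 ^+ k * (16 * Cn')).
    have KR : 0 < 2 * K * r by rewrite !mulr_gt0.
    have := ler_wpM2l (ltW KR) H.
    have -> : 2 * K * r * (2 ^+ k * (8 * (d ^+ k / K) / r * Cn')) = d ^+ k * (2 ^+ k * (16 * Cn')).
      by field; rewrite !gt_eqF.
    have -> : 2 * K * r * (d ^+ k * h0 ^+ k * (`|L| / 2)) = d ^+ k * (K * (r * h0 ^+ k * `|L|)).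
      by field.
    by [].
  by rewrite ler_pM2l in q.
have den : 0 < r * h0 ^+ k * `|L| by rewrite !mulr_gt0// exprn_gt0.
rewrite -ler_pdivlMr// /K; move: p2; move: (2 ^+ k * _ / _) (8 / r * _) => a b; clear; lra.
Qed.

End type_estimate.

(** * Visibility *)

Section real_sums.
Context (R : realType).

Definition ndist (k l : nat) := (k - l + (l - k))%N.

Lemma geometric_ndist (theta : R) k0 N : 0 < theta < 1 ->
  (1 - theta) * \sum_(k < N) theta ^+ ndist k k0 <= 2.
Proof.
move=> /andP[t0 t1].
(* A telescoping majorant: its increments are the terms $(1-\theta)\theta^{|N-k_0|}$, except at
   [k0], where there is slack. *)
pose f N := if (N <= k0)%N then theta ^+ (k0 - N).+1 else 2 - theta ^+ (N - k0).
have H : (1 - theta) * \sum_(k < N) theta ^+ ndist k k0 <= f N.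
  elim: N => [|N IH]; first by rewrite big_ord0 mulr0 /f leq0n exprn_ge0// ltW.
  rewrite big_ord_recr /= mulrDr.
  suff : (1 - theta) * theta ^+ ndist N k0 <= f N.+1 - f N by move: IH; clear; lra.
  rewrite /f /ndist; have [Nk|kN|->] := ltngtP N k0.
  - rewrite (eqP (ltnW Nk : N - k0 == 0)%N) add0n -(subnSK Nk) !exprS.
    by clear; lra.
  - rewrite (eqP (ltnW kN : k0 - N == 0)%N) addn0 subSn ?(ltnW kN)// exprS; clear; lra.
  - rewrite subnn addn0 subSnn !expr1 expr0; clear -t1; lra.
apply: le_trans H _; rewrite /f; case: ifP => _.
  by apply: (@le_trans _ _ 1); [rewrite exprn_ile1 ?(ltW t0) ?(ltW t1)|clear; lra].
by rewrite gerBl exprn_ge0// ltW.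
Qed.

Lemma interval_avoiding (s : seq R) (a : R) : 0 < a ->
  exists r1 r2 : R, [/\ 0 < r1, r1 < r2, r2 <= a & forall x, x \in s -> ~ (r1 <= x <= r2)].
Proof.
move=> a0; elim: s => [|x s [r1 [r2 [r10 r12 r2a H]]]].
  by exists (a / 2), a; split=> //; lra.
have [xm|mx] := ltP x ((r1 + r2) / 2).
  exists ((r1 + r2) / 2), r2; split=> [||//|y]; try lra.
  rewrite inE => /orP[/eqP ->|/H Hy] /andP[y1 y2]; first by lra.
  by apply: Hy; rewrite y2 andbT; lra.
(* Here [x] may be the midpoint itself, so the closed left interval has to stop strictly before
   it. *)
exists r1, ((3 * r1 + r2) / 4); split=> [//|||y]; try lra.
rewrite inE => /orP[/eqP ->|/H Hy] /andP[y1 y2]; first by lra.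
by apply: Hy; rewrite y1 /=; lra.
Qed.

Lemma maximum_upto (f : nat -> R) N : exists2 k0, (k0 <= N)%N & forall k, (k <= N)%N -> f k <= f k0.
Proof.
elim: N => [|N [k0 k0N H]]; first by exists 0%N => // k; rewrite leqn0 => /eqP ->.
have [le|lt] := leP (f N.+1) (f k0).
  exists k0 => [|k]; first exact: leqW.
  by rewrite leq_eqVlt => /orP[/eqP ->//|]; rewrite ltnS => /H.
exists N.+1 => // k; rewrite leq_eqVlt => /orP[/eqP ->//|]; rewrite ltnS => /H Hk.
by apply: le_trans Hk _; exact: ltW.
Qed.

Definition clamp (r1 r2 u : R) := Num.max r1 (Num.min r2 u).

Lemma clamp_lip r1 r2 u v : r1 <= r2 -> `|clamp r1 r2 u - clamp r1 r2 v| <= `|u - v|.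
Proof.
wlog uv : u v / u <= v => [H r12|r12].
  have [/H|/ltW/H/(_ r12)] := leP u v; first exact.
  by rewrite distrC (distrC v).
rewrite [leRHS]distrC (ger0_norm (_ : 0 <= v - u)) ?subr_ge0// ler_norml /clamp.
case: (leP r2 u) => h1; case: (leP r2 v) => h2; rewrite ?(max_r r12);
  case: (leP r1 u) => h3; case: (leP r1 v) => h4; apply/andP; split; lra.
Qed.

(** As [a <= b], both logarithms are at most the one with [a]; solving for [a] halves the rate,
    whence [8 * M] from [4 * M]. *)
Lemma ln_decay (a b r M t : R) : 0 < a -> a <= b -> b <= r -> 0 < M ->
  t <= 4 * M / r * (ln (8 * r / a) + ln (8 * r / b)) -> a <= 8 * r * expR (- t / (8 * M / r)).
Proof.
move=> a0 ab br M0 H.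
have b0 : 0 < b := lt_le_trans a0 ab.
have r0 : 0 < r := lt_le_trans b0 br.
have r8 : 0 < 8 * r by rewrite mulr_gt0.
have lyx : ln (8 * r / b) <= ln (8 * r / a).
  by rewrite ler_ln ?posrE ?divr_gt0// ler_pM2l// lef_pV2 ?posrE.
have k0 : 0 < 8 * M / r by rewrite divr_gt0// mulr_gt0.
have tl : t / (8 * M / r) <= ln (8 * r / a).
  rewrite ler_pdivrMr//; apply: le_trans H _.
  have -> : ln (8 * r / a) * (8 * M / r) = 4 * M / r * (ln (8 * r / a) + ln (8 * r / a)).
    by clear; ring.
  by rewrite ler_pM2l ?lerD2l// divr_gt0// mulr_gt0.
have : expR (- ln (8 * r / a)) <= expR (- t / (8 * M / r)).
  by rewrite ler_expR mulNr lerN2.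
rewrite expRN lnK ?posrE ?divr_gt0// invf_div => /(ler_wpM2l (ltW r8)).
by rewrite [leLHS]mulrC divfK ?gt_eqF.
Qed.

Lemma clamp_lo r1 r2 u : r1 <= r2 -> u <= r1 -> clamp r1 r2 u = r1.
Proof. by move=> r12 ur; apply: max_l; rewrite ge_min ur orbT. Qed.

Lemma clamp_hi r1 r2 u : r1 <= r2 -> r2 <= u -> clamp r1 r2 u = r2.
Proof. by move=> r12 ru; rewrite /clamp (min_l ru) (max_r r12). Qed.

Lemma ndistE k l : `|k%:R - l%:R| = (ndist k l)%:R :> R.
Proof.
rewrite /ndist; have [kl|lk] := leqP k l.
  by rewrite (eqP (kl : k - l == 0)%N) distrC natrB// ger0_norm// subr_ge0 ler_nat.
have {}lk := ltnW lk.
by rewrite (eqP (lk : l - k == 0)%N) addn0 natrB// ger0_norm// subr_ge0 ler_nat.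
Qed.

(** In $m^{2j}\le j^2\delta^2$ one factor [delta] is bounded by [eta] and the other by the decay;
    the bound on [eta] is chosen so that the product is at most $(\varepsilon\theta^k)^{2j}$. *)
Lemma root_bound (m delta eta eps theta r : R) (j k : nat) : (0 < j)%N -> 0 <= m -> 0 < eps ->
  0 < theta -> 0 < r -> m ^+ j / j%:R <= delta -> delta <= eta ->
  delta <= 8 * r * (theta ^+ (2 * j)) ^+ k -> eta <= eps ^+ (2 * j) / (8 * j%:R ^+ 2 * r) ->
  m <= eps * theta ^+ k.
Proof.
move=> j0 m0 e0 t0 r0 md de dk he.
have jR : 0 < j%:R :> R by rewrite ltr0n.
rewrite ler_pdivrMr// in md.
have d0 : 0 <= delta by rewrite -(pmulr_lge0 _ jR); apply: le_trans md; rewrite exprn_ge0.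
have den : 0 < 8 * j%:R ^+ 2 * r by rewrite !mulr_gt0.
rewrite ler_pdivlMr// in he.
have th0 : 0 < (theta ^+ (2 * j)) ^+ k by rewrite !exprn_gt0.
rewrite -(@ler_pXn2r _ (2 * j)) ?muln_gt0// ?nnegrE ?mulr_ge0 ?exprn_ge0 ?(ltW e0) ?(ltW t0)//.
rewrite exprMn -exprM (mulnC k) (exprM theta).
apply: (@le_trans _ _ ((delta * j%:R) ^+ 2)).
  by rewrite mulnC exprM ler_pXn2r// nnegrE ?exprn_ge0// mulr_ge0// ltW.
apply: (@le_trans _ _ (eta * (8 * j%:R ^+ 2 * r) * (theta ^+ (2 * j)) ^+ k)).
  have -> : (delta * j%:R) ^+ 2 = j%:R ^+ 2 * (delta * delta) by rewrite exprMn mulrC expr2.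
  have -> : eta * (8 * j%:R ^+ 2 * r) * (theta ^+ (2 * j)) ^+ k =
    j%:R ^+ 2 * (eta * (8 * r * (theta ^+ (2 * j)) ^+ k)) by ring.
  by apply: ler_wpM2l; [rewrite exprn_ge0// ltW|exact: ler_pM].
by apply: ler_wpM2r => //; exact: ltW.
Qed.

End real_sums.

Lemma nm_sub_continuous (R : realType) (V : normedModType (cplx R)) (p : V) :
  continuous (fun z : V => nm (z - p)).
Proof.
move=> z; apply/cvgrPdist_lt => e e0; apply/nbhs_nm; exists e => // y yz /=.
by apply: le_lt_trans (nm_dist _ _) _; rewrite opprB addrA subrK nmC.
Qed.

(** * Distance to the boundary along a sampled geodesic *)

Section boundary_distance.
Context (R : realType) (n : nat).
Local Notation C := (cplx R).
Local Notation Cn := 'rV[C]_n.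
Implicit Types (D : set Cn) (p q z w x y X o : Cn).

Definition bdist D z : R := inf [set nm (w - z) | w in ~` D].

(** For an empty complement [inf] would take its default value 0 although every ball fits. *)
Lemma inball_bdist D z (s : R) : ~` D !=set0 -> inball D z s <-> s <= bdist D z.
Proof.
move=> [w0 nDw0]; split=> [B|sd w wz].
  apply: lb_le_inf; first by exists (nm (w0 - z)), w0.
  by move=> _ [w nDw <-]; rewrite leNgt; apply/negP => /B.
apply: contrapT => nDw; have : bdist D z <= nm (w - z).
  apply: ge_inf; last by exists w.
  by exists 0 => _ [v _ <-]; exact: nm_ge0.
by move=> H; have := lt_le_trans wz (le_trans sd H); rewrite ltxx.
Qed.

(** Supplies the compact set of the visibility property, the points at depth at least [s]. *)
Lemma compact_inball D (s M : R) : (forall z, D z -> nm z <= M) -> 0 < s ->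
  compact [set z | inball D z s].
Proof.
move=> DM s0; apply: (@Cn_compact _ _ _ M) => [z Hz w wz|z /(inball_center s0)/DM//].
have e0 : 0 < s - nm (w - z) by rewrite subr_gt0.
have [y [By yz]] : [set y | inball D y s] `&` [set y | nm (y - z) < s - nm (w - z)] !=set0.
  by apply: Hz; apply/nbhs_nm; exists (s - nm (w - z)).
apply: By; apply: le_lt_trans (nm_tri _ z _) _; rewrite (nmC z) /= in yz *.
by rewrite -ltrBrDl.
Qed.

(** Compactness of [S] times the unit sphere of directions. Since [d <= 1], a local exponent and a
    local constant are both absorbed by every large [j]. *)
Lemma type_uniform D (S : set Cn) o (r : R) : rconvex D -> open D -> 0 < r -> inball D o r ->
  compact S -> (forall z, S z -> ~ D z -> finite_type D z) ->
  exists2 j, (0 < j)%N & forall z X (d : R), S z -> D z -> nm X = 1 -> 0 < d <= 1 ->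
    (forall zeta : C, cmod zeta < d -> D (z + zeta *: X)) -> inball D z (d ^+ j / j%:R).
Proof.
move=> cD oD r0 Bo cS ftS.
have loc z0 X0 : S z0 -> X0 != 0 -> exists (e : R) (k : nat) (K : R), [/\ 0 < e, 0 < K &
    forall z X (d : R), nm (z - z0) < e -> nm (X - X0) < e -> D z -> 0 < d <= 1 ->
      (forall zeta : C, cmod zeta < d -> D (z + zeta *: X)) -> inball D z (d ^+ k / K)].
  move=> Sz0 X00; have [Dz0|nDz0] := pselect (D z0); last first.
    exact: type_local cD r0 Bo nDz0 (ftS _ Sz0 nDz0) X00.
  have [s s0 Bs] := open_inball oD Dz0.
  (* Exponent 0: near an interior point a ball of fixed radius fits, whatever the disc. *)
  exists (s / 2), 0%N, (s / 2)^-1; split; [by rewrite divr_gt0|by rewrite invr_gt0 divr_gt0|].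
  move=> z X d zz _ _ _ _ w; rewrite expr0 div1r invrK => wz; apply: Bs.
  by apply: le_lt_trans (nm_tri _ z _) _; lra.
have cSph : compact [set X : Cn | nm X = 1].
  apply: (@Cn_compact _ _ _ 1) => [|X /= ->//].
  apply: (@closed_comp _ _ (@nm R Cn) [set 1 : R]); first by move=> x _; exact: nm_continuous.
  exact: closed_eq.
pose P (j : nat) (zX : Cn * Cn) := forall d : R, D zX.1 -> 0 < d <= 1 ->
    (forall zeta : C, cmod zeta < d -> D (zX.1 + zeta *: zX.2)) -> inball D zX.1 (d ^+ j / j%:R).
have /compact_near_coveringP/(_ nat \oo P _) := compact_setX cS cSph.
case.
  move=> [z0 X0] [/= Sz0 X01].
  have X00 : X0 != 0 by rewrite -nm_gt0 X01.
  have [e [k [K [e0 K0 H]]]] := loc _ _ Sz0 X00.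
  exists ([set zX : Cn * Cn | nm (zX.1 - z0) < e /\ nm (zX.2 - X0) < e],
          [set j : nat | (maxn k (Num.trunc K).+1 <= j)%N]).
    split; last exact: nbhs_infty_ge.
    exists ([set z | nm (z - z0) < e], [set X | nm (X - X0) < e]); last by case.
    by split; apply/nbhs_nm; exists e.
  move=> [[z X] j] /= [[zz XX]]; rewrite geq_max => /andP[kj Kj].
  move=> d Dz d01 disc_in.
  apply: inballW (H z X d zz XX Dz d01 disc_in); move: d01 => /andP[d0 d1].
  have j0 : (0 < j)%N by exact: leq_trans Kj.
  have Kj' : K <= j%:R.
    apply: le_trans (ltW _) (_ : (Num.trunc K).+1%:R <= _); last by rewrite ler_nat.
    by have /andP[] := truncn_itv (ltW K0).
  apply: ler_pM; rewrite ?exprn_ge0 ?invr_ge0 ?(ltW d0)//.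
    by apply: ler_wiXn2l => //; exact: ltW.
  by rewrite lef_pV2 ?posrE// ltr0n.
move=> j _ /(_ j.+1 (leqnSn _)) Hj; exists j.+1 => // z X d Sz Dz X1.
exact: (Hj (z, X) (conj Sz X1)) Dz.
Qed.

(** A disc of relative radius [d] through the step fits in a bounded set, so a large [d] forces a
    short step. *)
Lemma dist_step D x y (d M : R) : open D -> rconvex D -> (forall z, D z -> nm z <= M) ->
  0 < d -> D x -> D y -> (kobayashi_dist D x y < (16 * (1 + 2 * d))^-1%:E)%E ->
  d * nm (y - x) <= 4 * M.
Proof.
move=> oD cD DM d0 Dx Dy kd.
have z1 : cmod (rtoc (d / 2) : C) < d by rewrite cmod_rtoc gtr0_norm ?divr_gt0//; lra.
have := disc_of_dist oD cD DM d0 Dx Dy kd z1 => /DM H.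
have := nmD (x + rtoc (d / 2) *: (y - x)) (- x).
rewrite addrAC subrr add0r nmN nmZ cmod_rtoc gtr0_norm ?divr_gt0//.
have := DM _ Dx; move: H; clear; set a := nm (_ + _); set b := nm x; set c := nm (y - x).
by clearbody a b c; lra.
Qed.

(** Because [1 <= d], the disc in the unit direction of $y-x$ has radius at least [nm (y - x)], and
    the type estimate applies with this radius. *)
Lemma inball_step D x y (j : nat) (d M : R) : open D -> rconvex D -> (forall z, D z -> nm z <= M) ->
  (forall X (e : R), nm X = 1 -> 0 < e <= 1 ->
    (forall zeta : C, cmod zeta < e -> D (x + zeta *: X)) -> inball D x (e ^+ j / j%:R)) ->
  1 <= d -> D x -> D y -> x != y -> nm (y - x) <= 1 ->
  (kobayashi_dist D x y < (16 * (1 + 2 * d))^-1%:E)%E -> inball D x (nm (y - x) ^+ j / j%:R).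
Proof.
move=> oD cD DM H d1 Dx Dy xy m1 kd.
have m0 : 0 < nm (y - x) by rewrite nm_gt0 subr_eq0 eq_sym.
have d0 : 0 < d by lra.
apply: (H (rtoc (nm (y - x))^-1 *: (y - x))); rewrite ?m0//.
  by rewrite nmZ cmod_rtoc gtr0_norm ?invr_gt0// mulVf// gt_eqF.
move=> zeta zm; rewrite scalerA.
apply: (disc_of_dist oD cD DM d0 Dx Dy kd).
rewrite cmodM cmod_rtoc gtr0_norm ?invr_gt0// ltr_pdivrMr//.
by apply: lt_le_trans zm _; rewrite ler_peMl// ltW.
Qed.

Lemma dist_decay D x y o (r M t : R) : rconvex D -> (forall z, D z -> nm z <= M) -> 0 < M ->
  0 < r -> inball D o r -> 0 < bdist D x -> bdist D x <= bdist D y -> bdist D y <= r ->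
  ~` D !=set0 -> kobayashi_dist D x y = t%:E ->
  bdist D x <= 8 * r * expR (- t / (8 * M / r)).
Proof.
move=> cD DM M0 r0 Bo dx dxy dyr nD kt.
have bx : 0 < bdist D x <= r by rewrite dx (le_trans dxy dyr).
have by' : 0 < bdist D y <= r by rewrite dyr (lt_le_trans dx dxy).
have := dist_le cD DM M0 bx by' Bo
  ((inball_bdist _ _ nD).2 (lexx _)) ((inball_bdist _ _ nD).2 (lexx _)).
rewrite kt lee_fin; move: (bdist D x) (bdist D y) dx dxy dyr => a b a0 ab br.
exact: ln_decay.
Qed.

(* [x k] are the sampled points, [k0] is the index at which the distance to the boundary is largest, and
   [chi] is the distance to [p] truncated to the shell. *)
Lemma geodesic_meets D p o (r r1 r2 M b : R) (j : nat) : open D -> rconvex D ->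
  (forall z, D z -> nm z <= M) -> 0 < M -> 0 < r -> inball D o r -> ~` D !=set0 -> (0 < j)%N ->
  r1 < r2 -> 0 < b ->
  (forall z X (d : R), r1 <= nm (z - p) <= r2 -> D z -> nm X = 1 -> 0 < d <= 1 ->
    (forall zeta : C, cmod zeta < d -> D (z + zeta *: X)) -> inball D z (d ^+ j / j%:R)) ->
  exists2 eta : R, 0 < eta & forall (L : R) (g : R -> Cn), 0 <= L -> geodesic D `[0, L] g ->
    nm (g 0 - p) <= r1 -> r2 + b <= nm (g L - p) ->
    exists2 t : R, 0 <= t <= L & inball D (g t) eta.
Proof.
move=> oD cD DM M0 r0 Bo nD j0 r12 b0 Hshell.
(* A step of size [c] cannot jump across the shell, is at most 1 as the type estimate asks, and is
   at most [b], which covers the part of the geodesic after the last sample. *)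
have [c [c0 cr [c1 cb]]] : exists c : R, [/\ 0 < c, c <= (r2 - r1) / 2 & c <= 1 /\ c <= b].
  exists (Num.min ((r2 - r1) / 2) (Num.min 1 b)).
  by rewrite !lt_min ltr01 b0 divr_gt0 ?subr_gt0// !ge_min !lexx !orbT.
have [d d1 dc] : exists2 d : R, 1 <= d & 4 * M <= c * d.
  exists (Num.max 1 (4 * M / c)); first by rewrite le_max lexx.
  by rewrite [leRHS]mulrC -ler_pdivrMr// le_max lexx orbT.
have d0 : 0 < d by lra.
pose T : R := (16 * (1 + 2 * d))^-1.
have T0 : 0 < T by rewrite invr_gt0; lra.
have [tau tau0 tauT] : exists2 tau : R, 0 < tau & tau < T.
  by exists (T / 2); [rewrite divr_gt0|rewrite ltr_pdivrMr// ltr_pMr// ltrDl].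
have a0 : 0 < 8 * M / r by rewrite divr_gt0// mulr_gt0.
have jR : 0 < j%:R :> R by rewrite ltr0n.
(* The $2j$-th root of the decay factor over one time step, in view of [root_bound]. *)
have [theta t01 thetaE] : exists2 theta : R, 0 < theta < 1 &
    theta ^+ (2 * j) = expR (- tau / (8 * M / r)).
  exists (expR (- tau / (8 * M / r) / (2 * j)%:R)); last first.
    by rewrite -expRM_natr divfK// pnatr_eq0 muln_eq0 /= -lt0n.
  rewrite expR_gt0 /= expR_lt1 !mulNr oppr_lt0 divr_gt0//.
    by rewrite divr_gt0.
  by rewrite ltr0n muln_gt0.
have /andP[t0 t1] := t01.
(* A two-sided geometric series is at most $2/(1-\theta)$, and two of them occur: with this [eps]
   they add up to at most half the width of the shell. *)
have [eps e0 epsE] : exists2 eps : R, 0 < eps & eps = (r2 - r1) / 8 * (1 - theta).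
  by exists ((r2 - r1) / 8 * (1 - theta)) => //; rewrite mulr_gt0 ?divr_gt0 ?subr_gt0.
pose eta0 := eps ^+ (2 * j) / (8 * j%:R ^+ 2 * r).
have eta00 : 0 < eta0 by rewrite divr_gt0 ?exprn_gt0// !mulr_gt0.
exists (Num.min r eta0) => [|L g L0 [gD gk] g0 gL]; first by rewrite lt_min r0.
apply: contrapT => nt.
have gin (t : R) : 0 <= t <= L -> `[0, L]%classic t by rewrite /= in_itv.
have gdist (t u : R) : 0 <= t <= L -> 0 <= u <= L -> kobayashi_dist D (g t) (g u) = `|t - u|%:E.
  by move=> /gin Ht /gin Hu; exact: gk.
have {gk} gDt (t : R) : 0 <= t <= L -> D (g t) by move=> /gin; exact: gD.
(* If no point has depth [eta], then $\delta<r$, as the upper bound for the distance requires, and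
   $\delta$ is below [eta0], as [root_bound] requires. *)
have bd (t : R) : 0 <= t <= L -> 0 < bdist D (g t) /\ bdist D (g t) < r /\ bdist D (g t) < eta0.
  move=> tL; split.
    have [s s0 Bs] := open_inball oD (gDt _ tL).
    exact: lt_le_trans s0 ((inball_bdist _ _ nD).1 Bs).
  apply/andP; rewrite -lt_min ltNge; apply/negP => /(inball_bdist _ _ nD) H.
  by apply: nt; exists t.
have gstep (t u : R) : 0 <= t <= L -> 0 <= u <= L -> `|t - u| <= tau ->
    (kobayashi_dist D (g t) (g u) < T%:E)%E /\ nm (g u - g t) <= c.
  move=> tL uL tu.
  have kd : (kobayashi_dist D (g t) (g u) < T%:E)%E.
    by rewrite gdist// lte_fin; exact: le_lt_trans tu tauT.
  split=> //; rewrite -(ler_pM2l d0); apply: le_trans (_ : 4 * M <= _); last by rewrite [leRHS]mulrC.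
  exact: dist_step oD cD DM d0 (gDt _ tL) (gDt _ uL) kd.
pose N := Num.trunc (L / tau).
have /andP[NL LN] : N%:R * tau <= L < N.+1%:R * tau.
  by rewrite -ler_pdivlMr// -ltr_pdivrMr//; apply: truncn_itv; rewrite divr_ge0// ltW.
pose x k := g (k%:R * tau).
have xL k : (k <= N)%N -> 0 <= k%:R * tau <= L.
  move=> kN; rewrite mulr_ge0 ?(ltW tau0)//=; apply: le_trans NL.
  by rewrite ler_pM2r// ler_nat.
have [k0 k0N k0max] := maximum_upto (fun k => bdist D (x k)) N.
have decay k : (k <= N)%N -> bdist D (x k) <= 8 * r * (theta ^+ (2 * j)) ^+ ndist k k0.
  move=> kN; have [dk _] := bd _ (xL _ kN); have [_ [dk0 _]] := bd _ (xL _ k0N).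
  have kd : kobayashi_dist D (x k) (x k0) = ((ndist k k0)%:R * tau)%:E.
    by rewrite gdist ?xL// -mulrBl normrM ndistE (gtr0_norm tau0).
  have := dist_decay cD DM M0 r0 Bo dk (k0max _ kN) (ltW dk0) nD kd.
  rewrite thetaE -expRM_natl.
  by have -> : (ndist k k0)%:R * (- tau / (8 * M / r)) = - ((ndist k k0)%:R * tau) / (8 * M / r)
    by rewrite mulrA mulrN.
have small k (m : R) : (k <= N)%N -> 0 <= m -> inball D (x k) (m ^+ j / j%:R) ->
    m <= eps * theta ^+ ndist k k0.
  move=> kN m0 /(inball_bdist _ _ nD) Bm; have [dk [_ dke]] := bd _ (xL _ kN).
  exact: root_bound j0 m0 e0 t0 r0 Bm (ltW dke) (decay _ kN) (lexx _).
pose chi k := clamp r1 r2 (nm (x k - p)).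
pose B k := eps * theta ^+ ndist k k0.
have B0 k : 0 < B k by rewrite mulr_gt0// exprn_gt0.
have chi_step k : (k < N)%N -> chi k.+1 - chi k <= B k + B k.+1.
  move=> kN; have tL := xL _ (ltnW kN); have uL := xL _ kN.
  have tu : `|k%:R * tau - k.+1%:R * tau| <= tau.
    by rewrite -mulrBl -natr1 opprD addNKr mulN1r normrN gtr0_norm.
  have [kd mc] := gstep _ _ tL uL tu.
  rewrite distrC in tu; have [kd' mc'] := gstep _ _ uL tL tu.
  rewrite -/(x k) -/(x k.+1) in kd mc kd' mc'.
  have Dx := gDt _ tL; have Dy := gDt _ uL; rewrite -/(x k) -/(x k.+1) in Dx Dy.
  apply: le_trans (ler_norm _) _.
  have [xy|xy] := eqVneq (x k) (x k.+1).
    by rewrite /chi xy subrr normr0 addr_ge0// ltW.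
  have lip : `|chi k.+1 - chi k| <= nm (x k.+1 - x k).
    apply: le_trans (clamp_lip _ _ (ltW r12)) _; apply: le_trans (nm_dist _ _) _.
    by rewrite opprB addrA subrK.
  have [sh|/negP nsh] := boolP (r1 <= nm (x k - p) <= r2).
    apply: le_trans lip _; apply: (@le_trans _ _ (B k)); last by rewrite lerDl ltW.
    apply: small (ltnW kN) (nm_ge0 _) _.
    exact: inball_step oD cD DM (fun X e => Hshell _ X e sh Dx) d1 Dx Dy xy (le_trans mc c1) kd.
  have [sh'|/negP nsh'] := boolP (r1 <= nm (x k.+1 - p) <= r2).
    apply: le_trans lip _; apply: (@le_trans _ _ (B k.+1)); last by rewrite lerDr ltW.
    rewrite nmC; apply: small kN (nm_ge0 _) _; rewrite eq_sym in xy.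
    exact: inball_step oD cD DM (fun X e => Hshell _ X e sh' Dy) d1 Dy Dx xy (le_trans mc' c1) kd'.
  (* Neither sample is in the shell: a step of at most half its width leaves both on the same side,
     where the truncation is constant. *)
  have near_a : `|nm (x k.+1 - p) - nm (x k - p)| <= (r2 - r1) / 2.
    apply: le_trans (nm_dist _ _) _; rewrite opprB addrA subrK.
    exact: le_trans mc cr.
  have -> : chi k.+1 = chi k.
    rewrite /chi; move: (nm (x k.+1 - p)) (nm (x k - p)) near_a nsh nsh' => u v.
    rewrite ler_norml => /andP[uv1 uv2] nu nv.
    have [vr|rv] := ltP v r1.
      have [ur|ru] := ltP u r1; first by rewrite !clamp_lo ?ltW.
      by exfalso; apply: nv; rewrite ru /=; clear -uv1 uv2 vr r12; lra.
    have {nu}rv2 : r2 < v by rewrite ltNge; apply/negP => h; apply: nu; rewrite rv.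
    have [ur|ru] := ltP r2 u; first by rewrite !clamp_hi ?ltW.
    by exfalso; apply: nv; rewrite ru andbT; clear -uv1 uv2 rv2 r12; lra.
  by rewrite subrr normr0 addr_ge0// ltW.
have chi0 : chi 0%N = r1.
  by apply: clamp_lo (ltW r12) _; rewrite /x mul0r.
have chiN : chi N = r2.
  apply: clamp_hi (ltW r12) _.
  have LL : 0 <= L <= L by rewrite L0 lexx.
  have NLt : `|L - N%:R * tau| <= tau.
    by rewrite ger0_norm ?subr_ge0// lerBlDl; apply: ltW; rewrite -natr1 mulrDl mul1r in LN.
  have [_ H] := gstep _ _ LL (xL _ (leqnn N)) NLt.
  have := le_trans (nm_tri _ (x N) _) (lerD (le_trans (_ : nm (g L - x N) <= c) cb) (lexx _)).
  by rewrite nmC => /(_ p H) H'; move: gL H'; clear; lra.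
have sum_le : chi N - chi 0%N <= \sum_(k < N) (B k + B k.+1).
  rewrite -(telescope_sumr _ (leq0n N)) big_mkord; apply: ler_sum => k _.
  exact: chi_step.
have G1 := geometric_ndist k0 N t01; have G2 := geometric_ndist k0 N.+1 t01.
move: sum_le; rewrite chi0 chiN big_split /= -!mulr_sumr epsE.
rewrite big_ord_recl /= mulrDr in G2.
have th0 : 0 <= (1 - theta) * theta ^+ ndist 0 k0 by rewrite mulr_ge0 ?subr_ge0 ?exprn_ge0 ?ltW.
set S1 := \sum_(k < N) _; set S2 := \sum_(k < N) _.
rewrite -/S1 -/S2 in G1 G2.
have : (r2 - r1) / 8 * ((1 - theta) * S1) <= (r2 - r1) / 8 * 2.
  by rewrite ler_pM2l// divr_gt0// subr_gt0.
have : (r2 - r1) / 8 * ((1 - theta) * S2) <= (r2 - r1) / 8 * 2.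
  rewrite ler_pM2l ?divr_gt0 ?subr_gt0//; move: G2 th0; clear; lra.
by move: r12; clear; rewrite !mulrA; lra.
Qed.

End boundary_distance.

Theorem theorem1p1 (R : realType) (n : nat) (D : set 'rV[cplx R]_n) :
  (0 < n)%N ->
  domain D ->
  bounded_set D ->
  convex_set (D : set (convex_lmodType 'rV[cplx R]_n)) ->
  smooth_boundary D ->
  finite_set (boundary D `\` [set p | finite_type D p]) ->
  visibility_property D.
Proof.
move=> _ [oD _ [x0 Do]] bD /convex_rconvex cD _ finB p q [clp nDp] [_ nDq] pq.
have [r r0 Bo] := open_inball oD Do.
have nD : ~` D !=set0 by exists p.
have [M M0 DM] : exists2 M : R, 0 < M & forall z, D z -> nm z <= M.
  have [m m0 Hm] := pinfty_ex_gt0 bD.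
  rewrite (ge0_rtoc (ltW m0)) in Hm.
  exists (complex.Re m); first by rewrite -rtoc_lt -(ge0_rtoc (ltW m0)).
  by move=> z /Hm /=; rewrite nmE rtoc_le.
pose l := nm (q - p).
have l0 : 0 < l by rewrite nm_gt0 subr_eq0 eq_sym; apply/eqP.
(* If [p] itself is exceptional it contributes the value 0, which the interval avoids because
   [0 < r1]. *)
have /finite_seqP[s sE] := finite_image (fun z => nm (z - p)) finB.
have [r1 [r2 [r10 r12 r2l Hs]]] := interval_avoiding s (ltac:(lra) : 0 < l / 2).
pose S := closure D `&` [set z | r1 <= nm (z - p) <= r2].
have cS : compact S.
  apply: (@Cn_compact _ _ _ (r2 + nm p)) => [|z [_ /andP[_ zr]]]; last first.
    by have := nmD (z - p) p; rewrite subrK; move: zr; clear; lra.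
  apply: closedI; first exact: closed_closure.
  rewrite (_ : mkset _ = (fun z : 'rV[cplx R]_n => nm (z - p)) @^-1` [set` `[r1, r2]%R]).
    apply: closed_comp; first by move=> z _; exact: nm_sub_continuous.
    exact: (@interval_closed R).
  by apply/seteqP; split=> z /=; rewrite in_itv.
have ftS z : S z -> ~ D z -> finite_type D z.
  move=> [clz zr] nDz; apply: contrapT => nft; apply: (Hs (nm (z - p))) zr.
  suff : [set` s] (nm (z - p)) by [].
  by rewrite -sE; exists z.
have [j j0 Hj] := type_uniform cD oD r0 Bo cS ftS.
have Hsh (z X : 'rV[cplx R]_n) (d : R) : r1 <= nm (z - p) <= r2 -> D z -> nm X = 1 -> 0 < d <= 1 ->
    (forall zeta, cmod zeta < d -> D (z + zeta *: X)) -> inball D z (d ^+ j / j%:R).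
  by move=> zr Dz; exact: Hj (conj (subset_closure Dz) zr) Dz.
(* The margin [l / 8] fits: a geodesic ending within $r_1/2$ of [q] has $|g(L)-p|>l-r_1/2>3l/4\ge
   r_2+l/8$. *)
have [eta eta0 H] := geodesic_meets oD cD DM M0 r0 Bo nD j0 r12 (ltac:(lra) : 0 < l / 8) Hsh.
exists [set z | nm (z - p) < r1 / 2], [set z | nm (z - q) < r1 / 2], [set z | inball D z eta].
split.
- by apply/nbhs_nm; exists (r1 / 2) => //; rewrite divr_gt0.
- by apply/nbhs_nm; exists (r1 / 2) => //; rewrite divr_gt0.
- apply/seteqP; split=> // z [zp zq].
  (* A common point of the closures is approximated from both sides within [l / 8], and $r_1+2\cdot
     l/8<l$. *)
  have l8 : 0 < l / 8 by lra.
  have [u [up uz]] : [set z | nm (z - p) < r1 / 2] `&` [set u | nm (u - z) < l / 8] !=set0.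
    by apply: zp; apply/nbhs_nm; exists (l / 8).
  have [v [vq vz]] : [set z | nm (z - q) < r1 / 2] `&` [set u | nm (u - z) < l / 8] !=set0.
    by apply: zq; apply/nbhs_nm; exists (l / 8).
  rewrite /= in up uz vq vz; rewrite nmC in vq; rewrite nmC in uz.
  have h : l < r1 / 2 + (l / 8 + (l / 8 + r1 / 2)).
    apply: le_lt_trans (nm_tri _ v _) _; apply: ltrD => //.
    apply: le_lt_trans (nm_tri _ z _) _; apply: ltrD => //.
    by apply: le_lt_trans (nm_tri _ u _) _; exact: ltrD.
  by move: h r12 r2l l0; move: (l) => l'; clear; lra.
- split; first exact: compact_inball DM eta0.
  by move=> z /(inball_center eta0).
move=> L g L0 geo /= g0 gL.
have [||t tL Bt] := H L g L0 geo; first by lra.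
  have h : l < r1 / 2 + nm (g L - p).
    apply: le_lt_trans (nm_tri _ (g L) _) _; rewrite nmC in gL.
    by apply: ltr_leD => //; exact: lexx.
  by move: h r12 r2l l0; move: (l) (nm _) => l' a; clear; lra.
by exists (g t); split=> //; exists t.
Qed.
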